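(* Let $\{X_u:u\in\Lambda^*\setminus\{\emptyset\}\}$ be i.i.d. copies of a nonnegative random variable $X$ with $\mathbb E(X)=1$, let $h_X=\mathbb E(X\log X)$, and let $Q$ be the associated Mandelbrot multiplicative cascade. Suppose that $\mathbb P(X\ne1)>0$. Let $\nu$ be a $\sigma$-ergodic Borel probability measure on $\Sigma$ satisfying property (G) of the context; if $Q=Q_{h_\nu(\sigma)}$, suppose that $\nu$ also satisfies property $(\widetilde{\rm G})$ of the context. If $h_\nu(\sigma)=h_X$, then $\nu$ is $Q$-singular.
   Context: Let $b\ge2$ be an integer, $\Lambda=\{0,\dots,b-1\}$, $\Lambda^*=\bigcup_{n\ge0}\Lambda^n$ the finite words, and $\Sigma=\Lambda^{\mathbb N}$ the space of sequences $x=x_1x_2\cdots$ with the product topology and Borel $\sigma$-field; $\sigma$ is the left shift on $\Sigma$. Write $x|_n=x_1\cdots x_n$, and let $[u]$ be the cylinder of sequences with prefix $u$. $\lambda$ is the uniform measure, $\lambda([u])=b^{-|u|}$. Convention: $0\log0=0$. For $n\ge1$ put $Q_n(\omega,x)=\prod_{k=1}^nX_{x|_k}(\omega)$. The measures $Q_n(\omega,\cdot)\,\nu$ almost surely converge weakly to a random measure $Q\cdot\nu$; $\nu$ is $Q$-singular if $Q\cdot\nu=0$ almost surely. For $\alpha>0$, ''$Q=Q_\alpha$'' means $\mathbb P(X=e^\alpha)=e^{-\alpha}$ and $\mathbb P(X=0)=1-e^{-\alpha}$. ''$\sigma$-ergodic'' means $\sigma$-invariant and ergodic. The entropy of $\nu$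 is $h_\nu(\sigma)=\lim_{n\to\infty}\frac1n\sum_{u\in\Lambda^n}-\nu([u])\log\nu([u])$. Property (G): there exist measurable functions $C\ge1$ and $f$ on $\Sigma$, finite $\nu$-almost everywhere, such that for $\nu$-almost every $x\in\Sigma$ and all $n\ge1$, $$C(x)^{-1}e^{\sum_{k=0}^{n-1}f(\sigma^kx)}\le\nu([x|_n])\le C(x)e^{\sum_{k=0}^{n-1}f(\sigma^kx)}.$$ Property $(\widetilde{\rm G})$: $\nu$ satisfies (G) and, if $\nu\ne\lambda$, then $\limsup_{n\to\infty}\sum_{k=0}^{n-1}\big(f(\sigma^kx)+h_\nu(\sigma)\big)=\infty$ for $\nu$-almost every $x$. *)

(* Defs.v *)
From HB Require Import structures.
From mathcomp Require Import all_boot all_order all_algebra.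
From mathcomp Require Import all_classical all_reals all_analysis.
From mathcomp Require Import measurable_realfun.

Set Implicit Arguments.
Unset Strict Implicit.
Unset Printing Implicit Defensive.

Import Order.TTheory GRing.Theory Num.Theory.
Import numFieldNormedType.Exports.

Local Open Scope classical_set_scope.
Local Open Scope ring_scope.

(* The set {0, ..., b-1}: the successor form b.-1.+1, equal to b when 0 < b,
   is there because measurable types must be pointed. *)
Definition alphabet (b : nat) : Type := 'I_(b.-1.+1).

HB.instance Definition _ (b : nat) := Finite.on (alphabet b).
HB.instance Definition _ (b : nat) := isPointed.Build (alphabet b) ord0.
HB.instance Definition _ (b : nat) :=
  hasNbhs.Build (alphabet b) principal_filter.
HB.instance Definition _ (b : nat) :=
  Discrete_ofNbhs.Build (alphabet b) erefl.

(* The n-th letter x_n of the usual 1-based notation is [x n.-1]. *)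
Definition seqspace (b : nat) : Type :=
  prod_topology (fun _ : nat => alphabet b).

HB.instance Definition _ (b : nat) := Pointed.on (seqspace b).
HB.instance Definition _ (b : nat) := Topological.on (seqspace b).
(* Borel sigma-field of the product topology *)
HB.instance Definition _ (b : nat) :=
  @isMeasurable.Build (sigma_display (@open (seqspace b))) (seqspace b)
    <<s @open (seqspace b) >> (@sigma_algebra0 _ setT _)
    (@sigma_algebraC _ _) (@sigma_algebra_bigcup _ setT _).

Section words.
Variable b : nat.

Definition initial_word (x : seqspace b) (n : nat) : seq (alphabet b) := mkseq x n.

Definition cylinder (u : seq (alphabet b)) : set (seqspace b) :=
  [set x | initial_word x (size u) = u].

Definition left_shift (x : seqspace b) : seqspace b := fun n => x n.+1.

End words.

Section shift_measures.
Variables (R : realType) (b : nat) (nu : probability (seqspace b) R).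

Definition shift_invariant : Prop :=
  forall A : set (seqspace b), measurable A ->
    nu (@left_shift b @^-1` A) = nu A.

Definition shift_ergodic : Prop :=
  shift_invariant /\
  forall A : set (seqspace b), measurable A -> @left_shift b @^-1` A = A ->
    nu A = 0%E \/ nu A = 1%E.

Definition cylmass (u : seq (alphabet b)) : R := fine (nu (cylinder u)).

(* [nu] is the measure lambda *)
Definition is_uniform : Prop :=
  forall u : seq (alphabet b), nu (cylinder u) = (b%:R ^- size u)%:E.

Definition entropy : R :=
  lim ((fun n : nat => n%:R^-1 *
          \sum_(u : n.-tuple (alphabet b)) - (cylmass u * ln (cylmass u)))
       @ \oo).

(* [fine] turns the values of the almost everywhere finite functions C and f
   into real numbers. *)
Definition gibbs (C f : seqspace b -> \bar R) : Prop :=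
  [/\ measurable_fun setT C, measurable_fun setT f,
      (forall x, (1 <= C x)%E),
      {ae nu, forall x, C x \is a fin_num /\ f x \is a fin_num} &
      {ae nu, forall x, forall n : nat, (0 < n)%N ->
        let S := \sum_(0 <= k < n) fine (f (iter k (@left_shift b) x)) in
        (fine (C x))^-1 * expR S <= cylmass (initial_word x n) /\
        cylmass (initial_word x n) <= fine (C x) * expR S}].

Definition propG : Prop := exists C f, gibbs C f.

Definition propGtilde : Prop :=
  exists C f, gibbs C f /\
    (~ is_uniform ->
     {ae nu, forall x,
       limn_esup (fun n : nat =>
         (\sum_(0 <= k < n)
            (fine (f (iter k (@left_shift b) x)) + entropy))%:E) = +oo%E}).

End shift_measures.

Section random_variables.
Variables (R : realType) (d : measure_display) (Omega : measurableType d).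
Variable P : probability Omega R.

Definition mutually_independent (I : eqType) (D : set I)
    (Y : I -> {RV P >-> R}) : Prop :=
  forall s : seq I, uniq s -> (forall i, i \in s -> D i) ->
  forall A : I -> set R, (forall i, measurable (A i)) ->
    P (\bigcap_(i in [set` s]) (Y i @^-1` A i)) =
    (\prod_(i <- s) P (Y i @^-1` A i))%E.

Definition iid_copies (d' : measure_display) (Omega' : measurableType d')
    (P' : probability Omega' R) (X : {RV P' >-> R})
    (I : eqType) (D : set I) (Y : I -> {RV P >-> R}) : Prop :=
  mutually_independent D Y /\
  forall i, D i -> forall A : set R, measurable A ->
    distribution P (Y i) A = distribution P' X A.

(* "Q = Q_a" for the cascade with weight X *)
Definition is_Q_alpha (X : {RV P >-> R}) (a : R) : Prop :=
  [/\ 0 < a,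
      P (X @^-1` [set expR a]) = (expR (- a))%:E &
      P (X @^-1` [set 0]) = (1 - expR (- a))%:E].

(* h_X = E(X log X); as ln 0 = 0, the convention 0 log 0 = 0 holds. *)
Definition hX (X : {RV P >-> R}) : \bar R :=
  ('E_P[(fun w => X w * ln (X w))%R])%E.

End random_variables.

Section cascade.
Variables (R : realType) (b : nat).
Variables (d : measure_display) (Omega : measurableType d).
Variables (P : probability Omega R) (Y : seq (alphabet b) -> {RV P >-> R}).
Variable nu : probability (seqspace b) R.

Definition Qn (n : nat) (w : Omega) (x : seqspace b) : R :=
  \prod_(1 <= k < n.+1) Y (initial_word x k) w.

(* Almost surely, the measures Q_n(w, .) nu converge weakly to the finite
   measure Qnu w.  Kernels from Omega are the random measures; continuous
   functions on the compact space [seqspace b] are bounded. *)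
Definition cascade_limit (Qnu : R.-ker Omega ~> seqspace b) : Prop :=
  {ae P, forall w, (Qnu w setT < +oo)%E /\
    forall phi : seqspace b -> R, continuous phi ->
      (fun n : nat => (\int[nu]_x (phi x * Qn n w x)%:E)%E) @ \oo -->
      (\int[Qnu w]_x (phi x)%:E)%E}.

Definition Q_singular : Prop :=
  exists Qnu : R.-ker Omega ~> seqspace b,
    cascade_limit Qnu /\
    {ae P, forall w, forall A, measurable A -> Qnu w A = 0%E}.

End cascade.

(* Main.v *)
(* The total mass M_n = sum_u nu[u] W_u (u of length n, W_u the product of the
   weights along u) is a nonnegative martingale, so by its maximal inequality
   M_n -> 0 almost surely as soon as E(M_n; max_(m <= n) M_m < K) -> 0 for
   every K.  Size-biasing along a spine x of law nu and using
   M_m >= nu[x|m] W_(x|m), this expectation is at most the probability that the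
   walk with steps f(sigma^k x) + log X_k, the X_k being independent and
   size-biased, stays below log (K C(x)) up to time n.  The steps have mean
   h_X - h_nu = 0.

   Let u(x,s) be the probability that the walk started at s stays negative for
   ever, and P the transition operator of the skew product.  Then u <= P u, so
   v = u^2 satisfies v <= (P u)^2 <= P v.  Integrating P v - v against
   nu x Lebesgue on s >= -L leaves only a flux through -L, which tends to minus
   the mean step times a constant as L -> oo.  Hence P v = v, and by the
   equality case of Jensen u(sigma x, s + f(x) + log X) does not depend on X.
   If log X is not constant under the size-biased law, the monotone function
   u(sigma x, .) has a period, and vanishes since it does for s >= 0.

   Otherwise X takes the values 0 and e^(h_nu).  If nu is not uniform, property
   (G~) makes the walk unbounded above.  If nu is uniform, M_n is the size of a
   critical Galton-Watson population, which dies out. *)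
Require Import Defs.
From HB Require Import structures.
From mathcomp Require Import all_boot all_order all_algebra.
From mathcomp Require Import all_classical all_reals all_analysis.
From mathcomp Require Import measurable_realfun.
From mathcomp Require Import ring lra.

Import Order.TTheory GRing.Theory Num.Theory.
Import numFieldNormedType.Exports.

Local Open Scope classical_set_scope.
Local Open Scope ring_scope.

Set Implicit Arguments.
Unset Strict Implicit.
Unset Printing Implicit Defensive.

(** * Cylinders and the shift *)

(** The steps f(sigma^k x) are merely stationary. Property (G) asserts neither integrability of f
    nor a bound on C, so the mean -h_nu of f has to be extracted from (G) itself, by comparing
    Birkhoff sums with the information -log nu[x|n] off sets of small measure where C is large.
    Recurrence of a centred walk is replaced by a conservation law. The survival probability u is
    only subharmonic because of the killing at 0, and it need not be integrable as s -> -oo; hence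
    the cut at -L and the flux through it. The constant in front of the mean step is the limit of v
    at -oo, which is sub-invariant under the shift and so almost everywhere constant by ergodicity.
    The square is needed for its strict convexity: P u = u would say nothing about how u(sigma x, s
    + f(x) + log X) depends on X, whereas P(u^2) = u^2 together with u <= P u forces its variance to
    be 0. Harmonicity is obtained only for almost every s, but the starting point -log(K C(x))
    depends on x; monotonicity in s turns the conclusion into one valid for every s. *)

Section symbolic_space.
Variable b : nat.
Local Notation E := (seqspace b).
Local Notation A := (alphabet b).

Lemma initial_wordS (x : E) n :
  initial_word x n.+1 = rcons (initial_word x n) (x n).
Proof. exact: mkseqS. Qed.

Lemma size_initial_word (x : E) n : size (initial_word x n) = n.
Proof. by rewrite size_mkseq. Qed.

Lemma take_initial_word (x : E) m n : (m <= n)%N ->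
  take m (initial_word x n) = initial_word x m.
Proof. by move=> mn; rewrite /initial_word /mkseq -map_take take_iota (minn_idPl mn). Qed.

Lemma open_measurable_seqspace (U : set E) : open U -> measurable U.
Proof. exact: sub_sigma_algebra. Qed.

Lemma coord_continuous i : continuous (fun x : E => x i).
Proof. exact: (@proj_continuous nat (fun _ => A) i). Qed.

Lemma measurable_cylinder (u : seq A) : measurable (cylinder u).
Proof.
rewrite (_ : cylinder u = \bigcap_(i in `I_(size u)) [set x : E | x i = nth point u i]).
  apply: bigcap_measurableType => i _; apply: open_measurable_seqspace.
  have /continuousP/(_ [set nth point u i]) := @coord_continuous i.
  by apply; exact: discrete_open.
apply/seteqP; split=> x /= => [xu i /= iu|xu].
  by rewrite -[in RHS]xu nth_mkseq.
apply: (@eq_from_nth _ point); rewrite ?size_mkseq // => i iu.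
by rewrite nth_mkseq // xu.
Qed.

Lemma left_shift_continuous : continuous (@left_shift b).
Proof.
move=> x.
have F : Filter (nbhs x) := nbhs_filter x.
have F' := fmap_filter (@left_shift b) F.
apply/cvg_sup => i U [V] [[W] oW <-] /= Wx WU.
have nW : nbhs (x i.+1) W by apply: open_nbhs_nbhs.
have := @coord_continuous i.+1 x W nW.
rewrite !nbhs_simpl /=.
exact: (@filterS _ (nbhs x) F _ _ (fun y Wy => WU _ Wy)).
Qed.

Lemma measurable_left_shift : measurable_fun setT (@left_shift b).
Proof.
apply: (@measurability _ _ _ _ _ _ (@open E)) => //.
move=> _ [B oB <-]; rewrite setTI; apply: open_measurable_seqspace.
by have /continuousP := left_shift_continuous; exact.
Qed.

Lemma measurable_iter_left_shift k :
  measurable_fun setT (iter k (@left_shift b)).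
Proof.
elim: k => [|k IH]; first exact: measurable_id.
exact: (measurableT_comp measurable_left_shift IH).
Qed.

Section integral.
Variables (R : realType) (nu : probability E R).

(** Cylinders of length n partition the space, so a function of the first n letters is a simple
    function; its measurability and its integral both come from this decomposition. *)
Lemma sum_cylinder_indic n (F : seq A -> \bar R) (x : E) :
  F (initial_word x n) =
  (\sum_(u : n.-tuple A) F u * (\1_(cylinder u) x)%:E)%E.
Proof.
have sz : size (initial_word x n) == n by rewrite size_initial_word.
rewrite (bigD1 (Tuple sz)) //= indicE mem_set ?mule1; last first.
  by rewrite /cylinder /= size_initial_word.
rewrite big1 ?adde0 // => u ux.
rewrite indicE memNset ?mule0 // /cylinder /= size_tuple => xu.
by move/eqP: ux; apply; apply: val_inj.
Qed.

Lemma measurable_initial_word n (F : seq A -> \bar R) :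
  measurable_fun setT (fun x : E => F (initial_word x n)).
Proof.
under eq_fun do rewrite sum_cylinder_indic.
apply: emeasurable_sum => u; apply: emeasurable_funM => //.
apply/measurable_EFinP; apply: measurable_indic; exact: measurable_cylinder.
Qed.

Lemma measurable_initial_wordR n (F : seq A -> R) :
  measurable_fun setT (fun x : E => F (initial_word x n)).
Proof.
by apply/measurable_EFinP; exact: (measurable_initial_word n (EFin \o F)).
Qed.

Lemma integral_initial_word n (F : seq A -> \bar R) : (forall u, 0 <= F u)%E ->
  (\int[nu]_x F (initial_word x n) =
   \sum_(u : n.-tuple A) F u * nu (cylinder u))%E.
Proof.
move=> F0; under eq_integral do rewrite sum_cylinder_indic.
have mc (u : n.-tuple A) : measurable_fun setT (fun x => (\1_(cylinder u) x : R)%:E).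
  apply/measurable_EFinP; apply: measurable_indic; exact: measurable_cylinder.
rewrite ge0_integral_sum //.
- apply: eq_bigr => u _; rewrite ge0_integralZl //.
    by rewrite integral_indic ?setIT //; exact: measurable_cylinder.
- by move=> u; apply: emeasurable_funM.
- by move=> u x _; rewrite mule_ge0.
Qed.

Lemma cylmassE (u : seq A) : nu (cylinder u) = (cylmass nu u)%:E.
Proof. by rewrite /cylmass fineK // fin_num_measure //; exact: measurable_cylinder. Qed.

Lemma cylmass_ge0 (u : seq A) : 0 <= cylmass nu u.
Proof. by rewrite -lee_fin -cylmassE. Qed.

Lemma cylmass_le1 (u : seq A) : cylmass nu u <= 1.
Proof.
by rewrite -lee_fin -cylmassE; apply: probability_le1; exact: measurable_cylinder.
Qed.

Lemma cylmass_nil : cylmass nu [::] = 1.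
Proof.
rewrite /cylmass (_ : cylinder [::] = setT) ?probability_setT //.
by apply/seteqP; split.
Qed.

Lemma cylmass_initial_word_nincr (x : E) m n : (m <= n)%N ->
  cylmass nu (initial_word x n) <= cylmass nu (initial_word x m).
Proof.
move=> mn; rewrite -lee_fin -!cylmassE; apply: le_measure.
- by rewrite inE; exact: measurable_cylinder.
- by rewrite inE; exact: measurable_cylinder.
move=> y; rewrite /cylinder /= !size_initial_word => yx.
by rewrite -(take_initial_word y mn) yx take_initial_word.
Qed.

End integral.
End symbolic_space.

(** * Random walks driven by an ergodic system *)

Section ergodic.
Context d (E : measurableType d) (R : realType) (nu : probability E R).
Variable T : E -> E.
Hypothesis mT : measurable_fun setT T.
Hypothesis T_inv : forall A, measurable A -> nu (T @^-1` A) = nu A.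
Hypothesis T_erg :
  forall A, measurable A -> T @^-1` A = A -> nu A = 0%E \/ nu A = 1%E.

Lemma preimage_measurable A : measurable A -> measurable (T @^-1` A).
Proof. by move=> mA; rewrite -[X in measurable X]setTI; exact: mT. Qed.

Lemma ge0_integral_invariant (F : E -> \bar R) : measurable_fun setT F ->
  (forall x, 0 <= F x)%E -> (\int[nu]_x F (T x) = \int[nu]_x F x)%E.
Proof.
move=> mF F0.
rewrite -[LHS](@ge0_integral_pushforward _ _ _ _ _ _ mT nu setT F) //.
by apply: eq_measure_integral => A mA _; exact: T_inv.
Qed.

Lemma ae_comp_invariant (P : set E) : {ae nu, forall x, P x} ->
  {ae nu, forall x, P (T x)}.
Proof.
move=> [N [mN N0 PN]]; exists (T @^-1` N); split.
- exact: preimage_measurable.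
- by rewrite T_inv.
- by move=> x /= nPx; apply: PN.
Qed.

Lemma ae_iter_invariant (P : set E) : {ae nu, forall x, P x} ->
  {ae nu, forall x, forall n, P (iter n T x)}.
Proof.
move=> aP; apply: ae_foralln => n.
elim: n => // n IH; have := ae_comp_invariant IH.
by apply: filterS => x; rewrite iterSr.
Qed.

(** Ergodicity speaks of sets equal to their preimage. The preimages of A under the iterates
    increase and share the measure of A, and their union is such a set. *)
Lemma subinvariant_01 A : measurable A -> A `<=` T @^-1` A ->
  nu A = 0%E \/ nu A = 1%E.
Proof.
move=> mA AT.
pose B n := (iter n T) @^-1` A.
have BS n : B n.+1 = T @^-1` B n.
  by apply/seteqP; split => x; rewrite /B /= -iterSr.
have mB n : measurable (B n).
  elim: n => // n IH; rewrite BS; exact: preimage_measurable.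
have nB n : nu (B n) = nu A.
  by elim: n => // n IH; rewrite BS T_inv.
have ndB : nondecreasing_seq B.
  apply/nondecreasing_seqP => n; apply/subsetPset => x Bx; exact: AT.
have mU : measurable (\bigcup_n B n) by exact: bigcupT_measurable.
have <- : nu (\bigcup_n B n) = nu A.
  have : (fun n => nu (B n)) @ \oo --> nu (\bigcup_n B n).
    exact: nondecreasing_cvg_mu.
  rewrite (_ : (fun n => nu (B n)) = fun=> nu A); last exact/funext.
  by move=> /cvg_lim <- //; rewrite lim_cst.
apply: T_erg => //; apply/seteqP; split => x [n _ Bx].
  by exists n.+1 => //; rewrite BS.
exists n => //; suff : (T @^-1` B n) x by [].
by rewrite -BS; move: x Bx; apply/subsetPset/ndB.
Qed.

Lemma ae_eq0_integral (h : E -> R) : nu.-integrable setT (EFin \o h) ->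
  {ae nu, forall x, 0 <= h x} -> (\int[nu]_x (h x)%:E = 0)%E ->
  {ae nu, forall x, h x = 0}.
Proof.
move=> ih h0 hi.
have mh := measurable_int nu ih.
have : (\int[nu]_x `|(h x)%:E| = 0)%E.
  rewrite -hi; apply: ae_eq_integral => //.
    exact: measurableT_comp.
  by apply: filterS h0 => x hx _; rewrite gee0_abs // lee_fin.
move/(ae_eq_integral_abs nu measurableT mh).
by apply: filterS => x /(_ I) [].
Qed.

(** The constant is the mean of w. The set where w is at least its mean is sub-invariant, so w minus
    its mean has a constant sign almost everywhere; its integral being 0, it vanishes. *)
Lemma subinvariant_ae_cst (w : E -> R) : measurable_fun setT w ->
  (forall x, 0 <= w x <= 1) -> (forall x, w x <= w (T x)) ->
  exists c, {ae nu, forall x, w x = c}.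
Proof.
move=> mw w01 wT.
have bi (c : R) : nu.-integrable setT (EFin \o (fun x => w x - c)).
  apply: measurable_bounded_integrable => //.
  - by apply: (le_lt_trans (probability_le1 _ _)); rewrite ?ltry.
  - exact: measurable_funB.
  - exists (1 + `|c|); split; rewrite ?num_real // => M Mc x _ /=.
    rewrite (le_trans (ler_normB _ _)) //.
    have /andP[w0 w1] := w01 x; rewrite ger0_norm //.
    by move: Mc; lra.
pose c := fine (\int[nu]_x (w x)%:E)%E.
have iw : nu.-integrable setT (EFin \o w).
  by have := bi 0; apply: eq_integrable => // x _ /=; rewrite subr0.
have ci : (\int[nu]_x (w x - c)%:E = 0)%E.
  under eq_integral do rewrite EFinB.
  rewrite integralB_EFin //; last exact: finite_measure_integrable_cst.
  by rewrite integral_cst //= probability_setT mule1 /c fineK ?subee //;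
    exact: integrable_fin_num.
exists c.
have mS : measurable [set x | c <= w x].
  by rewrite -[X in measurable X]setTI; exact: measurable_fun_ler.
suff : {ae nu, forall x, w x - c = 0}.
  by apply: filterS => x /eqP; rewrite subr_eq0 => /eqP.
have [S0|S1] : nu [set x | c <= w x] = 0%E \/ nu [set x | c <= w x] = 1%E.
- by apply: subinvariant_01 => // x /= /le_trans; apply.
- have wc : {ae nu, forall x, 0 <= c - w x}.
    exists [set x | c <= w x]; split => // x /= /negP; rewrite -ltNge.
    by lra.
  have : {ae nu, forall x, c - w x = 0}.
    apply: ae_eq0_integral => //.
      have := integrableN (bi c); apply: eq_integrable => // x _ /=.
      by rewrite opprB.
    under eq_integral do rewrite EFinB.
    rewrite integralB_EFin //; last exact: finite_measure_integrable_cst.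
    by rewrite integral_cst //= probability_setT mule1 /c fineK ?subee //;
      exact: integrable_fin_num.
  by apply: filterS => x /eqP; rewrite subr_eq0 => /eqP ->; rewrite subrr.
- apply: ae_eq0_integral => //.
  exists (~` [set x | c <= w x]); split => //; first exact: measurableC.
    by rewrite probability_setC // S1 subee.
  by move=> x /= ; apply: contra_not => cw; rewrite subr_ge0.
Qed.

End ergodic.

(** * Translations of Lebesgue measure and tails of monotone functions *)

Section lebesgue_translation.
Variable R : realType.
Local Notation mu := (@lebesgue_measure R).

Lemma lebesgue_measureD (c : R) (A : set R) : measurable A ->
  mu ((fun s : measurableTypeR R => s + c) @^-1` A) = mu A.
Proof.
have mc : measurable_fun setT (fun s : measurableTypeR R => (s + c : measurableTypeR R)).
  exact: measurable_funD.
move=> mA; apply/esym.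
rewrite -[RHS]/(pushforward mu (fun s : measurableTypeR R => s + c) A).
apply: (@lebesgue_measure_unique _ (pushforward mu
  (fun s : measurableTypeR R => (s + c : measurableTypeR R)))) => //= _ [[a b]] _ <-.
rewrite /pushforward.
rewrite (_ : _ @^-1` _ = `]a - c, b - c]%classic); last first.
  by apply/seteqP; split => s /=; rewrite !in_itv /= ltrBlDr lerBrDr.
rewrite !lebesgue_measure_itv /= !lte_fin ltrD2r -!EFinB.
by case: ifP => // _; congr EFin; lra.
Qed.

Lemma ge0_integral_translation (c : R) (F : R -> \bar R) :
  measurable_fun setT F -> (forall s, 0 <= F s)%E ->
  (\int[mu]_s F (s + c)%R = \int[mu]_s F s)%E.
Proof.
move=> mF F0.
have mc : measurable_fun setT (fun s : measurableTypeR R => (s + c : measurableTypeR R)).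
  exact: measurable_funD.
rewrite -[LHS](@ge0_integral_pushforward _ _ _ _ _ _ mc mu setT F) //.
by apply: eq_measure_integral => A mA _; exact: lebesgue_measureD.
Qed.

End lebesgue_translation.

Section tail.
Variable R : realType.
Local Notation mu := (@lebesgue_measure R).
Implicit Types (v : R -> R) (a : R).

(** The cut-off sits in the integrand, so that translation invariance and Tonelli's theorem apply on
    the whole line. For a nonincreasing v with values in [0, 1] that vanishes on s >= 0 the value is
    finite ([etailE]), and [tail] loses nothing. *)
Definition etail v a : \bar R := (\int[mu]_s (if a <= s then v s else 0)%:E)%E.
Definition tail v a : R := fine (etail v a).

Variable v : R -> R.
Hypothesis v01 : forall s, 0 <= v s <= 1.
Hypothesis v_ni : forall s s', s <= s' -> v s' <= v s.
Hypothesis v0 : forall s, 0 <= s -> v s = 0.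

Let mv : measurable_fun setT v.
Proof. by apply: nonincreasing_measurable => // s s' _ _; exact: v_ni. Qed.

Let mtail a : measurable_fun setT (fun s => (if a <= s then v s else 0)%:E).
Proof.
apply/measurable_EFinP; apply: measurable_fun_ifT => //.
exact: measurable_fun_ler.
Qed.

Let vi_ge0 a s : (0 <= (if a <= s then v s else 0)%:E)%E.
Proof. by rewrite lee_fin; case: ifP => // _; case/andP: (v01 s). Qed.

Lemma etail_translation a c :
  (\int[mu]_s (if a <= s then v (s + c) else 0)%:E)%E = etail v (a + c).
Proof.
rewrite /etail -(@ge0_integral_translation _ c _ (mtail (a + c))).
  by apply: eq_integral => s _; rewrite lerD2r.
exact: vi_ge0.
Qed.

Lemma etail_split a a' : a <= a' ->
  etail v a = (\int[mu]_(s in `[a, a'[) (v s)%:E + etail v a')%E.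
Proof.
move=> aa'.
rewrite [X in (X + _)%E]integral_mkcond -ge0_integralD; do ?exact: mtail; do ?by [].
- apply: eq_integral => s _; rewrite patchE mem_setE /= in_itv /=.
  have [as_|sa] := leP a s; have [a's|sa'] := leP a' s => //=; rewrite ?adde0 ?add0e //.
  by move: (lt_le_trans sa aa'); rewrite ltNge a's.
- move=> s _; rewrite patchE; case: ifP => // _.
  by rewrite lee_fin; case/andP: (v01 s).
- apply/(measurable_restrictT _ _).1 => //.
  by apply/measurable_EFinP; exact: measurable_funTS.
Qed.

Lemma integral_itv_bounds a a' : a <= a' ->
  (((a' - a) * v a')%:E <= \int[mu]_(s in `[a, a'[) (v s)%:E <=
   ((a' - a) * v a)%:E)%E.
Proof.
move=> aa'.
have L : mu `[a, a'[%classic = (a' - a)%:E.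
  rewrite lebesgue_measure_itv /= lte_fin -EFinB; case: ltgtP aa' => //= ->.
  by rewrite subrr.
have mvi : measurable_fun `[a, a'[%classic (fun s => (v s)%:E).
  by apply/measurable_EFinP; exact: measurable_funTS.
apply/andP; split.
- rewrite mulrC EFinM -L -integral_cst //.
  apply: ge0_le_integral => // s /=.
    by rewrite lee_fin; case/andP: (v01 a').
  by rewrite in_itv /= => /andP[_ /ltW]; rewrite lee_fin; exact: v_ni.
- rewrite mulrC EFinM -L -integral_cst //.
  apply: ge0_le_integral => // s /=.
    by rewrite lee_fin; case/andP: (v01 s).
  by rewrite in_itv /= => /andP[+ _]; rewrite lee_fin; exact: v_ni.
Qed.

Lemma etail_ge0 a : (0 <= etail v a)%E.
Proof.
by apply: integral_ge0 => s _; exact: vi_ge0.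
Qed.

Lemma etail_eq0 a : 0 <= a -> etail v a = 0%E.
Proof.
move=> a0; apply: integral0_eq => s _; case: ifP => // as_.
by rewrite v0 // (le_trans a0).
Qed.

Lemma etailE a : etail v a = (tail v a)%:E.
Proof.
rewrite /tail fineK // ge0_fin_numE ?etail_ge0 //.
have [a0|a0] := leP 0 a; first by rewrite etail_eq0 ?ltry.
rewrite (etail_split (ltW a0)) etail_eq0 // adde0.
have /andP[_ h] := integral_itv_bounds (ltW a0).
by rewrite (le_lt_trans h) // ltry.
Qed.

Lemma tail_ge0 a : 0 <= tail v a.
Proof. by rewrite -lee_fin -etailE etail_ge0. Qed.

Lemma tail_diff a a' : a <= a' ->
  (a' - a) * v a' <= tail v a - tail v a' <= (a' - a) * v a.
Proof.
move=> aa'; have := etail_split aa'; rewrite !etailE => h.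
have := integral_itv_bounds aa'.
rewrite (_ : (\int[mu]_(s in `[a, a'[) (v s)%:E)%E = (tail v a - tail v a')%:E).
  by rewrite !lee_fin.
by rewrite EFinB h addeK.
Qed.

(** As v is at most 1, the tail is 1-Lipschitz. The bound does not depend on [a], which makes it the
    dominating function when the cut-off tends to -oo. *)
Lemma tail_increment_le a c : `|tail v (a + c) - tail v a| <= `|c|.
Proof.
have /andP[v1 v2] := v01 a; have /andP[v3 v4] := v01 (a + c).
have [c0|c0] := leP 0 c.
  have /tail_diff : a <= a + c by rewrite lerDl.
  have -> : a + c - a = c by ring.
  rewrite distrC => /andP[h1 h2].
  rewrite (ger0_norm c0) ger0_norm; last by rewrite (le_trans _ h1) // mulr_ge0.
  by rewrite (le_trans h2) // ler_piMr.
have /tail_diff : a + c <= a by rewrite gerDl ltW.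
have -> : a - (a + c) = - c by ring.
move=> /andP[h1 h2]; have c0' : 0 <= - c by lra.
rewrite (ltr0_norm c0) ger0_norm; last by rewrite (le_trans _ h1) // mulr_ge0.
by rewrite (le_trans h2) // ler_piMr.
Qed.

Lemma tail_le a : tail v a <= `|a|.
Proof.
have := tail_increment_le 0 a; rewrite add0r [tail v 0]/tail etail_eq0 //= subr0.
by rewrite ger0_norm // tail_ge0.
Qed.

(** By [tail_diff], the increment lies between -c times the values of v at the two ends of the
    window, and both values tend to the limit l of v at -oo. *)
Lemma tail_increment_cvg (l c : R) :
  v (- n%:R) @[n --> \oo] --> l ->
  (tail v (- n%:R + c) - tail v (- n%:R)) @[n --> \oo] --> - (l * c).
Proof.
move=> vl.
have vcl : v (- n%:R + c) @[n --> \oo] --> l.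
  (* An integer bound for |c|: after shifting the index by k, the point -(n + k) + c lies between
     -(n + 2k) and -n, where monotonicity squeezes v. *)
  pose k := (Num.truncn `|c|).+1.
  have kc : `|c| <= k%:R by apply: ltW; exact: truncnS_gt.
  have [c1 c2] : - k%:R <= c /\ c <= k%:R by apply/andP; rewrite -ler_norml.
  rewrite -(cvg_shiftn k).
  apply: (squeeze_cvgr (f := fun n => v (- n%:R)) (h := fun n => v (- (n + 2 * k)%N%:R))).
  - apply: nearW => n; apply/andP; split; apply: v_ni; rewrite !natrD ?natrM; lra.
  - exact: vl.
  - by rewrite (cvg_shiftn (2 * k) (fun n => v (- n%:R))).
have lc w : w n @[n --> \oo] --> l -> - (w n * c) @[n --> \oo] --> - (l * c).
  by move=> h; apply: cvgN; apply: cvgMr_tmp.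
have [c0|c0] := leP 0 c.
- apply: (squeeze_cvgr (f := fun n => - (v (- n%:R) * c))
    (h := fun n => - (v (- n%:R + c) * c))); [|exact: lc|exact: lc].
  apply: nearW => n.
  have /tail_diff : - n%:R <= - n%:R + c by rewrite lerDl.
  by move=> /andP[h1 h2]; apply/andP; split; lra.
- apply: (squeeze_cvgr (f := fun n => - (v (- n%:R) * c))
    (h := fun n => - (v (- n%:R + c) * c))); [|exact: lc|exact: lc].
  apply: nearW => n.
  have /tail_diff : - n%:R + c <= - n%:R by rewrite gerDl ltW.
  by move=> /andP[h1 h2]; apply/andP; split; lra.
Qed.

End tail.

(** * Jensen's inequality for squares under the size-biased law *)

Section weighted_mean.
Context d (S : measurableType d) (R : realType) (P : probability S R).
Variable X : S -> R.
Hypothesis mX : measurable_fun setT X.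
Hypothesis X0 : forall t, 0 <= X t.
Hypothesis EX : (\int[P]_t (X t)%:E = 1)%E.

Lemma integrable_weight : P.-integrable setT (EFin \o X).
Proof.
apply/integrableP; split; first exact/measurable_EFinP.
under eq_integral do rewrite /= ger0_norm //.
by rewrite EX ltry.
Qed.

Lemma integrable_weight_bounded (h : S -> R) : measurable_fun setT h ->
  (forall t, 0 <= h t <= 1) -> P.-integrable setT (fun t => (X t * h t)%:E).
Proof.
move=> mh h01; apply: (le_integrable measurableT _ _ integrable_weight).
- by apply/measurable_EFinP; exact: measurable_funM.
- move=> t _; have /andP[h0 h1] := h01 t.
  by rewrite /= lee_fin !ger0_norm ?mulr_ge0 // ler_piMr.
Qed.

Lemma weighted_variance (h : S -> R) (p a : R) : measurable_fun setT h ->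
  (forall t, 0 <= h t <= 1) ->
  (\int[P]_t (X t * h t)%:E = p%:E)%E ->
  (\int[P]_t (X t * h t ^+ 2)%:E = a%:E)%E ->
  (\int[P]_t (X t * (h t - p) ^+ 2)%:E = (a - p ^+ 2)%:E)%E.
Proof.
move=> mh h01 hp ha.
have mh2 : measurable_fun setT (fun t => h t ^+ 2) by exact: measurable_funX.
have h201 t : 0 <= h t ^+ 2 <= 1.
  by have /andP[h0 h1] := h01 t; rewrite sqr_ge0 expr_le1.
have i1 := integrable_weight_bounded mh h01.
have i2 := integrable_weight_bounded mh2 h201.
have -> : (\int[P]_t (X t * (h t - p) ^+ 2)%:E =
   \int[P]_t ((X t * h t ^+ 2)%:E + ((- (2 * p))%:E * (X t * h t)%:E +
      (p ^+ 2)%:E * (X t)%:E)))%E.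
  by apply: eq_integral => t _; rewrite -!EFinM -!EFinD; congr EFin; ring.
have i3 := integrableZl measurableT (- (2 * p)) i1.
have i4 := integrableZl measurableT (p ^+ 2) integrable_weight.
rewrite integralD //; last exact: integrableD.
rewrite integralD // integralZl // integralZl //; last exact: integrable_weight.
by rewrite ha hp EX -!EFinM -!EFinD; congr EFin; ring.
Qed.

(** By [EX] the weight X defines a probability. Let p and a be the weighted means of h and h^2: then
    q <= p, and a - p^2 is a variance. If a <= q^2 <= p^2, this variance is 0, so h = p wherever X
    is nonzero. *)
Lemma weighted_jensen (h : S -> R) (q : R) : measurable_fun setT h ->
  (forall t, 0 <= h t <= 1) -> 0 <= q ->
  (q%:E <= \int[P]_t (X t * h t)%:E)%E ->
  ((q ^+ 2)%:E <= \int[P]_t (X t * h t ^+ 2)%:E)%E /\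
  ((\int[P]_t (X t * h t ^+ 2)%:E <= (q ^+ 2)%:E)%E ->
   exists p, {ae P, forall t, X t != 0 -> h t = p}).
Proof.
move=> mh h01 q0 qp.
have mh2 : measurable_fun setT (fun t => h t ^+ 2) by exact: measurable_funX.
have h201 t : 0 <= h t ^+ 2 <= 1.
  by have /andP[h0 h1] := h01 t; rewrite sqr_ge0 expr_le1.
have i1 := integrable_weight_bounded mh h01.
have i2 := integrable_weight_bounded mh2 h201.
have hp := esym (fineK (integrable_fin_num measurableT i1)).
have ha := esym (fineK (integrable_fin_num measurableT i2)).
move: hp ha; set p := fine _; set a := fine _ => hp ha.
have var := weighted_variance mh h01 hp ha.
move: qp; rewrite hp ha !lee_fin => qp.
have mvar : measurable_fun setT (fun t => (X t * (h t - p) ^+ 2)%:E).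
  apply/measurable_EFinP; apply: measurable_funM => //.
  by apply: measurable_funX; exact: measurable_funB.
have var0 t : 0 <= X t * (h t - p) ^+ 2 by rewrite mulr_ge0 // sqr_ge0.
have q2 : q ^+ 2 <= p ^+ 2 by rewrite ler_sqr ?nnegrE // (le_trans q0).
have : (0 <= (a - p ^+ 2)%:E)%E.
  by rewrite -var; apply: integral_ge0 => t _; rewrite lee_fin.
rewrite lee_fin => ap; split; first by lra.
move=> aq; exists p.
have : (\int[P]_t `|(X t * (h t - p) ^+ 2)%:E| = 0)%E.
  under eq_integral => t _ do rewrite gee0_abs ?lee_fin //.
  by rewrite var; congr EFin; lra.
move=> /(ae_eq_integral_abs P measurableT mvar).
apply: filterS => t /(_ I) [] /eqP.
rewrite mulf_eq0 expf_eq0 /= subr_eq0 => /orP[/eqP ->|/eqP //].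
by rewrite eqxx.
Qed.

End weighted_mean.

Section product_integrable.
Context d1 d2 (E : measurableType d1) (S : measurableType d2) (R : realType).
Variables (nu : probability E R) (P : probability S R).

Lemma integrable_prodM (a : E -> R) (c : S -> R) :
  nu.-integrable setT (EFin \o a) -> P.-integrable setT (EFin \o c) ->
  (nu \x P)%E.-integrable setT (fun z => (c z.2 * a z.1)%:E) /\
  (\int[nu \x P]_z (c z.2 * a z.1)%:E =
    (\int[nu]_x (a x)%:E) * (\int[P]_t (c t)%:E))%E.
Proof.
move=> ia ic.
have ma : measurable_fun setT a by apply/measurable_EFinP; exact: measurable_int ia.
have mc : measurable_fun setT c by apply/measurable_EFinP; exact: measurable_int ic.
have fc := integrable_fin_num measurableT ic.
have mz : measurable_fun setT (fun z : E * S => (c z.2 * a z.1)%:E).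
  apply/measurable_EFinP; apply: measurable_funM.
    by apply: measurableT_comp => //; exact: measurable_snd.
  by apply: measurableT_comp => //; exact: measurable_fst.
have iz : (nu \x P)%E.-integrable setT (fun z => (c z.2 * a z.1)%:E).
  apply/integrable12ltyP => //=.
  under eq_integral => x _.
    under eq_integral => t _ do rewrite normrM EFinM muleC.
    rewrite ge0_integralZl //; last 1 first.
    + by apply/measurable_EFinP; exact: measurableT_comp.
    over.
  rewrite ge0_integralZr //; last 2 first.
  - by apply/measurable_EFinP; exact: measurableT_comp.
  - by apply: integral_ge0 => t _; rewrite lee_fin.
  have /integrableP[_ la] := ia; have /integrableP[_ lc] := ic.
  by rewrite lte_mul_pinfty //; [apply: integral_ge0 => t _|
    rewrite ge0_fin_numE //; apply: integral_ge0 => t _].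
split => //.
rewrite -(@integral12_prod_meas1 _ _ _ _ _ nu P _ iz) /fubini_F /=.
under eq_integral => x _.
  under eq_integral => t _ do rewrite EFinM muleC.
  rewrite integralZl //; over.
have ->  : (\int[P]_t (c t)%:E = (fine (\int[P]_t (c t)%:E))%:E)%E by rewrite fineK.
by rewrite integralZr.
Qed.

End product_integrable.

Lemma ae_exists d (T : measurableType d) (R : realType)
    (mu : {measure set T -> \bar R}) (A Q : set T) :
  measurable A -> (0 < mu A)%E -> {ae mu, forall t, Q t} -> exists2 t, A t & Q t.
Proof.
move=> mA A0 [N [mN N0 QN]]; apply: contrapT => h.
suff : (mu A <= mu N)%E by rewrite N0 leNgt A0.
apply: le_measure; rewrite ?inE // => t At.
by apply: QN => Qt; apply: h; exists t.
Qed.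

(** * Subharmonic functions on the skew product *)

Section skew_product.
Context dE (E : measurableType dE) (R : realType) (nu : probability E R).
Variable T : E -> E.
Hypothesis mT : measurable_fun setT T.
Hypothesis T_inv : forall A, measurable A -> nu (T @^-1` A) = nu A.
Hypothesis T_erg :
  forall A, measurable A -> T @^-1` A = A -> nu A = 0%E \/ nu A = 1%E.
Context dS (S : measurableType dS) (P : probability S R).
Variables (X y : S -> R) (f : E -> R).
Hypothesis mX : measurable_fun setT X.
Hypothesis X0 : forall t, 0 <= X t.
Hypothesis EX : (\int[P]_t (X t)%:E = 1)%E.
Hypothesis my : measurable_fun setT y.
Hypothesis iXy : P.-integrable setT (fun t => (X t * y t)%:E).
Hypothesis mf : measurable_fun setT f.
Hypothesis intf : nu.-integrable setT (EFin \o f).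
Hypothesis drift_ge0 :
  (0 <= \int[nu]_x (f x)%:E + \int[P]_t (X t * y t)%:E)%E.
Variable u : E -> R -> R.
Hypothesis mes_u : measurable_fun setT (fun z : E * R => u z.1 z.2).
Hypothesis u01 : forall x s, 0 <= u x s <= 1.
Hypothesis u_ni : forall x s s', s <= s' -> u x s' <= u x s.
Hypothesis u_eq0 : forall x s, 0 <= s -> u x s = 0.
Hypothesis u_sub : forall x s,
  ((u x s)%:E <= \int[P]_t (X t * u (T x) (s + (f x + y t)))%:E)%E.

Local Notation leb := (@lebesgue_measure R).

Let v x s := u x s ^+ 2.

Let mcomp d (Z : measurableType d) (al : Z -> E) (be : Z -> R) :
  measurable_fun setT al -> measurable_fun setT be ->
  measurable_fun setT (fun z => v (al z) (be z)).
Proof.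
move=> mal mbe; apply: measurable_funX.
exact: (measurableT_comp mes_u (measurable_fun_pair mal mbe)).
Qed.

Let v01 x s : 0 <= v x s <= 1.
Proof. by have /andP[a b] := u01 x s; rewrite sqr_ge0 expr_le1. Qed.

Let v_ni x s s' : s <= s' -> v x s' <= v x s.
Proof.
move=> /(u_ni x); have /andP[a _] := u01 x s; have /andP[b _] := u01 x s'.
by rewrite /v ler_sqr ?nnegrE.
Qed.

Let v_eq0 x s : 0 <= s -> v x s = 0.
Proof. by move=> s0; rewrite /v u_eq0 // expr0n. Qed.

Let Pv x s : \bar R := (\int[P]_t (X t * v (T x) (s + (f x + y t)))%:E)%E.

Let mu_t x s : measurable_fun setT (fun t => u (T x) (s + (f x + y t))).
Proof.
apply: (measurableT_comp mes_u (measurable_fun_pair (measurable_cst (T x)) _)).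
by do 2! apply: measurable_funD => //.
Qed.

Let jensen x s := @weighted_jensen _ S R P X mX X0 EX _ (u x s) (mu_t x s)
  (fun t => u01 _ _) (proj1 (andP (u01 x s))) (u_sub x s).

Let v_le_Pv x s : ((v x s)%:E <= Pv x s)%E.
Proof. exact: (jensen x s).1. Qed.

Let mPv : measurable_fun setT (fun z : E * R => Pv z.1 z.2).
Proof.
apply: (@measurable_fun_fubini_tonelli_F _ _ _ _ _ P
  (fun q : (E * R) * S => (X q.2 * v (T q.1.1) (q.1.2 + (f q.1.1 + y q.2)))%:E)).
- apply/measurable_EFinP; apply: measurable_funM.
    exact: (measurableT_comp mX measurable_snd).
  have m1 : measurable_fun setT (fun q : (E * R) * S => q.1.1).
    exact: (measurableT_comp measurable_fst measurable_fst).
  have m2 : measurable_fun setT (fun q : (E * R) * S => q.1.2).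
    exact: (measurableT_comp measurable_snd measurable_fst).
  apply: mcomp; first exact: (measurableT_comp mT m1).
  apply: measurable_funD => //; apply: measurable_funD.
    exact: (measurableT_comp mf m1).
  exact: (measurableT_comp my measurable_snd).
- by move=> q; rewrite lee_fin mulr_ge0 //; case/andP: (v01 (T q.1.1) (q.1.2 + (f q.1.1 + y q.2))).
Qed.

Let w x := limn (fun n => v x (- n%:R)).

Let v_cvg x : v x (- n%:R) @[n --> \oo] --> w x.
Proof.
apply: nondecreasing_is_cvgn.
  by move=> m n mn; apply: v_ni; rewrite lerN2 ler_nat.
by exists 1 => _ [n _ <-]; case/andP: (v01 x (- n%:R)).
Qed.

Let v_le_w x s : v x s <= w x.
Proof.
apply: limr_ge; first by apply: cvgP; exact: v_cvg.
exists (Num.truncn `|s|).+1 => // n /= sn; apply: v_ni.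
have : (Num.truncn `|s|).+1%:R <= n%:R :> R by rewrite ler_nat.
have := truncnS_gt `|s|; have := ler_norm (- s); rewrite normrN; lra.
Qed.

Let w01 x : 0 <= w x <= 1.
Proof.
apply/andP; split.
  by apply: le_trans (v_le_w x 0); case/andP: (v01 x 0).
apply: limr_le; first by apply: cvgP; exact: v_cvg.
by apply: nearW => n; case/andP: (v01 x (- n%:R)).
Qed.

Let mw : measurable_fun setT w.
Proof.
apply: (@measurable_fun_cvg _ _ _ _ (fun n x => v x (- n%:R))).
  by move=> n; apply: mcomp => //; exact: measurable_cst.
by move=> x _; exact: v_cvg.
Qed.

(** In [Pv], bound v (T x) by its supremum w (T x) and use that X has mean 1. Hence w, the limit of
    v at -oo, is almost everywhere a constant: the factor of the mean step in the flux. *)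
Let w_sub x : w x <= w (T x).
Proof.
apply: limr_le; first by apply: cvgP; exact: v_cvg.
apply: nearW => n; rewrite -lee_fin (le_trans (v_le_Pv _ _)) //.
rewrite /Pv -[leRHS]mule1 -EX -ge0_integralZl //;
  [|exact/measurable_EFinP|by move=> t _; rewrite lee_fin
   |by rewrite lee_fin; case/andP: (w01 (T x))].
apply: ge0_le_integral => //.
- by move=> t _; rewrite lee_fin mulr_ge0 //; case/andP: (v01 (T x) (- n%:R + (f x + y t))).
- apply/measurable_EFinP; apply: measurable_funM => //.
  by apply: measurable_funX; exact: mu_t.
- by apply: emeasurable_funM => //; exact/measurable_EFinP.
- by move=> t _; rewrite -EFinM lee_fin mulrC ler_wpM2r.
Qed.

(** [k n] is the flux density through the level -n: the weighted change of the tail of v (T x) when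
    the cut-off moves by one step f + y of the walk. [ph n] comes from [Pv], and [p0 n] from v. *)
Let ph n (z : E * S) := tail (v (T z.1)) (- n%:R + (f z.1 + y z.2)).
Let p0 n (z : E * S) := tail (v (T z.1)) (- n%:R).
Let k n (z : E * S) := X z.2 * (ph n z - p0 n z).

Let metail : measurable_fun setT (fun z : E * R => etail (v z.1) z.2).
Proof.
apply: (@measurable_fun_fubini_tonelli_F _ _ _ _ _ leb
  (fun q : (E * R) * R => (if q.1.2 <= q.2 then v q.1.1 q.2 else 0)%:E)).
- apply/measurable_EFinP.
  have m1 : measurable_fun setT (fun q : (E * R) * R => q.1.1).
    exact: (measurableT_comp measurable_fst measurable_fst).
  have m2 : measurable_fun setT (fun q : (E * R) * R => q.1.2).
    exact: (measurableT_comp measurable_snd measurable_fst).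
  have m3 : measurable_fun setT (fun q : (E * R) * R => q.2).
    exact: measurable_snd.
  apply: measurable_fun_ifT; [exact: measurable_fun_ler|exact: mcomp|by []].
- move=> q; rewrite lee_fin; case: ifP => // _.
  by case/andP: (v01 q.1.1 q.2).
Qed.

Let mtail d (Z : measurableType d) (al : Z -> E) (be : Z -> R) :
  measurable_fun setT al -> measurable_fun setT be ->
  measurable_fun setT (fun z => tail (v (al z)) (be z)).
Proof.
move=> mal mbe; apply/measurable_EFinP.
apply: (eq_measurable_fun (fun z => etail (v (al z)) (be z))).
  by move=> z _; rewrite /= (etailE (v01 _) (@v_ni _) (@v_eq0 _)).
exact: (measurableT_comp metail (measurable_fun_pair mal mbe)).
Qed.

Let mT1 : measurable_fun setT (fun z : E * S => T z.1).
Proof. exact: (measurableT_comp mT measurable_fst). Qed.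

Let mX2 : measurable_fun setT (fun z : E * S => X z.2).
Proof. exact: (measurableT_comp mX measurable_snd). Qed.

Let mG : measurable_fun setT (fun z : E * S => f z.1 + y z.2).
Proof.
apply: measurable_funD.
  exact: (measurableT_comp mf measurable_fst).
exact: (measurableT_comp my measurable_snd).
Qed.

Let mph n : measurable_fun setT (ph n).
Proof. by apply: mtail => //; exact: measurable_funD. Qed.

Let mp0 n : measurable_fun setT (p0 n).
Proof. by apply: mtail => //; exact: measurable_cst. Qed.

Let mk n : measurable_fun setT (k n).
Proof. by apply: measurable_funM => //; exact: measurable_funB. Qed.

Let m := (nu \x P)%E.

Let iXG : m.-integrable setT (fun z => (X z.2 * (f z.1 + y z.2))%:E) /\
  (\int[m]_z (X z.2 * (f z.1 + y z.2))%:E =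
    \int[nu]_x (f x)%:E + \int[P]_t (X t * y t)%:E)%E.
Proof.
have iX : P.-integrable setT (EFin \o X) by exact: integrable_weight.
have [i1 e1] := integrable_prodM intf iX.
have i1' : nu.-integrable setT (EFin \o (fun _ => 1 : R)).
  exact: finite_measure_integrable_cst.
have [i2 e2] := integrable_prodM i1' iXy.
have E1 : (fun z : E * S => (X z.2 * (f z.1 + y z.2))%:E) =
   ((fun z => (X z.2 * f z.1)%:E) \+ (fun z => (X z.2 * y z.2 * 1)%:E))%E.
  by apply/funext => z /=; rewrite -EFinD mulr1 mulrDr.
rewrite E1; split; first exact: integrableD.
rewrite integralD //; congr (_ + _)%E; first by rewrite e1 EX mule1.
rewrite e2 integral_cst //= probability_setT mule1 mul1e //.
Qed.

Let k_le n z : `|k n z| <= X z.2 * `|f z.1 + y z.2|.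
Proof.
rewrite /k normrM ger0_norm // ler_wpM2l //.
exact: (tail_increment_le (v01 _) (@v_ni _) (@v_eq0 _)).
Qed.

Let iXabsG : m.-integrable setT (fun z => (X z.2 * `|f z.1 + y z.2|)%:E).
Proof.
have [i _] := iXG.
apply: (le_integrable measurableT _ _ i).
- apply/measurable_EFinP; apply: measurable_funM => //.
  exact: measurableT_comp.
- by move=> z _; rewrite /= lee_fin !normrM normr_id.
Qed.

Let ik n : m.-integrable setT (EFin \o k n).
Proof.
apply: (le_integrable measurableT _ _ iXabsG).
- exact/measurable_EFinP.
- move=> z _; rewrite /= lee_fin (le_trans (k_le n z)) //.
  exact: ler_norm.
Qed.

(** The pointwise limit is that of [tail_increment_cvg] with l = w (T x), under the domination by X
    |f + y|. As w is almost everywhere one constant, it leaves the integral, and the mean step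
    remains. *)
Let limit_k : exists2 c, 0 <= c &
  (\int[m]_z (k n z)%:E @[n --> \oo] --> - (c%:E *
    (\int[nu]_x (f x)%:E + \int[P]_t (X t * y t)%:E)))%E.
Proof.
have [c wc] := subinvariant_ae_cst mT T_inv T_erg mw w01 w_sub.
have c0 : 0 <= c.
  have : nu.-negligible (~` [set x | w x = c]) by [].
  have [x ->] : exists x, c = w x.
    apply: contrapT => h.
    have : {ae nu, forall x, False}.
      by apply: filterS wc => x wx; apply: h; exists x.
    move=> [N [mN N0 sN]].
    have := probability_setT nu.
    rewrite (_ : setT = N); last by apply/seteqP; split => // x _; apply: sN.
    by rewrite N0 => /eqP; rewrite eqe => /eqP /esym; apply/eqP; rewrite oner_eq0.
  by case/andP: (w01 x).
exists c => //.
have [iG eG] := iXG.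
rewrite -eG -integralZl // -integralN; last first.
  exact: integrable_add_def (integrableZl measurableT c iG).
have wTc : {ae m, forall z : E * S, w (T z.1) = c}.
  have [N [mN N0 sN]] := ae_comp_invariant mT T_inv wc.
  exists (N `*` setT); split.
  - by apply: measurableX.
  - transitivity (nu N * P setT)%E; first exact: product_measure1E.
    by rewrite N0 mul0e.
  - by move=> z /= wz; split => //; apply: sN.
pose l (z : E * S) := (- (c%:E * (X z.2 * (f z.1 + y z.2))%:E))%E.
have ml : measurable_fun setT l.
  apply: measurableT_comp => //; apply: emeasurable_funM => //.
  exact: measurable_int iG.
have kl : {ae m, forall z, setT z -> (k n z)%:E @[n --> \oo] --> l z}.
  apply: filterS wTc => z wz _.
  rewrite /l -EFinM -EFinN; apply: cvg_EFin; first exact: nearW.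
  have := @tail_increment_cvg _ (v (T z.1)) (v01 _) (@v_ni _) (@v_eq0 _)
    (w (T z.1)) (f z.1 + y z.2) (@v_cvg (T z.1)).
  rewrite wz => h.
  have -> : - (c * (X z.2 * (f z.1 + y z.2))) = X z.2 * - (c * (f z.1 + y z.2)) by ring.
  by apply: cvgMl_tmp; exact: h.
have kb : {ae m, forall z n, setT z ->
    (`|(k n z)%:E| <= (X z.2 * `|f z.1 + y z.2|)%:E)%E}.
  by apply: aeW => z n _; rewrite /= lee_fin; exact: k_le.
by have [] := dominated_convergence measurableT
  (fun n => (measurable_EFinP _ _).2 (mk n)) ml kl iXabsG kb.
Qed.

(** Over the whole skew product the integrals of [Pv] and v may both be infinite; cut at -n they are
    finite and can be subtracted. *)
Let D n x s : \bar R := if - n%:R <= s then (Pv x s - (v x s)%:E)%E else 0%E.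

Let D_ge0 n x s : (0 <= D n x s)%E.
Proof. by rewrite /D; case: ifP => // _; rewrite sube_ge0 //; exact: v_le_Pv. Qed.

Let mD n : measurable_fun setT (fun z : E * R => D n z.1 z.2).
Proof.
apply: measurable_fun_ifT.
- apply: measurable_fun_ler; first exact: measurable_cst.
  exact: measurable_snd.
- apply: emeasurable_funB => //; apply/measurable_EFinP.
  by apply: mcomp; [exact: measurable_fst|exact: measurable_snd].
- exact: measurable_cst.
Qed.

Let mDx n x : measurable_fun setT (D n x).
Proof. exact: (measurable_fun_pair2 x (mD n)). Qed.

(** Tonelli exchanges s with the step. For a fixed step, translating s moves the cut-off of the tail
    instead of the argument of v. *)
Let Pv_tail n x :
  (\int[leb]_s (if (- n%:R <= s)%R then Pv x s else 0) =
   \int[P]_t (X t * ph n (x, t))%:E)%E.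
Proof.
pose F (q : R * S) : \bar R := (X q.2 * (if - n%:R <= q.1 then
   v (T x) (q.1 + (f x + y q.2)) else 0))%:E.
have F0 q : (0 <= F q)%E.
  rewrite lee_fin mulr_ge0 //; case: ifP => // _.
  by case/andP: (v01 (T x) (q.1 + (f x + y q.2))).
have mF : measurable_fun setT F.
  have m1 : measurable_fun setT (fun q : R * S => q.1) by exact: measurable_fst.
  have m2 : measurable_fun setT (fun q : R * S => q.2) by exact: measurable_snd.
  apply/measurable_EFinP; apply: measurable_funM.
    exact: (measurableT_comp mX m2).
  apply: measurable_fun_ifT; [exact: measurable_fun_ler| |by []].
  apply: mcomp; first exact: measurable_cst.
  do 2! apply: measurable_funD => //.
  exact: (measurableT_comp my m2).
transitivity (\int[leb]_s \int[P]_t F (s, t))%E.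
  apply: eq_integral => s _; rewrite /F /Pv /=; case: ifP => // _.
  by rewrite integral0_eq // => t _; rewrite mulr0.
transitivity (\int[P]_t \int[leb]_s F (s, t))%E.
  exact: (@fubini_tonelli _ _ _ _ _ leb P F mF F0).
apply: eq_integral => t _.
rewrite /F /=; under eq_integral => s _ do rewrite EFinM.
have mi : measurable_fun setT (fun s : R =>
    (if - n%:R <= s then v (T x) (s + (f x + y t)) else 0)%:E).
  apply/measurable_EFinP; apply: measurable_fun_ifT => //.
    exact: measurable_fun_ler.
  by apply: mcomp; [exact: measurable_cst|exact: measurable_funD].
rewrite ge0_integralZl //; last first.
- by rewrite lee_fin.
- move=> s _; rewrite lee_fin; case: ifP => // _.
  by case/andP: (v01 (T x) (s + (f x + y t))).
rewrite (etail_translation (v01 _) (@v_ni _) _ _).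
by rewrite (etailE (v01 _) (@v_ni _) (@v_eq0 _)) -EFinM.
Qed.

Let ip0 n : m.-integrable setT (fun z => (X z.2 * p0 n z)%:E).
Proof.
have iX : P.-integrable setT (EFin \o X) by exact: integrable_weight.
have ic : nu.-integrable setT (EFin \o (fun x : E => n%:R : R)).
  exact: finite_measure_integrable_cst.
have [i _] := integrable_prodM ic iX.
apply: (le_integrable measurableT _ _ i).
- by apply/measurable_EFinP; exact: measurable_funM.
- move=> z _; rewrite /= lee_fin !normrM ler_wpM2l //.
  have := tail_le (v01 (T z.1)) (@v_ni _) (@v_eq0 _) (- n%:R).
  rewrite normrN; apply: le_trans.
  by rewrite ger0_norm // (tail_ge0 (v01 (T z.1)) (@v_ni _) (@v_eq0 _)).
Qed.

(** Invariance of nu replaces v x by v (T x), and the mean of X being 1 inserts the weight. The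
    tails coming from v and from [Pv] then live under the same integral. *)
Let v_tail n :
  (\int[nu]_x \int[leb]_s (if - n%:R <= s then v x s else 0)%:E =
   \int[m]_z (X z.2 * p0 n z)%:E)%E.
Proof.
transitivity (\int[nu]_x etail (v x) (- n%:R))%E; first by [].
have me : measurable_fun setT (fun x => etail (v x) (- n%:R)).
  exact: (measurableT_comp metail (measurable_fun_pair (@measurable_id _ E setT)
    (measurable_cst (- n%:R : R)))).
rewrite -(ge0_integral_invariant mT T_inv me (fun x => etail_ge0 (v01 x) _)).
rewrite -(@integral12_prod_meas1 _ _ _ _ _ nu P _ (ip0 n)) /fubini_F /=.
apply: eq_integral => x _.
under eq_integral => t _ do rewrite EFinM /p0 /=.
rewrite ge0_integralZr //; [|exact/measurable_EFinP|by move=> t _; rewrite lee_fin|].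
  by rewrite EX mul1e (etailE (v01 _) (@v_ni _) (@v_eq0 _)).
by rewrite lee_fin; exact: (tail_ge0 (v01 (T x)) (@v_ni _) (@v_eq0 _)).
Qed.

(* Stationarity of nu and translation invariance of Lebesgue measure reduce the
   integral of P v - v over s >= -n to the increments of the tail of v at -n. *)
Let flux n : (\int[nu]_x \int[leb]_s D n x s = \int[m]_z (k n z)%:E)%E.
Proof.
have iph : m.-integrable setT (fun z => (X z.2 * ph n z)%:E).
  have := integrableD measurableT (ik n) (ip0 n).
  apply: eq_integrable => // z _ /=.
  by rewrite -EFinD /k; congr EFin; ring.
(* Stated as a sum, so that only nonnegative functions are integrated; the subtraction comes at the
   end, where [ip0] provides finiteness. *)
have ED : (\int[nu]_x \int[leb]_s D n x s +
   \int[nu]_x \int[leb]_s (if - n%:R <= s then v x s else 0)%:E =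
   \int[m]_z (X z.2 * ph n z)%:E)%E.
  have mv : measurable_fun setT (fun z : E * R =>
      (if - n%:R <= z.2 then v z.1 z.2 else 0)%:E).
    apply/measurable_EFinP; apply: measurable_fun_ifT => //.
    - by apply: measurable_fun_ler; [exact: measurable_cst|exact: measurable_snd].
    - by apply: mcomp; [exact: measurable_fst|exact: measurable_snd].
  have v_ge0 (z : E * R) : (0 <= (if - n%:R <= z.2 then v z.1 z.2 else 0)%:E)%E.
    by rewrite lee_fin; case: ifP => // _; case/andP: (v01 z.1 z.2).
  rewrite -ge0_integralD //.
  - rewrite -(@integral12_prod_meas1 _ _ _ _ _ nu P _ iph) /fubini_F /=.
    apply: eq_integral => x _; rewrite -Pv_tail -ge0_integralD //.
    + apply: eq_integral => s _; rewrite /D; case: ifP => _; last by rewrite adde0.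
      by rewrite subeK.
    + exact: (mDx n x).
    + by move=> s _; exact: (v_ge0 (x, s)).
    + exact: (measurable_fun_pair2 x mv).
  - by move=> x _; apply: integral_ge0 => s _; exact: D_ge0.
  - exact: (@measurable_fun_fubini_tonelli_F _ _ _ _ _ leb
      (fun z : E * R => D n z.1 z.2) (mD n) (fun z => D_ge0 n z.1 z.2)).
  - by move=> x _; apply: integral_ge0 => s _; exact: (v_ge0 (x, s)).
  - exact: (@measurable_fun_fubini_tonelli_F _ _ _ _ _ leb _ mv v_ge0).
rewrite v_tail in ED.
have -> : (\int[m]_z (k n z)%:E =
    \int[m]_z (X z.2 * ph n z)%:E - \int[m]_z (X z.2 * p0 n z)%:E)%E.
  rewrite -(integralB measurableT iph (ip0 n)).
  by apply: eq_integral => z _ /=; rewrite /k mulrBr EFinB.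
rewrite -ED addeK //.
exact: integrable_fin_num (ip0 n).
Qed.

(* The flux is nonnegative and increases with n to a limit which is <= 0. *)
Let D_eq0 n : (\int[nu]_x \int[leb]_s D n x s = 0)%E.
Proof.
have [c c0 kc] := limit_k.
apply/eqP; rewrite eq_le; apply/andP; split; last first.
  by apply: integral_ge0 => x _; apply: integral_ge0 => s _; exact: D_ge0.
apply: (@le_trans _ _ (- (c%:E * (\int[nu]_x (f x)%:E + \int[P]_t (X t * y t)%:E)))%E).
  apply: (cvge_to_ge kc); exists n => // p /= np.
  rewrite -flux; apply: ge0_le_integral => //.
  - by move=> x _; apply: integral_ge0 => s _; exact: D_ge0.
  - exact: (@measurable_fun_fubini_tonelli_F _ _ _ _ _ leb
      (fun z : E * R => D n z.1 z.2) (mD n) (fun z => D_ge0 n z.1 z.2)).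
  - exact: (@measurable_fun_fubini_tonelli_F _ _ _ _ _ leb
      (fun z : E * R => D p z.1 z.2) (mD p) (fun z => D_ge0 p z.1 z.2)).
  move=> x _; apply: ge0_le_integral => //.
  - exact: (mDx n x).
  - exact: (mDx p x).
  move=> s _; rewrite /D; case: ifP => ns; last exact: D_ge0.
  by rewrite (le_trans _ ns) // lerN2 ler_nat.
by rewrite oppe_le0 mule_ge0.
Qed.

(** Each [D n] is nonnegative with integral 0, so it vanishes almost everywhere, simultaneously for
    all n; and every s is above some -n. *)
Lemma square_harmonic : {ae nu, forall x, {ae leb, forall s,
  (Pv x s = (v x s)%:E)%E}}.
Proof.
have aD n : {ae nu, forall x, {ae leb, forall s, D n x s = 0%E}}.
  have mI : measurable_fun setT (fun x => \int[leb]_s D n x s)%E.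
    exact: (@measurable_fun_fubini_tonelli_F _ _ _ _ _ leb
      (fun z : E * R => D n z.1 z.2) (mD n) (fun z => D_ge0 n z.1 z.2)).
  have I0 x : (0 <= \int[leb]_s D n x s)%E.
    by apply: integral_ge0 => s _; exact: D_ge0.
  have : (\int[nu]_x `|\int[leb]_s D n x s| = 0)%E.
    by under eq_integral do rewrite gee0_abs //; exact: D_eq0.
  move=> /(ae_eq_integral_abs nu measurableT mI).
  apply: filterS => x /(_ I) /= xD.
  have : (\int[leb]_s `|D n x s| = 0)%E.
    by under eq_integral do rewrite gee0_abs //.
  move=> /(ae_eq_integral_abs leb measurableT (mDx n x)).
  by apply: filterS => s /(_ I).
have := ae_foralln aD; apply: filterS => x /ae_foralln; apply: filterS => s Ds.
have := Ds (Num.truncn `|s|).+1; rewrite /D.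
have -> : - (Num.truncn `|s|).+1%:R <= s.
  by have := truncnS_gt `|s|; have := ler_norm (- s); rewrite normrN; lra.
move=> /eqP; rewrite sube_eq // ?add0e => [/eqP //|].
rewrite /Pv; apply: integrable_fin_num => //.
apply: integrable_weight_bounded => //.
by apply: measurable_funX; exact: mu_t.
Qed.

Variables (a b : R).
Hypothesis ab : a < b.
Hypothesis Pa : (0 < P [set t | (X t != 0 /\ y t <= a)%R])%E.
Hypothesis Pb : (0 < P [set t | (X t != 0 /\ b <= y t)%R])%E.

Lemma subharmonic_eq0 : {ae nu, forall x, forall s, u x s = 0}.
Proof.
have mX0 : measurable [set t | X t != 0].
  rewrite (_ : [set _ | _] = X @^-1` (~` [set 0])); last first.
    by apply/seteqP; split => t /= /eqP.
  by rewrite -[X in measurable X]setTI; apply: mX => //; exact: measurableC.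
have mAa : measurable [set t | X t != 0 /\ y t <= a].
  apply: measurableI => //.
  by rewrite -[X in measurable X]setTI; apply: measurable_fun_ler.
have mAb : measurable [set t | X t != 0 /\ b <= y t].
  apply: measurableI => //.
  by rewrite -[X in measurable X]setTI; apply: measurable_fun_ler.
apply: filterS square_harmonic => x hx.
pose r := u (T x); have ab' := ab.
(* Equality in Jensen gives r (s + (f x + y t)) one value p for almost every t with X t nonzero.
   Such t with y t <= a and with y t >= b exist by [Pa] and [Pb], and monotonicity of r pins its
   values at both shifts to p. *)
have step s : (Pv x s = (v x s)%:E)%E -> r (s + (f x + a)) = r (s + (f x + b)).
  move=> Es; have [_ jn] := jensen x s.
  have [|p hp] := jn; first by rewrite -[leLHS]/(Pv x s) Es.
  have [t1 [X1 y1] h1] := ae_exists mAa Pa hp.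
  have [t2 [X2 y2] h2] := ae_exists mAb Pb hp.
  apply/eqP; rewrite eq_le; apply/andP; split; last first.
    by apply: u_ni; rewrite !lerD2l ltW.
  apply: (@le_trans _ _ p).
  - by rewrite -(h1 X1); apply: u_ni; rewrite !lerD2l.
  - by rewrite -(h2 X2); apply: u_ni; rewrite !lerD2l.
(* Harmonicity is known for almost every s' only. Asking for half of b - a as period leaves an
   interval of admissible s' of length (b - a) / 2, hence a good one, with s' + f x + a <= s and s +
   (b - a) / 2 <= s' + f x + b. *)
have period s : r s = r (s + (b - a) / 2).
  pose I := `[s + (b - a) / 2 - b - f x, s - a - f x]%classic.
  have I0 : (0 < leb I)%E.
    rewrite /I lebesgue_measure_itv /= lte_fin ifT; last by lra.
    by rewrite -EFinB lte_fin; lra.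
  have mI : measurable (I : set (measurableTypeR R)) by exact: measurable_itv.
  have [s' + Es] := @ae_exists _ _ _ leb I _ mI I0 hx.
  rewrite /I /= in_itv /= => /andP[s1 s2].
  apply/eqP; rewrite eq_le; apply/andP; split; last by apply: u_ni; lra.
  apply: (@le_trans _ _ (r (s' + (f x + a)))); first by apply: u_ni; lra.
  by rewrite (step _ Es); apply: u_ni; lra.
have rn n s : r s = r (s + (b - a) / 2 * n%:R).
  elim: n => [|n ->]; first by rewrite mulr0 addr0.
  by rewrite period; congr (r _); rewrite -natr1; ring.
have r0 s : r s = 0.
  pose n := (Num.truncn (`|s| / ((b - a) / 2))).+1.
  rewrite (rn n) /r u_eq0 //.
  have d0 : 0 < (b - a) / 2 by lra.
  have : `|s| / ((b - a) / 2) < n%:R by exact: truncnS_gt.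
  rewrite ltr_pdivrMr // mulrC => h.
  by have := ler_norm (- s); rewrite normrN; lra.
(* [r] is the function over T x; subharmonicity carries its vanishing back to x. *)
move=> s; apply/eqP; rewrite eq_le; apply/andP; split; last by case/andP: (u01 x s).
rewrite -lee_fin (le_trans (u_sub x s)) // integral0_eq // => t _.
by rewrite [u _ _]r0 mulr0.
Qed.

End skew_product.

(** * Independence *)

Section independence.
Context d (Omega : measurableType d) (R : realType) (P : probability Omega R).
Context d' (Omega' : measurableType d') (P' : probability Omega' R).
Variables (X : {RV P' >-> R}) (I : choiceType) (D : set I) (Y : I -> {RV P >-> R}).
Hypothesis Y_iid : iid_copies X D Y.

Definition events_of (S : set I) : set (set Omega) :=
  [set B | exists2 i, S i & exists2 A : set R, measurable A & B = Y i @^-1` A].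

(** A copy of [Omega] with the sigma-field generated by the Y i, i in S. Measurability of a function
    on this copy expresses that it depends on those variables only. *)
Definition sigma_of (S : set I) := g_sigma_algebraType (events_of S).

Let rectangles (S : set I) : set (set Omega) :=
  [set B | exists s : seq I, exists A : I -> set R,
    [/\ uniq s, {in s, forall i, S i}, (forall i, measurable (A i)) &
     B = \bigcap_(i in [set` s]) (Y i @^-1` A i)]].

Let measurable_preimage i (A : set R) : measurable A -> measurable (Y i @^-1` A).
Proof.
by move=> mA; rewrite -[X in measurable X]setTI; exact: (measurable_funP (Y i)).
Qed.

Let rectangles_measurable S B : rectangles S B -> measurable B.
Proof.
move=> [s [A [us sS mA ->]]].
apply: fin_bigcap_measurable; first exact: finite_seq.
by move=> i _; exact: measurable_preimage.
Qed.

Let rectanglesI S : setI_closed (rectangles S).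
Proof.
move=> _ _ [s [A [us sS mA ->]]] [t [B [ut tS mB ->]]].
exists (undup (s ++ t)).
exists (fun i => (if i \in s then A i else setT) `&` (if i \in t then B i else setT)).
split.
- exact: undup_uniq.
- by move=> i; rewrite mem_undup mem_cat => /orP[/sS|/tS].
- by move=> i; apply: measurableI; case: ifP.
apply/seteqP; split => w /=.
  move=> [h1 h2] i /=; rewrite mem_undup mem_cat => ist; split; case: ifP => // ii.
    exact: h1.
  exact: h2.
move=> h; split=> i /= ii.
  have /h[] : i \in undup (s ++ t) by rewrite mem_undup mem_cat ii.
  by rewrite ii.
have /h[] : i \in undup (s ++ t) by rewrite mem_undup mem_cat ii orbT.
by rewrite ii.
Qed.

Let events_sub S : <<s events_of S >> `<=` <<s rectangles S >>.
Proof.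
apply: sub_sigma_algebra2 => B [i Si [A mA ->]].
exists [:: i], (fun _ => A); split => //.
  by move=> k; rewrite inE => /eqP ->.
apply/seteqP; split => w /= h; first by move=> k /=; rewrite inE => /eqP ->.
by apply: h => /=; rewrite inE.
Qed.

Lemma sigma_of_measurable S (B : set (sigma_of S)) : measurable B ->
  measurable (B : set Omega).
Proof.
move: B; apply: smallest_sub.
- exact: sigma_algebra_measurable.
- by move=> B [i Si [A mA ->]]; exact: measurable_preimage.
Qed.

(** Finite intersections of events of single variables form a pi-system generating [sigma_of Y S],
    and the sets B that satisfy the product rule against a fixed event of Y j form a Dynkin
    class. *)
Lemma sigma_of_independent S j : S `<=` D -> D j -> ~ S j ->
  forall (B : set (sigma_of S)) (A : set R), measurable B -> measurable A ->
  (P (B `&` Y j @^-1` A) = P B * P (Y j @^-1` A))%E.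
Proof.
move=> SD Dj Sj B A mB mA.
have mC := measurable_preimage j mA.
have finC := fin_num_measure P _ mC.
pose Q (B : set Omega) := measurable B /\
  (P (B `&` Y j @^-1` A) = P B * P (Y j @^-1` A))%E.
suff : Q B by case.
have QT : Q setT by split => //; rewrite setTI probability_setT mul1e.
have QC B' : Q B' -> Q (~` B').
  move=> [mB' eB']; split; first exact: measurableC.
  have e1 : (P (Y j @^-1` A `\` B') = P (Y j @^-1` A) - P (B' `&` Y j @^-1` A))%E.
    by rewrite (setIC B'); apply: measureD => //; rewrite -ge0_fin_numE.
  rewrite setIC -setDE e1 eB' probability_setC //.
  by rewrite -(fineK (fin_num_measure P _ mB')) -(fineK finC) -[in RHS](EFinB 1)
    -!EFinM -EFinB; congr EFin; ring.
have QU (F : (set Omega)^nat) : trivIset setT F -> (forall n, Q (F n)) ->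
    Q (\bigcup_k F k).
  move=> tF hF; have mF n := (hF n).1.
  split; first exact: bigcupT_measurable.
  rewrite setI_bigcupl measure_bigcup //; last 2 first.
  - by move=> n _; exact: measurableI.
  - exact: trivIset_setIr.
  rewrite measure_bigcup // muleC -(fineK finC) -nneseriesZl //.
  by apply: eq_eseriesr => n _; rewrite (fineK finC) muleC; exact: (hF n).2.
have Qrect B' : rectangles S B' -> Q B'.
  move=> rB; split; first exact: rectangles_measurable rB.
  case: rB => s [A' [us sS mA' ->]].
  have js : j \notin s by apply/negP => /sS.
  have [ind _] := Y_iid.
  (* The family A' changed to A at the index j only, which is not in s, so that mutual independence
     applies to the list [j :: s]. *)
  pose A'' i := if i == j then A else A' i.
  have mA'' i : measurable (A'' i) by rewrite /A''; case: ifP.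
  have eA : \bigcap_(i in [set` s]) (Y i @^-1` A'' i) =
            \bigcap_(i in [set` s]) (Y i @^-1` A' i).
    apply: eq_bigcapr => i /= si; rewrite /A''.
    by case: eqP js => // <-; rewrite si.
  have := ind (j :: s); rewrite /= js us => /(_ isT) h.
  have {}h := h _ A'' mA''.
  have e2 : \bigcap_(i in [set` j :: s]) (Y i @^-1` A'' i) =
    (\bigcap_(i in [set` s]) (Y i @^-1` A' i)) `&` Y j @^-1` A.
    rewrite -eA; apply/seteqP; split => w /=.
      move=> hw; split; last by have /= := hw j (mem_head _ _); rewrite /A'' eqxx.
      by move=> i si; apply: hw; rewrite /= inE si orbT.
    move=> [h1 h2] i /=; rewrite inE => /orP[/eqP ->|/h1 //].
    by rewrite /A'' eqxx.
  rewrite -e2 h; last by move=> i; rewrite inE => /orP[/eqP ->|/sS /SD].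
  rewrite big_cons {1}/A'' eqxx muleC -eA ind //.
  by move=> i /sS /SD.
have : <<s rectangles S >> B by exact: events_sub.
apply: (@dynkin_induction _ (g_sigma_algebraType (rectangles S))
  (rectangles S) Q) => //.
- by move=> B' _; exact: QC.
- by move=> F _; exact: QU.
Qed.

End independence.

Section independent_fubini.
Context d (Omega : measurableType d) (R : realType) (P : probability Omega R).
Context d' (Omega' : measurableType d') (P' : probability Omega' R).
Variables (X : {RV P' >-> R}) (I : choiceType) (D : set I) (Y : I -> {RV P >-> R}).
Hypothesis Y_iid : iid_copies X D Y.

Lemma measurable_fun_sigma_of S i : S i ->
  measurable_fun setT (Y i : sigma_of Y S -> R).
Proof.
move=> Si _ A mA; rewrite setTI; apply: sub_sigma_algebra.
by exists i => //; exists A.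
Qed.

Lemma sigma_of_sub S S' (B : set Omega) : S `<=` S' ->
  measurable (B : set (sigma_of Y S)) -> measurable (B : set (sigma_of Y S')).
Proof.
move=> SS'; apply: sub_sigma_algebra2 => C [i Si [A mA ->]].
by exists i; [exact: SS'|exists A].
Qed.

Lemma measurable_sigma_of_id S : measurable_fun setT (id : Omega -> sigma_of Y S).
Proof. by move=> _ B mB; rewrite setTI; exact: sigma_of_measurable mB. Qed.

(** By independence the point of [sigma_of Y S] and the variable Y j have a product law, whose
    second factor is the law of X; Tonelli does the rest. This plays the part of conditioning on the
    variables indexed by S. *)
Lemma independent_fubini S j (F : sigma_of Y S * R -> \bar R) :
  S `<=` D -> D j -> ~ S j -> measurable_fun setT F -> (forall z, 0 <= F z)%E ->
  (\int[P]_w F (w, Y j w) = \int[P']_t \int[P]_w F (w, X t))%E.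
Proof.
move=> SD Dj Sj mF F0.
have mid := @measurable_sigma_of_id S.
(* The identity as a random element of the coarser measurable space; its law is P restricted to that
   sigma-field. *)
pose idS : {mfun Omega >-> sigma_of Y S} :=
  HB.pack (id : Omega -> sigma_of Y S) (isMeasurableFun.Build _ _ _ _ _ mid).
pose m1 := distribution P idS.
pose m2 := distribution P' X.
have mpr : measurable_fun setT (fun w : Omega => ((w, Y j w) : sigma_of Y S * R)).
  by apply: measurable_fun_pair.
pose pr : {mfun Omega >-> (sigma_of Y S * R)%type} :=
  HB.pack (fun w : Omega => ((w, Y j w) : sigma_of Y S * R))
    (isMeasurableFun.Build _ _ _ _ _ mpr).
pose m' := distribution P pr.
have E B : measurable B -> (m1 \x m2)%E B = m' B.
  apply: product_measure_unique => A C mA mC.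
  change (P (A `&` Y j @^-1` C) = m1 A * m2 C)%E.
  rewrite (sigma_of_independent Y_iid SD Dj Sj) //.
  by congr (_ * _)%E; have [_ /(_ _ Dj _ mC)] := Y_iid.
transitivity (\int[m']_z F z)%E.
  rewrite -[LHS]/(\int[P]_w (F \o pr) w)%E.
  by rewrite -(@ge0_integral_pushforward _ _ _ _ _ _ mpr P setT F).
transitivity (\int[m1 \x m2]_z F z)%E.
  by apply: eq_measure_integral => A mA _; exact/esym/E.
rewrite (fubini_tonelli2 (m1 := m1) (m2 := m2) F mF F0) /fubini_G /=.
have mG : measurable_fun setT (fun t => \int[m1]_w F (w, t))%E.
  exact: (measurable_fun_fubini_tonelli_G (m1 := m1) F mF F0).
rewrite (@ge0_integral_pushforward _ _ _ _ _ X _ P' setT) //.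
- apply: eq_integral => t _ /=.
  by rewrite (@ge0_integral_pushforward _ _ _ _ _ _ mid P setT) //;
    exact: measurable_fun_pair1.
- by move=> t _; exact: integral_ge0.
Qed.

End independent_fubini.

(** * The mass martingale *)

Section cascade_mass.
Variables (b : nat) (R : realType).
Context d (Omega : measurableType d) (P : probability Omega R).
Context d' (Omega' : measurableType d') (P' : probability Omega' R).
Variables (X : {RV P' >-> R}) (Y : seq (alphabet b) -> {RV P >-> R}).
Local Notation words := [set u : seq (alphabet b) | u != [::]].
Hypothesis X_ge0 : forall w, 0 <= X w.
Hypothesis EX : (\int[P']_t (X t)%:E = 1)%E.
Hypothesis Y_iid : iid_copies X words Y.
Variable nu : probability (seqspace b) R.

(* The copies Y u are only almost surely nonnegative, whence the absolute values. *)
Definition weight (u : seq (alphabet b)) (w : Omega) : R :=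
  \prod_(1 <= k < (size u).+1) `|Y (take k u) w|.

Definition mass n (w : Omega) : R :=
  \sum_(u : n.-tuple (alphabet b)) cylmass nu u * weight u w.

(** The sigma-fields [sigma_of Y (level n)] are the filtration of the cascade. The empty word is
    left out because the independence hypothesis does not cover it. *)
Definition level n : set (seq (alphabet b)) :=
  [set u | u != [::] /\ (size u <= n)%N].

Lemma weight_nil w : weight [::] w = 1.
Proof. by rewrite /weight big_geq. Qed.

Lemma weight_rcons u a w : weight (rcons u a) w = weight u w * `|Y (rcons u a) w|.
Proof.
rewrite /weight size_rcons big_nat_recr //= take_oversize ?size_rcons //.
congr (_ * _); apply: eq_big_nat => k /andP[_ ku].
by rewrite -cats1 takel_cat.
Qed.

Lemma weight_ge0 u w : 0 <= weight u w.
Proof. by apply: prodr_ge0. Qed.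

Lemma mass_ge0 n w : 0 <= mass n w.
Proof. by apply: sumr_ge0 => u _; rewrite mulr_ge0 ?cylmass_ge0 ?weight_ge0. Qed.

Lemma mass0 w : mass 0 w = 1.
Proof.
rewrite /mass (bigD1 [tuple]) //= big1 ?addr0 => [|u /eqP]; last by case; exact: tuple0.
by rewrite cylmass_nil weight_nil mulr1.
Qed.

Lemma level_sub m n : (m <= n)%N -> level m `<=` level n.
Proof. by move=> mn u [u0 um]; split => //; exact: leq_trans mn. Qed.

Lemma measurable_weight n u : (size u <= n)%N ->
  measurable_fun setT (weight u : sigma_of Y (level n) -> R).
Proof.
elim/last_ind: u => [|u a IH] un.
  by rewrite (_ : weight [::] = cst 1) //; apply/funext => w; exact: weight_nil.
rewrite (_ : weight _ = fun w => weight u w * `|Y (rcons u a) w|); last first.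
  by apply/funext => w; exact: weight_rcons.
apply: measurable_funM.
  by apply: IH; rewrite (leq_trans _ un) // size_rcons.
apply: measurableT_comp => //.
by apply: measurable_fun_sigma_of; split => //; case: (u).
Qed.

Lemma measurable_mass m n : (m <= n)%N ->
  measurable_fun setT (mass m : sigma_of Y (level n) -> R).
Proof.
move=> mn; apply: measurable_sum => u; apply: measurable_funM => //.
by apply: measurable_weight; rewrite size_tuple.
Qed.

Lemma measurable_massT n : measurable_fun setT (mass n).
Proof.
exact: (measurableT_comp (measurable_mass (leqnn n))
  (@measurable_sigma_of_id _ _ _ _ _ Y (level n))).
Qed.

Lemma measurable_weightT u : measurable_fun setT (weight u : Omega -> R).
Proof.
exact: (measurableT_comp (measurable_weight (leqnn _))
  (@measurable_sigma_of_id _ _ _ _ _ Y (level (size u)))).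
Qed.

(** The last factor |Y (rcons u a)| is independent of all that is decided by the words of [level n],
    and its mean is that of X, namely 1. *)
Lemma integral_weight_rcons n u a (A : set (sigma_of Y (level n))) :
  (size u <= n)%N -> ~ level n (rcons u a) -> measurable A ->
  (\int[P]_w (weight (rcons u a) w * \1_A w)%:E =
   \int[P]_w (weight u w * \1_A w)%:E)%E.
Proof.
move=> un ua mA.
pose F (z : sigma_of Y (level n) * R) : \bar R := (weight u z.1 * \1_A z.1 * `|z.2|)%:E.
transitivity (\int[P]_w F (w, Y (rcons u a) w))%E.
  by apply: eq_integral => w _; rewrite /F /= weight_rcons mulrAC.
have mI : measurable_fun setT (\1_A : sigma_of Y (level n) -> R).
  exact: measurable_indic.
have mF : measurable_fun setT F.
  apply/measurable_EFinP; apply: measurable_funM; last first.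
    by apply: measurableT_comp => //; exact: measurable_snd.
  apply: measurable_funM.
    exact: (measurableT_comp (measurable_weight un) measurable_fst).
  exact: (measurableT_comp mI measurable_fst).
rewrite (independent_fubini Y_iid (S := level n)) //.
- have mA' : measurable (A : set Omega) by exact: sigma_of_measurable mA.
  have mZ : measurable_fun setT (fun w : Omega => (weight u w * \1_A w)%:E).
    apply/measurable_EFinP; apply: measurable_funM => //.
    exact: (measurableT_comp (measurable_weight un)
      (@measurable_sigma_of_id _ _ _ _ _ Y (level n))).
  have Z0 w : setT w -> (0 <= (weight u w * \1_A w)%:E)%E.
    by move=> _; rewrite lee_fin mulr_ge0 ?weight_ge0.
  have mXe : measurable_fun setT (fun t => (X t)%:E) by exact/measurable_EFinP.
  have Xe0 t : setT t -> (0 <= (X t)%:E)%E by rewrite lee_fin.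
  have I0 := integral_ge0 P Z0.
  rewrite /F /= -[RHS]mul1e -EX -ge0_integralZr //.
  apply: eq_integral => t _; rewrite -ge0_integralZl ?lee_fin //.
  by apply: eq_integral => w _; rewrite -EFinM (ger0_norm (X_ge0 t)) mulrC.
- by move=> v [].
- by case: (u).
- by move=> z; rewrite lee_fin !mulr_ge0 ?weight_ge0.
Qed.

(** The masses of the children of a cylinder add up to its own: both sums are the nu-integral of one
    function of the first n letters. *)
Lemma sum_level n (G : seq (alphabet b) -> \bar R) : (forall u, 0 <= G u)%E ->
  (\sum_(v : n.+1.-tuple (alphabet b)) G (take n v) * (cylmass nu v)%:E =
   \sum_(u : n.-tuple (alphabet b)) G u * (cylmass nu u)%:E)%E.
Proof.
move=> G0.
under eq_bigr do rewrite -cylmassE.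
under [RHS]eq_bigr do rewrite -cylmassE.
rewrite -(@integral_initial_word _ _ nu n.+1 (fun v => G (take n v))) //.
rewrite -(@integral_initial_word _ _ nu n G) //.
by apply: eq_integral => x _; rewrite take_initial_word.
Qed.

(** The martingale property, tested on events of time n in place of a conditional expectation:
    average out the last weight of each word of length n + 1, then group these words by parent. *)
Lemma mass_martingale n (A : set (sigma_of Y (level n))) : measurable A ->
  (\int[P]_w (mass n.+1 w * \1_A w)%:E = \int[P]_w (mass n w * \1_A w)%:E)%E.
Proof.
move=> mA.
have mA' : measurable (A : set Omega) by exact: sigma_of_measurable mA.
have mw := measurable_weightT.
have E m : (\int[P]_w (mass m w * \1_A w)%:E =
   \sum_(u : m.-tuple (alphabet b))
     \int[P]_w (weight u w * \1_A w)%:E * (cylmass nu u)%:E)%E.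
  under eq_integral => w _ do rewrite /mass mulr_suml -sumEFin.
  have mi u : measurable_fun setT (fun w => (weight u w * \1_A w)%:E).
    by apply/measurable_EFinP; apply: measurable_funM.
  rewrite ge0_integral_sum //.
  - apply: eq_bigr => u _.
    under eq_integral => w _ do rewrite -mulrA EFinM muleC.
    rewrite ge0_integralZr //.
    + by move=> w _; rewrite lee_fin mulr_ge0 ?weight_ge0.
    + by rewrite lee_fin cylmass_ge0.
  - move=> u; apply/measurable_EFinP; apply: measurable_funM => //.
    exact: measurable_funM.
  - by move=> u w _; rewrite lee_fin !mulr_ge0 ?cylmass_ge0 ?weight_ge0.
rewrite !E -(@sum_level n (fun u => \int[P]_w (weight u w * \1_A w)%:E)%E); last first.
  by move=> u; apply: integral_ge0 => w _; rewrite lee_fin mulr_ge0 ?weight_ge0.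
apply: eq_bigr => v _; congr (_ * _)%E.
have [u [a va]] : exists u a, val v = rcons u a.
  have := valP v; case/lastP: (val v) => // u a _.
  by exists u, a.
have su : size u = n by have := valP v; rewrite va size_rcons => /eqP[].
rewrite va -cats1 take_cat su ltnn subnn take0 cats0 cats1.
apply: integral_weight_rcons; rewrite ?su //.
by move=> []; rewrite size_rcons su ltnn.
Qed.

End cascade_mass.

(** * Doob's maximal inequality and almost sure convergence to 0 *)

Section maximal_inequality.
Variables (b : nat) (R : realType).
Context d (Omega : measurableType d) (P : probability Omega R).
Context d' (Omega' : measurableType d') (P' : probability Omega' R).
Variables (X : {RV P' >-> R}) (Y : seq (alphabet b) -> {RV P >-> R}).
Local Notation words := [set u : seq (alphabet b) | u != [::]].
Hypothesis X_ge0 : forall w, 0 <= X w.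
Hypothesis EX : (\int[P']_t (X t)%:E = 1)%E.
Hypothesis Y_iid : iid_copies X words Y.
Variable nu : probability (seqspace b) R.
Local Notation mass := (mass Y nu).
Local Notation F n := (sigma_of Y (@level b n)).

(** The inspected times are n, ..., n + N - 1; thus [exceeds a 0 n.+1] concerns the times up to n
    and belongs to the sigma-field of time n. *)
Definition exceeds (a : R) n N : set Omega :=
  [set w | has (fun m => a <= mass m w) (iota n N)].

Lemma measurable_exceeds a n N q : (n + N <= q.+1)%N ->
  measurable (exceeds a n N : set (F q)).
Proof.
elim: N n => [|N IH] n nN.
  by rewrite (_ : exceeds a n 0 = set0) //; apply/seteqP; split.
rewrite (_ : exceeds a n N.+1 = [set w | a <= mass n w] `|` exceeds a n.+1 N).
  apply: measurableU; last by apply: IH; rewrite addSnnS.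
  rewrite -[X in measurable X]setTI.
  apply: (@measurable_fun_ler _ (F q)) => //.
  by apply: measurable_mass; move: nN; rewrite addnS ltnS; apply: leq_trans; exact: leq_addr.
by apply/seteqP; split => w /=; rewrite /exceeds /= => /orP.
Qed.

Lemma measurable_exceedsT a n N : measurable (exceeds a n N).
Proof. exact: (sigma_of_measurable (measurable_exceeds a (leqnSn (n + N)))). Qed.

Let mA_T n (A : set Omega) : measurable (A : set (F n)) -> measurable A.
Proof. exact: sigma_of_measurable. Qed.

Let mass1_ge0 n (A : set Omega) w : (0 <= (mass n w * \1_A w)%:E)%E.
Proof. by rewrite lee_fin mulr_ge0 ?mass_ge0. Qed.

Let measurable_mass1 n (A : set Omega) : measurable A ->
  measurable_fun setT (fun w => (mass n w * \1_A w)%:E).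
Proof.
move=> mA; apply/measurable_EFinP; apply: measurable_funM => //.
exact: measurable_massT.
Qed.

Lemma markov_mass (a : R) n (A : set Omega) : 0 <= a -> measurable A ->
  (forall w, A w -> a <= mass n w) ->
  (a%:E * P A <= \int[P]_w (mass n w * \1_A w)%:E)%E.
Proof.
move=> a0 mA Aa.
have -> : P A = (\int[P]_w (\1_A w)%:E)%E by rewrite integral_indic // setIT.
have m1 : measurable_fun setT (fun w => (\1_A w : R)%:E) by exact/measurable_EFinP.
rewrite -ge0_integralZl //.
apply: ge0_le_integral => //.
- by move=> w _; rewrite -EFinM lee_fin mulr_ge0.
- exact: emeasurable_funM.
- exact: measurable_mass1.
move=> w _; rewrite -EFinM lee_fin indicE.
by case: (boolP (w \in A)) => wA; rewrite ?mulr0 // !mulr1 Aa //; exact: set_mem.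
Qed.

(** Induction on the number of inspected times. The part of A where height a is reached at time n is
    handled by Markov's inequality; the rest is an event of time n, so its mass is the same at time
    n + 1. *)
Lemma maximal_inequality_fin (a : R) N n (A : set Omega) : 0 <= a ->
  measurable (A : set (F n)) ->
  (a%:E * P (A `&` exceeds a n N) <= \int[P]_w (mass n w * \1_A w)%:E)%E.
Proof.
move=> a0; elim: N n A => [|N IH] n A mA.
  rewrite (_ : exceeds a n 0 = set0); last by apply/seteqP; split.
  by rewrite setI0 measure0 mule0; apply: integral_ge0.
pose A1 : set Omega := A `&` [set w | a <= mass n w].
pose A2 : set Omega := A `&` [set w | mass n w < a].
have mm : measurable_fun setT (mass n : F n -> R) by exact: measurable_mass.
have mA1 : measurable (A1 : set (F n)).
  by apply: measurableI => //; rewrite -[X in measurable X]setTI; exact: measurable_fun_ler.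
have mA2 : measurable (A2 : set (F n)).
  by apply: measurableI => //; rewrite -[X in measurable X]setTI; exact: measurable_fun_ltr.
have mA2' : measurable (A2 : set (F n.+1)).
  by apply: (sigma_of_sub _ mA2); exact: level_sub.
have sub : A `&` exceeds a n N.+1 `<=` A1 `|` (A2 `&` exceeds a n.+1 N).
  move=> w [Aw] /= /orP[aw|aw]; first by left.
  by have [?|?] := leP a (mass n w); [left|right].
have mE := measurable_exceedsT.
apply: (@le_trans _ _ (a%:E * (P A1 + P (A2 `&` exceeds a n.+1 N)))%E).
  apply: lee_wpmul2l; first by rewrite lee_fin.
  apply: (le_trans (le_measure _ _ _ sub)).
  - by rewrite inE; apply: measurableI; [exact: mA_T mA|exact: mE].
  - rewrite inE; apply: measurableU; first exact: mA_T mA1.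
    by apply: measurableI; [exact: mA_T mA2|exact: mE].
  - apply: measureU2; first exact: mA_T mA1.
    by apply: measurableI; [exact: mA_T mA2|exact: mE].
have -> : (\int[P]_w (mass n w * \1_A w)%:E =
  \int[P]_w (mass n w * \1_A1 w)%:E + \int[P]_w (mass n w * \1_A2 w)%:E)%E.
  rewrite -ge0_integralD //; 
    [|exact: measurable_mass1 (mA_T mA1)|exact: measurable_mass1 (mA_T mA2)].
  apply: eq_integral => w _; rewrite -EFinD -mulrDr; congr (_ * _)%:E.
  rewrite !indicE /A1 /A2 !in_setI -natrD; congr (_%:R).
  case: (w \in A) => //=.
  have -> : (w \in [set w | a <= mass n w]) = (a <= mass n w).
    by apply/idP/idP => [/set_mem//|?]; exact: mem_set.
  have -> : (w \in [set w | mass n w < a]) = (mass n w < a).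
    by apply/idP/idP => [/set_mem//|?]; exact: mem_set.
  by case: leP.
rewrite ge0_muleDr //; apply: leeD.
  by apply: markov_mass => //; [exact: mA_T mA1|move=> w []].
rewrite -(mass_martingale X_ge0 EX Y_iid nu mA2).
exact: IH.
Qed.

Lemma maximal_inequality (a : R) n (A : set Omega) : 0 <= a ->
  measurable (A : set (F n)) ->
  (a%:E * P (A `&` \bigcup_N exceeds a n N) <=
   \int[P]_w (mass n w * \1_A w)%:E)%E.
Proof.
move=> a0 mA.
have nd : nondecreasing_seq (fun N => A `&` exceeds a n N).
  move=> M N MN; apply/subsetPset => w [Aw ew]; split => //.
  by move: ew; rewrite /exceeds /= -(subnKC MN) iotaD has_cat => ->.
have mE N : measurable (A `&` exceeds a n N : set Omega).
  by apply: measurableI; [exact: mA_T mA|exact: measurable_exceedsT].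
have cv : P (A `&` exceeds a n N) @[N --> \oo] --> P (\bigcup_N (A `&` exceeds a n N)).
  apply: nondecreasing_cvg_mu => //.
  exact: bigcupT_measurable.
rewrite setI_bigcupr.
have cv2 := @cvgeZl _ _ _ _ _ a%:E isT cv.
apply: (cvge_to_le cv2); apply: nearW => N; exact: maximal_inequality_fin.
Qed.

(* The maximal inequality is applied twice: from time 0 at height k, and from
   time n at height e on the event that the mass has stayed below k. *)
Lemma mass_cvg0 :
  (forall k : nat, (0 < k)%N ->
    (\int[P]_w (mass n w * \1_(~` exceeds k%:R 0 n.+1) w)%:E)%E @[n --> \oo]
      --> 0%E)
  -> {ae P, forall w, mass n w @[n --> \oo] --> (0 : R)}.
Proof.
move=> H.
pose L (e : R) := \bigcap_n \bigcup_N exceeds e n N.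
have mL e : measurable (L e).
  by apply: bigcapT_measurable => n; apply: bigcupT_measurable => N; exact: measurable_exceedsT.
have L0 e : 0 < e -> P (L e) = 0%E.
  move=> e0.
  have bound (k : nat) : (0 < k)%N -> (P (L e) <= (k%:R^-1)%:E)%E.
    move=> k0.
    have k0' : 0 < k%:R :> R by rewrite ltr0n.
    pose EN := \bigcup_N exceeds k%:R 0 N.
    have mEN : measurable EN by apply: bigcupT_measurable => N; exact: measurable_exceedsT.
    have b1 : (P EN <= (k%:R^-1)%:E)%E.
      have := @maximal_inequality k%:R 0%N setT (ltW k0') measurableT.
      rewrite setTI.
      have -> : (\int[P]_w (mass 0 w * \1_setT w)%:E = 1)%E.
        under eq_integral do rewrite mass0 mul1r.
        by rewrite integral_indic // setIT; exact: probability_setT.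
      move=> h.
      by rewrite -(@lee_pmul2l _ k%:R%:E) // ?lte_fin // -EFinM divff // gt_eqF.
    pose An : nat -> set Omega := fun n => ~` exceeds k%:R 0 n.+1.
    have mAn n : measurable (An n : set (F n)).
      by apply: measurableC; exact: measurable_exceeds.
    pose y n := (\int[P]_w (mass n w * \1_(An n) w)%:E)%E.
    have mEe n : measurable (\bigcup_N exceeds e n N).
      by apply: bigcupT_measurable => N; exact: measurable_exceedsT.
    have b2 n : (e%:E * P (L e) <= (e / k%:R)%:E + y n)%E.
      have sub : L e `<=` EN `|` (An n `&` \bigcup_N exceeds e n N).
        move=> w Lw; have [ew|ew] := pselect (exceeds k%:R 0 n.+1 w).
          by left; exists n.+1.
        by right; split => //; exact: Lw.
      have mB : measurable (An n `&` \bigcup_N exceeds e n N).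
        by apply: measurableI => //; exact: mA_T (mAn n).
      apply: (@le_trans _ _ (e%:E * (P EN + P (An n `&` \bigcup_N exceeds e n N)))%E).
        apply: lee_wpmul2l; first by rewrite lee_fin ltW.
        apply: (le_trans (le_measure _ _ _ sub)); rewrite ?inE //.
          exact: measurableU.
        exact: measureU2.
      rewrite ge0_muleDr //; apply: leeD; last by apply: maximal_inequality => //; exact: ltW.
      by rewrite EFinM; apply: lee_wpmul2l => //; rewrite lee_fin ltW.
    have cv : ((e / k%:R)%:E + y n)%E @[n --> \oo] --> (e / k%:R)%:E.
      rewrite -[X in _ --> X]adde0; apply: cvgeD => //; last exact: H.
      exact: cvg_cst.
    have : (e%:E * P (L e) <= (e / k%:R)%:E)%E.
      by apply: (cvge_to_ge cv); apply: nearW.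
    by rewrite EFinM lee_pmul2l // lte_fin.
  apply/eqP; rewrite eq_le measure_ge0 andbT.
  rewrite -(fineK (fin_num_measure P _ (mL e))) lee_fin leNgt; apply/negP => r0.
  pose r := fine (P (L e)); pose k := (Num.truncn r^-1).+1.
  have := bound k isT; rewrite -(fineK (fin_num_measure P _ (mL e))) lee_fin -/r.
  by apply/negP; rewrite -ltNge invf_plt ?posrE // truncnS_gt.
have aL : {ae P, forall w, forall j : nat, ~ L j.+1%:R^-1 w}.
  apply: ae_foralln => j; exists (L j.+1%:R^-1); split => //.
    by apply: L0; rewrite invr_gt0.
  by move=> w /= /contrapT.
apply: filterS aL => w Lw; apply/cvgr0Pnorm_lt => eps eps0.
pose j := Num.truncn eps^-1.
have : ~ L j.+1%:R^-1 w by exact: Lw.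
move=> /existsNP[n] /not_implyP[_ nw].
exists n => // m /= nm.
rewrite ger0_norm ?mass_ge0 // (@lt_trans _ _ j.+1%:R^-1) //; last first.
  by rewrite invf_plt ?posrE // truncnS_gt.
rewrite ltNge; apply/negP => mw; apply: nw; exists (m - n).+1 => //.
have mi : m \in iota n (m - n).+1 by rewrite mem_iota nm addnS subnKC //= ltnS.
suff : has (fun m => j.+1%:R^-1 <= mass m w) (iota n (m - n).+1) by [].
by apply/hasP; exists m.
Qed.

End maximal_inequality.

(** * From vanishing mass to singularity *)

Section singularity.
Variables (b : nat) (R : realType).
Context d (Omega : measurableType d) (P : probability Omega R).
Variables (Y : seq (alphabet b) -> {RV P >-> R}).
Variable nu : probability (seqspace b) R.

Lemma seqspace_compact : compact [set: seqspace b].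
Proof.
have fc : compact [set: alphabet b].
  by apply: finite_compact; exact: finite_finset.
have := @tychonoff nat (fun _ : nat => alphabet b) (fun=> setT) (fun=> fc).
by congr (compact _); rewrite eqEsubset.
Qed.

Lemma continuous_bounded_seqspace (phi : seqspace b -> R) : continuous phi ->
  exists B, forall x, `|phi x| <= B.
Proof.
move=> cphi.
have cc : compact (phi @` setT).
  apply: continuous_compact seqspace_compact.
  exact: continuous_subspaceT.
have /pinfty_ex_gt0[B _ hB] := compact_bounded cc.
by exists B => x; apply: hB; exists x.
Qed.

Lemma continuous_measurable_seqspace (phi : seqspace b -> R) : continuous phi ->
  measurable_fun setT phi.
Proof.
move=> /continuousP cphi.
apply: (measurability _ (RGenOpens.measurableE R)).
move=> _ [_ [x [y ->]] <-].
rewrite setTI; apply: open_measurable_seqspace; apply: cphi; exact: interval_open.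
Qed.

Lemma norm_Qn n w (x : seqspace b) : `|Qn Y n w x| = weight Y (initial_word x n) w.
Proof.
rewrite /Qn /weight normr_prod size_initial_word.
by apply: eq_big_nat => k /andP[_ kn]; rewrite take_initial_word.
Qed.

Lemma integral_norm_Qn n w : (\int[nu]_x `|Qn Y n w x|%:E = (mass Y nu n w)%:E)%E.
Proof.
under eq_integral do rewrite norm_Qn.
rewrite (@integral_initial_word _ _ nu n (fun u => (weight Y u w)%:E)).
  by rewrite /mass -sumEFin; apply: eq_bigr => u _; rewrite cylmassE -EFinM mulrC.
by move=> u; rewrite lee_fin weight_ge0.
Qed.

Lemma measurable_Qn n w : measurable_fun setT (fun x => Qn Y n w x).
Proof.
rewrite (_ : (fun x => Qn Y n w x) = fun x =>
    (fun u => \prod_(1 <= k < n.+1) Y (take k u) w) (initial_word x n)); last first.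
  apply/funext => x; apply: eq_big_nat => k /andP[_ kn].
  by rewrite take_initial_word.
exact: (measurable_initial_wordR n (fun u => \prod_(1 <= k < n.+1) Y (take k u) w)).
Qed.

(** The limit is the zero kernel. A continuous phi is bounded by compactness, and its integral
    against Q_n nu is at most this bound times [mass], the total variation of Q_n nu. *)
Lemma Q_singular_mass :
  {ae P, forall w, mass Y nu n w @[n --> \oo] --> (0 : R)} -> Q_singular Y nu.
Proof.
move=> m0; exists (@kzero _ _ Omega (seqspace b) R : R.-ker Omega ~> seqspace b).
split; last first.
  by apply: aeW => w A mA.
move: m0; apply: filterS => w mw; split.
  by rewrite /= /kzero /mzero ltry.
move=> phi cphi.
have [B hB] := continuous_bounded_seqspace cphi.
have mphi := continuous_measurable_seqspace cphi.
rewrite integral_measure_zero.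
have B0 : 0 <= B by apply: le_trans (hB point).
have mB : (fun n => (B * mass Y nu n w)%:E) @ \oo --> (0%R)%:E.
  apply: cvg_EFin; first exact: nearW.
  by rewrite -(mulr0 B); apply: cvgMl_tmp; exact: mw.
have mNB : (fun n => (- (B * mass Y nu n w)%:E)%E) @ \oo --> (0%R)%:E.
  by rewrite -[X in _ --> X]oppe0; apply: cvgeN; exact: mB.
have key n : (`|\int[nu]_x (phi x * Qn Y n w x)%:E| <= (B * mass Y nu n w)%:E)%E.
  have mQ := measurable_Qn n w.
  apply: le_trans (le_abse_integral _ _ _) _ => //.
    by apply/measurable_EFinP; exact: measurable_funM.
  have mN : measurable_fun setT (fun x => `|Qn Y n w x|%:E).
    by apply/measurable_EFinP; exact: measurableT_comp.
  rewrite EFinM -integral_norm_Qn -ge0_integralZl //.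
  apply: ge0_le_integral => //.
  - by apply/measurable_EFinP; apply: measurableT_comp => //; exact: measurable_funM.
  - by apply: emeasurable_funM => //; apply/measurable_EFinP; exact: measurableT_comp.
  by move=> x _; rewrite /= -EFinM lee_fin normrM ler_wpM2r.
apply: (squeeze_cvge _ mNB mB); apply: nearW => n.
apply/andP; split; last by apply: le_trans (lee_abs _) (key n).
by rewrite leeNl; apply: le_trans (key n); rewrite -abseN; exact: lee_abs.
Qed.

End singularity.

(** * Walks killed at the origin *)

Section killed_path.
Variable R : realType.

(* Where q vanishes, ln 0 = 0 moves the walk wrongly, but the factor |q| is 0. *)
Fixpoint killed_weight n (a q : nat -> R) (s : R) : R :=
  if n is n'.+1 then
    if s < 0 then `|q 0%N| * killed_weight n' (fun k => a k.+1) (fun k => q k.+1)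
      (s + (a 0%N + ln `|q 0%N|)) else 0
  else if s < 0 then 1 else 0.

Lemma killed_weight_ge0 n a q s : 0 <= killed_weight n a q s.
Proof. by elim: n a q s => [|n IH] a q s /=; case: ifP => // _; rewrite mulr_ge0. Qed.

Lemma killed_weight_alive n a q s :
  (forall m, (m <= n)%N -> s + \sum_(0 <= k < m) (a k + ln `|q k|) < 0) ->
  killed_weight n a q s = \prod_(0 <= k < n) `|q k|.
Proof.
elim: n a q s => [|n IH] a q s h /=.
  by have := h 0%N isT; rewrite !big_geq // addr0 => ->.
have s0 : s < 0 by have := h 0%N isT; rewrite big_geq // addr0.
rewrite s0.
rewrite IH => [|m mn]; first by rewrite big_nat_recl.
by have := h m.+1 mn; rewrite big_nat_recl // addrA.
Qed.

Lemma measurable_killed_weight d (Z : measurableType d) n a (q : nat -> Z -> R)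
    (s : Z -> R) : (forall k, measurable_fun setT (q k)) -> measurable_fun setT s ->
  measurable_fun setT (fun z => killed_weight n a (fun k => q k z) (s z)).
Proof.
elim: n a q s => [|n IH] a q s mq ms /=.
  by apply: measurable_fun_ifT => //; exact: measurable_fun_ltr.
apply: measurable_fun_ifT => //; first exact: measurable_fun_ltr.
apply: measurable_funM; first exact: measurableT_comp.
apply: IH => //; apply: measurable_funD => //; apply: measurable_funD => //.
by apply: measurableT_comp; [exact: measurable_ln|exact: measurableT_comp].
Qed.

End killed_path.

Section killed_mean.
Context d' (Omega' : measurableType d') (R : realType) (P' : probability Omega' R).
Variable X : {RV P' >-> R}.
Hypothesis X_ge0 : forall w, 0 <= X w.

(** For X of mean 1 the factor X turns P' into the size-biased law, and this is the probability that
    the walk from s with steps a k + ln X_k, the X_k independent and size-biased, is negative at the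
    times 0, ..., n. The recursion on the first step avoids constructing the walk. *)
Fixpoint killed_mean n (a : nat -> R) (s : R) : \bar R :=
  if n is n'.+1 then
    if s < 0 then (\int[P']_t ((X t)%:E *
      killed_mean n' (fun k => a k.+1) (s + (a 0%N + ln (X t)))))%E else 0%E
  else if s < 0 then 1%E else 0%E.

Lemma killed_mean_ge0 n a s : (0 <= killed_mean n a s)%E.
Proof.
elim: n a s => [|n IH] a s /=; case: ifP => // _.
by apply: integral_ge0 => t _; rewrite mule_ge0 ?lee_fin.
Qed.

Context d (Omega : measurableType d) (P : probability Omega R).
Variables (I : choiceType) (D : set I) (Y : I -> {RV P >-> R}).
Hypothesis Y_iid : iid_copies X D Y.

(** As i is injective, the first factor Y (i 0) is independent of the later ones; averaging over it
    reproduces the recursion of [killed_mean]. *)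
Lemma integral_killed_weight n a s (i : nat -> I) : injective i ->
  (forall k, D (i k)) ->
  (\int[P]_w (killed_weight n a (fun k => Y (i k) w) s)%:E = killed_mean n a s)%E.
Proof.
elim: n a s i => [|n IH] a s i inj Di /=.
  by case: ifP => _; rewrite integral_cst //= probability_setT mule1.
case: ifP => s0; last by rewrite integral0_eq.
pose S := range (fun k => i k.+1).
pose F (z : sigma_of Y S * R) : \bar R := (`|z.2| *
  killed_weight n (fun k => a k.+1) (fun k => Y (i k.+1) z.1)
   (s + (a 0%N + ln `|z.2|)))%:E.
have F0 z : (0 <= F z)%E by rewrite lee_fin mulr_ge0 ?killed_weight_ge0.
have mkw : measurable_fun setT (fun z : sigma_of Y S * R =>
   killed_weight n (fun k => a k.+1) (fun k => Y (i k.+1) z.1)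
   (s + (a 0%N + ln `|z.2|))).
  apply: (@measurable_killed_weight _ _ (sigma_of Y S * R)%type n _
    (fun k z => Y (i k.+1) z.1) (fun z => s + (a 0%N + ln `|z.2|))).
    move=> k; have m1 : measurable_fun setT (Y (i k.+1) : sigma_of Y S -> R).
      by apply: measurable_fun_sigma_of; exists k.
    exact: (measurableT_comp m1 measurable_fst).
  do 2! apply: measurable_funD => //.
  apply: measurableT_comp; first exact: measurable_ln.
  by apply: measurableT_comp => //; exact: measurable_snd.
have mF : measurable_fun setT F.
  apply/measurable_EFinP; apply: measurable_funM => //.
  by apply: measurableT_comp => //; exact: measurable_snd.
rewrite -[LHS]/(\int[P]_w F (w, Y (i 0%N) w))%E.
have SD : S `<=` D by move=> _ [k _ <-]; exact: Di.
have nS : ~ S (i 0%N) by move=> [k _ /inj].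
rewrite (independent_fubini Y_iid SD (Di 0%N) nS mF F0).
apply: eq_integral => t _.
rewrite -(IH _ _ (fun k => i k.+1)); [|by move=> k l /inj []|by move=> k].
have m0 : measurable_fun setT (fun w : Omega => (killed_weight n (fun k => a k.+1)
    (fun k => Y (i k.+1) w) (s + (a 0%N + ln (X t))))%:E).
  by apply/measurable_EFinP; exact: (@measurable_killed_weight _ _ _ _ _ (fun k => Y (i k.+1))).
rewrite -ge0_integralZl //; [|by move=> w _; rewrite lee_fin killed_weight_ge0
  |by rewrite lee_fin].
by apply: eq_integral => w _; rewrite /F /= -EFinM (ger0_norm (X_ge0 t)).
Qed.

End killed_mean.

(** * Survival probability of the walk over an ergodic base *)

Section killed_limit.
Context dE (E : measurableType dE) (R : realType) (nu : probability E R).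
Variable T : E -> E.
Hypothesis mT : measurable_fun setT T.
Hypothesis T_inv : forall A, measurable A -> nu (T @^-1` A) = nu A.
Hypothesis T_erg :
  forall A, measurable A -> T @^-1` A = A -> nu A = 0%E \/ nu A = 1%E.
Context d' (Omega' : measurableType d') (P' : probability Omega' R).
Variable X : {RV P' >-> R}.
Hypothesis X_ge0 : forall w, 0 <= X w.
Hypothesis EX : (\int[P']_t (X t)%:E = 1)%E.
Variable h : E -> R.
Hypothesis mh : measurable_fun setT h.

Definition killed n x s := killed_mean X n (fun k => h (iter k T x)) s.

Lemma killedS n x s : killed n.+1 x s =
  if s < 0 then (\int[P']_t ((X t)%:E * killed n (T x) (s + (h x + ln (X t)))))%E
  else 0%E.
Proof.
rewrite /killed /=; case: ifP => // _; apply: eq_integral => t _.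
by congr (_ * killed_mean _ _ _ _)%E; apply/funext => k; rewrite -iterSr.
Qed.

Lemma killed_ge0 n x s : (0 <= killed n x s)%E.
Proof. exact: killed_mean_ge0. Qed.

Let mXe : measurable_fun setT (fun t => (X t)%:E).
Proof. exact/measurable_EFinP. Qed.

Lemma measurable_killed n : measurable_fun setT (fun z : E * R => killed n z.1 z.2).
Proof.
elim: n => [|n IH].
  rewrite /killed /=; apply: measurable_fun_ifT; [|exact: measurable_cst|exact: measurable_cst].
  by apply: measurable_fun_ltr; [exact: measurable_snd|exact: measurable_cst].
under eq_fun do rewrite killedS.
apply: measurable_fun_ifT; last exact: measurable_cst.
  by apply: measurable_fun_ltr; [exact: measurable_snd|exact: measurable_cst].
apply: (@measurable_fun_fubini_tonelli_F _ _ _ _ _ P' (fun q : (E * R) * Omega' =>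
  ((X q.2)%:E * killed n (T q.1.1) (q.1.2 + (h q.1.1 + ln (X q.2))))%E)).
  have m1 : measurable_fun setT (fun q : (E * R) * Omega' => q.1.1).
    exact: (measurableT_comp measurable_fst measurable_fst).
  have m2 : measurable_fun setT (fun q : (E * R) * Omega' => q.1.2).
    exact: (measurableT_comp measurable_snd measurable_fst).
  have m3 : measurable_fun setT (fun q : (E * R) * Omega' => X q.2).
    by apply: measurableT_comp => //; exact: measurable_snd.
  apply: emeasurable_funM; first exact/measurable_EFinP.
  have mT1 := measurableT_comp mT m1.
  have ms : measurable_fun setT (fun q : (E * R) * Omega' =>
      q.1.2 + (h q.1.1 + ln (X q.2))).
    apply: measurable_funD => //; apply: measurable_funD.
      exact: (measurableT_comp mh m1).
    exact: (measurableT_comp (@measurable_ln R) m3).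
  exact: (measurableT_comp IH (measurable_fun_pair mT1 ms)).
by move=> q; rewrite mule_ge0 ?lee_fin ?killed_ge0.
Qed.

Let mstep n x s : measurable_fun setT
  (fun t => ((X t)%:E * killed n (T x) (s + (h x + ln (X t))))%E).
Proof.
apply: emeasurable_funM => //.
have ms : measurable_fun setT (fun t => s + (h x + ln (X t))).
  do 2! apply: measurable_funD => //.
  exact: (measurableT_comp (@measurable_ln R)).
exact: (measurableT_comp (measurable_killed n)
  (measurable_fun_pair (measurable_cst (T x)) ms)).
Qed.

Let step_ge0 n x s t : setT t ->
  (0 <= (X t)%:E * killed n (T x) (s + (h x + ln (X t))))%E.
Proof. by move=> _; rewrite mule_ge0 ?lee_fin ?killed_ge0. Qed.

Lemma killed_le1 n x s : (killed n x s <= 1)%E.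
Proof.
elim: n x s => [|n IH] x s; first by rewrite /killed /=; case: ifP.
rewrite killedS; case: ifP => // _.
rewrite -EX; apply: ge0_le_integral => //; first exact: step_ge0.
by move=> t _; rewrite -[leRHS]mule1; apply: lee_wpmul2l; rewrite ?lee_fin.
Qed.

Lemma killed_nincr_time n x s : (killed n.+1 x s <= killed n x s)%E.
Proof.
elim: n x s => [|n IH] x s.
  have := killed_le1 1 x s; rewrite /killed /=; case: ifP => //.
rewrite killedS [leRHS]killedS; case: ifP => // _.
apply: ge0_le_integral => //; first exact: step_ge0.
by move=> t _; apply: lee_wpmul2l; rewrite ?lee_fin.
Qed.

Lemma killed_nincr n x s s' : s <= s' -> (killed n x s' <= killed n x s)%E.
Proof.
elim: n x s s' => [|n IH] x s s' ss'.
  rewrite /killed /=; case: ifP => s'0; case: ifP => // s0.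
  by move: s0; rewrite (le_lt_trans ss' s'0).
rewrite killedS [leRHS]killedS; case: ifP => s'0; last first.
  by case: ifP => // _; apply: integral_ge0; exact: step_ge0.
rewrite (le_lt_trans ss' s'0); apply: ge0_le_integral => //; first exact: step_ge0.
move=> t _; apply: lee_wpmul2l; rewrite ?lee_fin //.
by apply: IH; rewrite lerD2r.
Qed.

Lemma killed_eq0 n x s : 0 <= s -> killed n x s = 0%E.
Proof. by case: n => [|n] s0; rewrite /killed /= ltNge s0. Qed.

Let u x s := fine (limn (fun n => killed n x s)).

Let killed_cvgE x s : killed n x s @[n --> \oo] --> limn (fun n => killed n x s).
Proof.
apply: ereal_nonincreasing_is_cvgn; apply/nonincreasing_seqP => n.
exact: killed_nincr_time.
Qed.

Let killed_cvg x s : killed n x s @[n --> \oo] --> (u x s)%:E.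
Proof.
rewrite /u fineK; first exact: killed_cvgE.
have l0 : (0 <= limn (fun n => killed n x s))%E.
  by apply: lime_ge; [exact: killed_cvgE|apply: nearW => n; exact: killed_ge0].
rewrite ge0_fin_numE // (@le_lt_trans _ _ 1%E) ?ltry //.
by apply: lime_le; [exact: killed_cvgE|apply: nearW => n; exact: killed_le1].
Qed.

Let u01 x s : 0 <= u x s <= 1.
Proof.
apply/andP; split; rewrite -lee_fin.
  by apply: (cvge_to_ge (@killed_cvg x s)); apply: nearW => n; exact: killed_ge0.
by apply: (cvge_to_le (@killed_cvg x s)); apply: nearW => n; exact: killed_le1.
Qed.

Let u_le n x s : ((u x s)%:E <= killed n x s)%E.
Proof.
apply: (cvge_to_le (@killed_cvg x s)); exists n => // m /= nm.
elim: m nm => [|m IH]; first by rewrite leqn0 => /eqP ->.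
rewrite leq_eqVlt => /predU1P[->//|]; rewrite ltnS => /IH.
exact: le_trans (killed_nincr_time _ _ _).
Qed.

Let u_ni x s s' : s <= s' -> u x s' <= u x s.
Proof.
move=> ss'; rewrite -lee_fin; apply: (cvge_to_ge (@killed_cvg x s)).
by apply: nearW => n; exact: (le_trans (u_le n x s') (killed_nincr n x ss')).
Qed.

Let u_eq0 x s : 0 <= s -> u x s = 0.
Proof.
move=> s0; apply/eqP; rewrite eq_le; have /andP[-> _] := u01 x s; rewrite andbT.
by rewrite -lee_fin (le_trans (u_le 0 x s)) // killed_eq0.
Qed.

Let mes_u : measurable_fun setT (fun z : E * R => u z.1 z.2).
Proof.
apply/measurable_EFinP.
apply: (@emeasurable_fun_cvg _ _ _ _ (fun n (z : E * R) => killed n z.1 z.2)).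
  by move=> n; exact: measurable_killed.
by move=> z _; exact: killed_cvg.
Qed.

(** Dominated convergence in the recursion [killedS]. At s >= 0 the walk is already killed while the
    right-hand side may be positive, whence an inequality only. *)
Let u_sub x s :
  ((u x s)%:E <= \int[P']_t (X t * u (T x) (s + (h x + ln (X t))))%:E)%E.
Proof.
have iX : P'.-integrable setT (fun t => (X t)%:E) by exact: integrable_weight.
have mlim : measurable_fun setT (fun t => (X t * u (T x) (s + (h x + ln (X t))))%:E).
  apply/measurable_EFinP; apply: measurable_funM => //.
  have ms : measurable_fun setT (fun t => s + (h x + ln (X t))).
    do 2! apply: measurable_funD => //.
    exact: (measurableT_comp (@measurable_ln R)).
  exact: (measurableT_comp mes_u (measurable_fun_pair (measurable_cst (T x)) ms)).
have cv : {ae P', forall t, setT t ->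
    ((X t)%:E * killed n (T x) (s + (h x + ln (X t))))%E @[n --> \oo] -->
    (X t * u (T x) (s + (h x + ln (X t))))%:E}.
  apply: aeW => t _; rewrite EFinM; apply: cvgeZl => //; exact: killed_cvg.
have dom : {ae P', forall t n, setT t ->
    (`|(X t)%:E * killed n (T x) (s + (h x + ln (X t)))| <= (X t)%:E)%E}.
  apply: aeW => t n _; rewrite gee0_abs ?step_ge0 //.
  by rewrite -[leRHS]mule1; apply: lee_wpmul2l; rewrite ?lee_fin // killed_le1.
have [_ _ lim] := dominated_convergence measurableT (fun n => mstep n x s) mlim cv iX dom.
apply: (cvge_to_ge lim); apply: nearW => n.
apply: (le_trans (u_le n.+1 x s)); rewrite killedS; case: ifP => // _.
by apply: integral_ge0; exact: step_ge0.
Qed.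

Hypothesis intf : nu.-integrable setT (EFin \o h).
Hypothesis iXlnX : P'.-integrable setT (fun t => (X t * ln (X t))%:E).
Hypothesis drift_ge0 :
  (0 <= \int[nu]_x (h x)%:E + \int[P']_t (X t * ln (X t))%:E)%E.

Lemma killed_cvg0 (a b : R) : a < b ->
  (0 < P' [set t | (X t != 0 /\ ln (X t) <= a)%R])%E ->
  (0 < P' [set t | (X t != 0 /\ b <= ln (X t))%R])%E ->
  {ae nu, forall x, forall s, killed n x s @[n --> \oo] --> 0%E}.
Proof.
move=> ab Pa Pb.
have mlnX : measurable_fun setT (fun t => ln (X t)).
  exact: (measurableT_comp (@measurable_ln R)).
have mX : measurable_fun setT (X : Omega' -> R) by [].
have := subharmonic_eq0 mT T_inv T_erg mX X_ge0 EX mlnX iXlnX mh intf drift_ge0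
  mes_u u01 u_ni u_eq0 u_sub ab Pa Pb.
by apply: filterS => x ux s; have := @killed_cvg x s; rewrite ux.
Qed.

End killed_limit.

(** * Comparison of the mass with the walk along a spine *)

Section spine.
Variables (b : nat) (R : realType).
Context d (Omega : measurableType d) (P : probability Omega R).
Context d' (Omega' : measurableType d') (P' : probability Omega' R).
Variables (X : {RV P' >-> R}) (Y : seq (alphabet b) -> {RV P >-> R}).
Local Notation words := [set u : seq (alphabet b) | u != [::]].
Hypothesis X_ge0 : forall w, 0 <= X w.
Hypothesis EX : (\int[P']_t (X t)%:E = 1)%E.
Hypothesis Y_iid : iid_copies X words Y.
Variable nu : probability (seqspace b) R.
Local Notation mass := (mass Y nu).
Local Notation T := (@left_shift b).

Variables (c h : seqspace b -> R).
Hypothesis mc : measurable_fun setT c.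
Hypothesis mh : measurable_fun setT h.
Hypothesis gibbs_lower : {ae nu, forall x, forall n,
  0 < cylmass nu (initial_word x n) /\
  - c x + \sum_(0 <= k < n) h (iter k T x) <= ln (cylmass nu (initial_word x n))}.
Hypothesis killed0 : {ae nu, forall x, forall s,
  killed T X h n x s @[n --> \oo] --> 0%E}.

Lemma weight_initial_word (x : seqspace b) n w :
  weight Y (initial_word x n) w =
  \prod_(0 <= k < n) `|Y (initial_word x k.+1) w|.
Proof.
elim: n => [|n IH]; first by rewrite big_geq // (_ : initial_word x 0 = [::]) // weight_nil.
by rewrite big_nat_recr //= -IH initial_wordS weight_rcons.
Qed.

(** The condition that the total mass stays below a is weakened to one on the single branch of u,
    where it can be read as a condition on a walk. *)
Definition stopped_weight (a : R) (u : seq (alphabet b)) w : R :=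
  if all (fun m => cylmass nu (take m u) * weight Y (take m u) w < a)
         (iota 0 (size u).+1)
  then weight Y u w else 0.

Let stopped_weight_ge0 a u w : 0 <= stopped_weight a u w.
Proof. by rewrite /stopped_weight; case: ifP => // _; exact: weight_ge0. Qed.

Let mw u : measurable_fun setT (weight Y u : Omega -> R).
Proof. exact: measurable_weightT. Qed.

Let measurable_stopped_weight a u : measurable_fun setT (stopped_weight a u).
Proof.
apply: measurable_fun_ifT => //.
elim: (iota _ _) => [|m s IH] /=; first exact: measurable_cst.
apply: measurable_and => //; apply: measurable_fun_ltr => //.
exact: measurable_funM.
Qed.

(** Taking the logarithm of nu[x|m] W_(x|m) < a and inserting the lower Gibbs bound shows that the
    walk from -c x - ln a is negative at time m. *)
Lemma stopped_weight_le (x : seqspace b) n w (a : R) : 0 < a ->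
  (forall n, 0 < cylmass nu (initial_word x n) /\
  - c x + \sum_(0 <= k < n) h (iter k T x) <= ln (cylmass nu (initial_word x n))) ->
  stopped_weight a (initial_word x n) w <=
  killed_weight n (fun k => h (iter k T x)) (fun k => Y (initial_word x k.+1) w)
    (- c x - ln a).
Proof.
move=> a0 hx; rewrite /stopped_weight size_initial_word.
case: ifP => [alive|_]; last exact: killed_weight_ge0.
(* When the weight is nonzero, all factors along the branch are positive, and the logarithm of the
   product is the sum of the logarithms. *)
have [->|w0] := eqVneq (weight Y (initial_word x n) w) 0; first exact: killed_weight_ge0.
have Y0 k : (k < n)%N -> 0 < `|Y (initial_word x k.+1) w|.
  move=> kn; rewrite normr_gt0; apply: contraNneq w0 => Yk.
  rewrite weight_initial_word (big_cat_nat (n := k)) //=; last exact: ltnW.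
  by rewrite [X in _ * X]big_ltn // Yk normr0 mul0r mulr0.
rewrite killed_weight_alive => [|m mn]; first by rewrite weight_initial_word.
have mi : m \in iota 0 n.+1 by rewrite mem_iota.
have := allP alive _ mi; rewrite take_initial_word //.
have [p0 pl] := hx m.
have wm0 : 0 < weight Y (initial_word x m) w.
  rewrite weight_initial_word big_mkord; apply: prodr_gt0 => k _; apply: Y0.
  exact: leq_trans (ltn_ord k) mn.
rewrite -ltr_ln ?posrE ?mulr_gt0 // lnM ?posrE //.
have -> : ln (weight Y (initial_word x m) w) =
    \sum_(0 <= k < m) ln `|Y (initial_word x k.+1) w|.
  rewrite weight_initial_word {p0 pl mi wm0}; elim: m mn => [|m IH] mn.
    by rewrite !big_geq // ln1.
  rewrite !big_nat_recr //= lnM ?posrE; first by rewrite IH // ltnW.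
    rewrite big_mkord; apply: prodr_gt0 => k _; apply: Y0.
    by rewrite (ltn_trans (ltn_ord k)).
  exact: Y0.
by rewrite big_split /=; lra.
Qed.

Let spine_mean a (u : seq (alphabet b)) : \bar R :=
  (\int[P]_w (stopped_weight a u w)%:E)%E.

(** A term of the mass is at most the mass, so while the mass is below a, every branch is. Summing
    over words with the weights nu[u] is integrating over a spine of law nu. *)
Lemma mass_le_spine (a : R) n :
  (\int[P]_w (mass n w * \1_(~` exceeds Y nu a 0 n.+1) w)%:E <=
   \int[nu]_x spine_mean a (initial_word x n))%E.
Proof.
have s0 u : (0 <= spine_mean a u)%E.
  by apply: integral_ge0 => w _; rewrite lee_fin.
have ms u : measurable_fun setT (fun w => (stopped_weight a u w)%:E).
  exact/measurable_EFinP.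
rewrite (@integral_initial_word _ _ nu n (spine_mean a) s0).
have -> : (\sum_(u : n.-tuple (alphabet b)) spine_mean a u * nu (cylinder u) =
   \int[P]_w \sum_(u : n.-tuple (alphabet b))
      ((cylmass nu u)%:E * (stopped_weight a u w)%:E))%E.
  rewrite ge0_integral_sum //.
  - apply: eq_bigr => u _; rewrite muleC cylmassE ge0_integralZl //.
      by move=> w _; rewrite lee_fin.
    by rewrite lee_fin cylmass_ge0.
  - by move=> u; exact: emeasurable_funM.
  - by move=> u w _; rewrite mule_ge0 // lee_fin ?cylmass_ge0.
have mE : measurable (~` exceeds Y nu a 0 n.+1).
  by apply: measurableC; exact: measurable_exceedsT.
apply: ge0_le_integral => //.
- by move=> w _; rewrite lee_fin mulr_ge0 ?mass_ge0.
- apply/measurable_EFinP; apply: measurable_funM => //.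
  exact: measurable_massT.
- by apply: emeasurable_sum => u; exact: emeasurable_funM.
move=> w _; under eq_bigr do rewrite -EFinM.
rewrite sumEFin lee_fin indicE.
case: (boolP (w \in ~` _)) => [|_]; last first.
  by rewrite mulr0; apply: sumr_ge0 => u _; rewrite mulr_ge0 ?cylmass_ge0.
move=> /set_mem /= nw; rewrite mulr1 /mass.
apply: ler_sum => u _; rewrite ler_wpM2l ?cylmass_ge0 //.
rewrite /stopped_weight ifT //; apply/allP => m; rewrite size_tuple mem_iota => /= mn.
rewrite ltNge; apply/negP => am; apply: nw; apply/hasP; exists m.
  by rewrite mem_iota.
apply: (le_trans am); rewrite /mass.
have sm : size (take m u) == m.
  by rewrite size_takel // size_tuple; move: mn; rewrite add0n ltnS.
rewrite (bigD1 (Tuple sm)) //= lerDl; apply: sumr_ge0 => v _.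
by rewrite mulr_ge0 ?cylmass_ge0 ?weight_ge0.
Qed.

Lemma mass_ae_cvg0 : {ae P, forall w, mass n w @[n --> \oo] --> (0 : R)}.
Proof.
apply: (mass_cvg0 X_ge0 EX Y_iid) => k k0.
have k0' : 0 < k%:R :> R by rewrite ltr0n.
have ms : measurable_fun setT (fun x => - c x - ln k%:R).
  by apply: measurable_funB => //; exact: measurable_funN.
pose F n x := killed T X h n x (- c x - ln k%:R).
have mF n : measurable_fun setT (F n).
  exact: (measurableT_comp (measurable_killed (@measurable_left_shift b) X_ge0 mh n)
    (measurable_fun_pair (@measurable_id _ (seqspace b) setT) ms)).
have F0 n x : (0 <= F n x)%E by exact: (killed_ge0 T X_ge0).
have cvF : {ae nu, forall x, setT x -> F n x @[n --> \oo] --> 0%E}.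
  by move: killed0; apply: filterS => x kx _; exact: kx.
have i1 : nu.-integrable setT (fun _ : seqspace b => 1%E).
  exact: (finite_measure_integrable_cst nu (1 : R)).
have dF : {ae nu, forall x n, setT x -> (`|F n x| <= 1)%E}.
  by apply: aeW => x n _; rewrite gee0_abs //;
    exact: (killed_le1 (@measurable_left_shift b) X_ge0 EX mh).
have [_ _] := dominated_convergence measurableT mF (measurable_cst 0%E) cvF i1 dF.
rewrite integral0 => cv.
apply: (squeeze_cvge _ (cvg_cst 0%E) cv).
apply: nearW => n; apply/andP; split.
  by apply: integral_ge0 => w _; rewrite lee_fin mulr_ge0 ?mass_ge0.
apply: (le_trans (mass_le_spine _ _)).
apply: ae_ge0_le_integral => //.
- by move=> x _; apply: integral_ge0 => w _; rewrite lee_fin.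
- exact: measurable_initial_word.
move: gibbs_lower; apply: filterS => x hx _.
have Di l : words (initial_word x l.+1) by [].
(* Words along a spine differ in length, so their weights are distinct members of the independent
   family. *)
have inj : injective (fun l => initial_word x l.+1).
  by move=> l m /(congr1 size); rewrite !size_initial_word => -[].
rewrite /F /killed -(integral_killed_weight X_ge0 Y_iid _ _ _ inj Di).
apply: ge0_le_integral => //.
- by move=> w _; rewrite lee_fin.
- exact/measurable_EFinP.
- apply/measurable_EFinP.
  exact: (@measurable_killed_weight _ _ _ _ _ (fun k => Y (initial_word x k.+1))).
by move=> w _; rewrite lee_fin stopped_weight_le.
Qed.

End spine.

(** * Integrability of the potential *)

Section gibbs_integrable.
Variables (b : nat) (R : realType).
Hypothesis b_gt0 : (0 < b)%N.
Variable nu : probability (seqspace b) R.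
Hypothesis nu_ergodic : shift_ergodic nu.
Variables C f : seqspace b -> \bar R.
Hypothesis nuG : gibbs nu C f.

Local Notation E := (seqspace b).
Local Notation T := (@left_shift b).

Definition block_entropy n : R :=
  \sum_(u : n.-tuple (alphabet b)) - (cylmass nu u * ln (cylmass nu u)).

Definition information n (x : E) : R := - ln (cylmass nu (initial_word x n)).

Lemma information_ge0 n x : 0 <= information n x.
Proof. by rewrite oppr_ge0 ln_le0 // cylmass_le1. Qed.

Lemma measurable_information n : measurable_fun setT (information n).
Proof. exact: (measurable_initial_wordR n (fun u => - ln (cylmass nu u))). Qed.

Lemma integral_information n :
  (\int[nu]_x (information n x)%:E = (block_entropy n)%:E)%E.
Proof.
rewrite (@integral_initial_word _ _ nu n (fun u => (- ln (cylmass nu u))%:E)) //.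
  rewrite /block_entropy -sumEFin; apply: eq_bigr => u _.
  by rewrite cylmassE -EFinM mulNr mulrC.
by move=> u; rewrite lee_fin oppr_ge0 ln_le0 // cylmass_le1.
Qed.

Let fr x := fine (f x).
Let c x := ln (fine (C x)).
Let S n x := \sum_(0 <= k < n) fr (iter k T x).

Let mfr : measurable_fun setT fr.
Proof. by case: nuG => _ mf _ _ _; exact: measurableT_comp. Qed.

Let mc : measurable_fun setT c.
Proof.
case: nuG => mC _ _ _ _; apply: measurableT_comp => //.
exact: measurableT_comp.
Qed.

Let T_inv := nu_ergodic.1.
Let T_erg := nu_ergodic.2.
Let mT := @measurable_left_shift b.

(** Property (G) in logarithms. Positivity of the cylinder masses comes from its lower bound; time
    0, which (G) does not cover, is added by means of c >= 0. *)
Lemma gibbs_information : {ae nu, forall x, 0 <= c x /\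
  forall n, [/\ 0 < cylmass nu (initial_word x n),
    - c x + S n x <= - information n x & - information n x <= c x + S n x]}.
Proof.
have [_ _ C1 Cfin H] := nuG.
move: Cfin H; apply: filterS2 => x [Cx fx] Hx.
have C1x : 1 <= fine (C x) by rewrite -lee_fin fineK.
have c0 : 0 <= c x by apply: ln_ge0.
split => // -[|n].
  rewrite /S big_geq // /information (_ : initial_word x 0 = [::]) // cylmass_nil ln1.
  by rewrite !addr0; split => //; lra.
have [h1 h2] := Hx n.+1 isT.
rewrite -/(S n.+1 x) in h1 h2.
have Cpos : 0 < fine (C x) by lra.
have p0 : 0 < cylmass nu (initial_word x n.+1).
  by apply: (lt_le_trans _ h1); rewrite mulr_gt0 ?invr_gt0 ?expR_gt0.
rewrite /information opprK; split => //.
- rewrite -[leLHS]expRK ler_ln ?posrE ?expR_gt0 //.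
  by rewrite expRD expRN /c lnK.
- rewrite -[leRHS]expRK ler_ln ?posrE ?expR_gt0 //.
  by rewrite expRD /c lnK.
Qed.

(* Cylinder masses decrease, so f (sigma^k x) <= 2 ln (C x) for all k; the sets
   {x | forall k, f (sigma^k x) <= a} are sub-invariant, hence of mass 0 or 1. *)
Lemma gibbs_potential_bounded : exists2 a : R, 0 <= a & {ae nu, forall x, fr x <= a}.
Proof.
pose A (a : nat) := [set x | forall k, fr (iter k T x) <= a%:R].
have mA a : measurable (A a).
  rewrite (_ : A a = \bigcap_k [set x | fr (iter k T x) <= a%:R]); last first.
    by apply/seteqP; split => x /= h k => [_|]; apply: h.
  apply: bigcapT_measurable => k.
  rewrite -[X in measurable X]setTI; apply: measurable_fun_ler => //.
  exact: (measurableT_comp mfr (@measurable_iter_left_shift b k)).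
have A01 a : nu (A a) = 0%E \/ nu (A a) = 1%E.
  apply: (subinvariant_01 mT T_inv T_erg) => // x Ax k.
  by rewrite -iterSr; exact: Ax.
have [[a Aa]|none] := pselect (exists a, nu (A a) = 1%E).
  exists a%:R => //; exists (~` A a); split; first exact: measurableC.
    by rewrite probability_setC // Aa subee.
  by move=> x /= nx Ax; apply: nx; exact: (Ax 0%N).
have : {ae nu, forall x, forall a : nat, ~ A a x}.
  apply: ae_foralln => a; exists (A a); split => //.
    by have [//|h] := A01 a; exfalso; apply: none; exists a.
  by move=> x /= /contrapT.
move=> nA.
have nuT : (0 < nu setT)%E by rewrite probability_setT.
suff : {ae nu, forall x, False} by case/(ae_exists measurableT nuT).
move: nA gibbs_information; apply: filterS2 => x xA [c0 xG].
apply: (xA (Num.truncn (2 * c x)).+1) => k.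
have [p1 h1 _] := xG k.+1; have [p0 _ h2] := xG k.
have i1 : - information k.+1 x <= - information k x.
  rewrite lerN2 /information lerN2 ler_ln ?posrE //.
  exact: cylmass_initial_word_nincr.
rewrite /S big_nat_recr //= -/(S k x) in h1.
have := truncnS_gt (2 * c x); lra.
Qed.

Section upper_bounded.
Variable a : R.
Hypothesis a_ge0 : 0 <= a.
Hypothesis f_le : {ae nu, forall x, fr x <= a}.

(** Almost everywhere this is a - f. The maximum makes it nonnegative at every point, so its
    integral is meaningful before f is known to be integrable. *)
Let g x := Num.max (a - fr x) 0.

Let mg : measurable_fun setT g.
Proof. by apply: measurable_maxr => //; exact: measurable_funB. Qed.

Let g_ge0 x : 0 <= g x. Proof. by rewrite /g le_max lexx orbT. Qed.

Let sum_g : {ae nu, forall x, forall n,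
  \sum_(0 <= k < n) g (iter k T x) = n%:R * a - S n x}.
Proof.
move: (ae_iter_invariant mT T_inv f_le); apply: filterS => x fx n.
rewrite /S mulr_natl -[X in a *+ X]subn0 -sumr_const_nat -sumrB.
by apply: eq_bigr => k _; rewrite /g max_l // subr_ge0.
Qed.

Let bad (K : nat) := [set x | K%:R < c x].

Let mbad K : measurable (bad K).
Proof.
by rewrite -[X in measurable X]setTI; apply: measurable_fun_ltr.
Qed.

Let pr K := fine (nu (bad K)).

Let prE K : nu (bad K) = (pr K)%:E.
Proof. by rewrite /pr fineK // fin_num_measure. Qed.

Let pr_ge0 K : 0 <= pr K.
Proof. by rewrite -lee_fin -prE. Qed.

Let pr_cvg0 : pr K @[K --> \oo] --> (0 : R).
Proof.
have cv : nu (bad K) @[K --> \oo] --> nu (\bigcap_K bad K).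
  apply: nonincreasing_cvg_mu => //.
  - by apply: (le_lt_trans (probability_le1 _ _)); rewrite ?ltry.
  - exact: bigcapT_measurable.
  - move=> m n mn; apply/subsetPset => x /=; apply: le_lt_trans.
    by rewrite ler_nat.
have e0 : \bigcap_K bad K = set0.
  apply/seteqP; split => // x /(_ (Num.truncn (c x)).+1 I) /=.
  by move=> /(lt_trans (truncnS_gt (c x))); rewrite ltxx.
rewrite e0 measure0 in cv.
exact: (fine_cvg cv).
Qed.

Let ind K x : R := \1_(bad K) x.

Let mind K : measurable_fun setT (ind K).
Proof. by apply: measurable_indic. Qed.

Let integral_ind K : (\int[nu]_x (ind K x)%:E = (pr K)%:E)%E.
Proof. by rewrite integral_indic // setIT; exact: prE. Qed.

Let ind_ge0 K x : 0 <= ind K x.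
Proof. by rewrite /ind indicE. Qed.

Let gM (M : nat) x := Num.min (g x) M%:R.

Let mgM M : measurable_fun setT (gM M).
Proof. exact: measurable_minr. Qed.

Let gM_ge0 M x : 0 <= gM M x.
Proof. by rewrite /gM le_min g_ge0 /=. Qed.

Let integral_cstR (r : R) : (\int[nu]_(x in setT) r%:E = r%:E)%E.
Proof. by rewrite integral_cst //= probability_setT mule1. Qed.

Let integral_birkhoff (h : E -> R) n : measurable_fun setT h ->
  (forall x, 0 <= h x) ->
  (\int[nu]_x (\sum_(0 <= k < n) h (iter k T x))%:E =
   n%:R%:E * \int[nu]_x (h x)%:E)%E.
Proof.
move=> mh h0.
under eq_integral do rewrite -sumEFin.
have mk k : measurable_fun setT (fun x => (h (iter k T x))%:E).
  apply/measurable_EFinP.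
  exact: (measurableT_comp mh (@measurable_iter_left_shift b k)).
rewrite ge0_integral_sum //; last by move=> k x _; rewrite lee_fin.
have E1 k : (\int[nu]_x (h (iter k T x))%:E = \int[nu]_x (h x)%:E)%E.
  elim: k => // k IH; rewrite -IH.
  rewrite -(ge0_integral_invariant mT T_inv (mk k)); last by move=> x; rewrite lee_fin.
  by apply: eq_integral => x _; rewrite iterSr.
under eq_bigr do rewrite E1.
have I0 : (0 <= \int[nu]_x (h x)%:E)%E by apply: integral_ge0 => x _; rewrite lee_fin.
elim: n => [|n IH]; first by rewrite big_geq // mul0e.
rewrite big_nat_recr //= IH -natr1 EFinD ge0_muleDl ?lee_fin // mul1e //.
Qed.

Let integral_combination (F : E -> R) (r q s : R) K :
  measurable_fun setT F -> (forall x, 0 <= F x) -> 0 <= r -> 0 <= s ->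
  (\int[nu]_x (F x)%:E = q%:E)%E ->
  (\int[nu]_x (F x + (r * ind K x + s))%:E = (q + (r * pr K + s))%:E)%E.
Proof.
move=> mF F0 r0 s0 Fq.
have mi : measurable_fun setT (fun x => (ind K x)%:E) by exact/measurable_EFinP.
have mri : measurable_fun setT (fun x => (r%:E * (ind K x)%:E)%E).
  exact: emeasurable_funM.
have i0 x : setT x -> (0 <= (ind K x)%:E)%E by rewrite lee_fin ind_ge0.
have ri0 x : setT x -> (0 <= r%:E * (ind K x)%:E)%E.
  by move=> _; rewrite mule_ge0 ?lee_fin.
transitivity (\int[nu]_x ((F x)%:E + (r%:E * (ind K x)%:E + s%:E)))%E.
  by apply: eq_integral => x _; rewrite -EFinM -!EFinD.
rewrite ge0_integralD //; last 3 first.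
- exact/measurable_EFinP.
- by move=> x xT; rewrite adde_ge0 ?ri0 // lee_fin.
- exact: emeasurable_funD.
rewrite ge0_integralD // ge0_integralZl // integral_ind integral_cstR.
  by rewrite Fq -EFinM -!EFinD.
by move=> x _; rewrite lee_fin.
Qed.

(** Off [bad K] the Gibbs bound controls the Birkhoff sum of g by the information, up to n a + K. On
    [bad K], where C is uncontrolled, the truncation at M bounds the sum by n M. *)
Let entropy_lower n K M :
  (n%:R%:E * \int[nu]_x (gM M x)%:E <=
   (block_entropy n + (n%:R * M%:R * pr K + (n%:R * a + K%:R)))%:E)%E.
Proof.
have nM0 : 0 <= n%:R * M%:R :> R by rewrite mulr_ge0.
have na0 : 0 <= n%:R * a + K%:R by rewrite addr_ge0 ?mulr_ge0.
rewrite -(integral_combination K (measurable_information n) (information_ge0 n)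
  nM0 na0 (integral_information n)).
rewrite -integral_birkhoff //.
apply: ae_ge0_le_integral => //.
- by move=> x _; rewrite lee_fin; apply: sumr_ge0.
- apply/measurable_EFinP; apply: measurable_sum => k.
  exact: (measurableT_comp (mgM M) (@measurable_iter_left_shift b k)).
- move=> x _; rewrite lee_fin addr_ge0 ?information_ge0 //.
  by rewrite addr_ge0 ?mulr_ge0 ?ind_ge0.
- apply/measurable_EFinP; apply: measurable_funD; first exact: measurable_information.
  by apply: measurable_funD => //; exact: measurable_funM.
move: sum_g gibbs_information; apply: filterS2 => x gx [c0 xG] _.
have [_ h1 h2] := xG n.
rewrite lee_fin; have [xb|xb] := boolP (x \in bad K).
- rewrite /ind indicE xb mulr1.
  apply: (@le_trans _ _ (n%:R * M%:R)).
    rewrite mulr_natl -[X in _ *+ X]subn0 -sumr_const_nat.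
    by apply: ler_sum => k _; rewrite /gM ge_min lexx orbT.
  by have := information_ge0 n x; lra.
- rewrite /ind indicE (negbTE xb) mulr0 add0r.
  have cK : c x <= K%:R.
    by rewrite leNgt; apply/negP => h; move/negP: xb; apply; rewrite inE.
  apply: (@le_trans _ _ (\sum_(0 <= k < n) g (iter k T x))).
    by apply: ler_sum => k _; rewrite /gM ge_min lexx.
  by rewrite gx; lra.
Qed.

(** This is ln q <= q for q the ratio of the uniform mass to the nu-mass. By [integral_shannon], q
    has mean at most 1, so block entropies are at most n ln b + 1; the pointwise form serves on
    [bad K] in [upper]. *)
Let shannon_bound n x : 0 < cylmass nu (initial_word x n) ->
  information n x <= n%:R * ln b%:R + (b%:R ^- n) / cylmass nu (initial_word x n).
Proof.
move=> p0; set p := cylmass _ _ in p0 *.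
have b0 : 0 < b%:R :> R by rewrite ltr0n.
have bn0 : 0 < b%:R ^- n :> R by rewrite invr_gt0 exprn_gt0.
have q0 : 0 < b%:R ^- n / p by rewrite divr_gt0.
have := ln_sublinear q0; rewrite ln_div ?posrE // lnV ?posrE ?exprn_gt0 //.
by rewrite lnXn // -mulr_natl /information -/p; lra.
Qed.

Let card_words n : #|{: n.-tuple (alphabet b)}| = (b ^ n)%N.
Proof. by rewrite card_tuple card_ord prednK. Qed.

Let integral_shannon n :
  (\int[nu]_x ((b%:R ^- n) / cylmass nu (initial_word x n))%:E <= 1)%E.
Proof.
have b0 : 0 < b%:R :> R by rewrite ltr0n.
rewrite (@integral_initial_word _ _ nu n (fun u => ((b%:R ^- n) / cylmass nu u)%:E)).
  apply: (@le_trans _ _ (\sum_(u : n.-tuple (alphabet b)) (b%:R ^- n : R)%:E)%E).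
    apply: lee_sum => u _; rewrite cylmassE -EFinM lee_fin.
    have [->|p0] := eqVneq (cylmass nu u) 0; first by rewrite mulr0 invr_ge0 exprn_ge0.
    by rewrite divfK.
  rewrite sumEFin sumr_const card_words lee_fin -[X in X *+ _]mulr1 -mulrnAr natrX.
  by rewrite mulVf // expf_neq0 // gt_eqF.
by move=> u; rewrite lee_fin divr_ge0 ?cylmass_ge0 // invr_ge0 exprn_ge0.
Qed.

Let lnb_ge0 : 0 <= ln b%:R :> R.
Proof. by apply: ln_ge0; rewrite ler1n. Qed.

Let mshannon n : measurable_fun setT
  (fun x : E => (b%:R ^- n / cylmass nu (initial_word x n) : R)%:E).
Proof. exact: (measurable_initial_word n (fun u => (b%:R ^- n / cylmass nu u : R)%:E)). Qed.

Let shannon_ge0 n (x : E) : 0 <= b%:R ^- n / cylmass nu (initial_word x n) :> R.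
Proof. by rewrite divr_ge0 ?cylmass_ge0 // invr_ge0 exprn_ge0. Qed.

Let block_entropy_le n : block_entropy n <= n%:R * ln b%:R + 1.
Proof.
rewrite -lee_fin -integral_information.
apply: (@le_trans _ _ (\int[nu]_x ((n%:R * ln b%:R)%:E +
   (b%:R ^- n / cylmass nu (initial_word x n))%:E))%E).
  apply: ae_ge0_le_integral => //.
  - by move=> x _; rewrite lee_fin information_ge0.
  - by apply/measurable_EFinP; exact: measurable_information.
  - by move=> x _; rewrite -EFinD lee_fin addr_ge0 ?shannon_ge0 // mulr_ge0.
  - exact: emeasurable_funD.
  move: gibbs_information; apply: filterS => x [_ xG] _.
  by rewrite -EFinD lee_fin; apply: shannon_bound; case: (xG n).
rewrite ge0_integralD //; last 2 first.
- by move=> x _; rewrite lee_fin mulr_ge0.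
- by move=> x _; rewrite lee_fin.
by rewrite integral_cstR EFinD; apply: leeD => //; exact: integral_shannon.
Qed.

Let small_pr (r e : R) : 0 <= r -> 0 < e -> exists K, r * pr K < e.
Proof.
move=> r0 e0.
have d0 : 0 < e / (r + 1) by rewrite divr_gt0 //; lra.
have /cvgr0Pnorm_lt /(_ _ d0) [K _ /(_ K (leqnn K))] := pr_cvg0.
rewrite ger0_norm // ltr_pdivlMr; last by lra.
by move=> h; exists K; have := pr_ge0 K; nra.
Qed.

Let large_n (r e : R) : 0 < e -> exists2 n0, (0 < n0)%N &
  forall n, (n0 <= n)%N -> r < n%:R * e.
Proof.
move=> e0; exists (Num.truncn (`|r| / e)).+1 => // n nn.
have : `|r| / e < n%:R by apply: (lt_le_trans (truncnS_gt _)); rewrite ler_nat.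
by rewrite ltr_pdivrMr //; apply: le_lt_trans; exact: ler_norm.
Qed.

Let iM M := fine (\int[nu]_x (gM M x)%:E)%E.

Let iME M : (\int[nu]_x (gM M x)%:E = (iM M)%:E)%E.
Proof.
rewrite /iM fineK // ge0_fin_numE; last by apply: integral_ge0 => x _; rewrite lee_fin.
apply: (@le_lt_trans _ _ (\int[nu]_(x in setT) M%:R%:E)%E).
  apply: ge0_le_integral => //.
  - by move=> x _; rewrite lee_fin.
  - exact/measurable_EFinP.
  - by move=> x _; rewrite lee_fin /gM ge_min lexx orbT.
by rewrite integral_cstR ltry.
Qed.

Let lower n K M :
  n%:R * iM M <= block_entropy n + (n%:R * M%:R * pr K + (n%:R * a + K%:R)).
Proof. by have := entropy_lower n K M; rewrite iME -EFinM lee_fin. Qed.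

(** Divide [lower] by n. K is chosen first, to make M times [pr K] small, then n, to absorb K + 1.
    The bound is uniform in M, so g is integrable by monotone convergence. *)
Let iM_le M : iM M <= ln b%:R + a.
Proof.
apply/ler_addgt0Pr => e e0.
have e20 : 0 < e / 2 by lra.
have [K Ke] := @small_pr M%:R _ (ler0n _ _) e20.
have [n n0 /(_ n (leqnn n)) Kn] := large_n (K%:R + 1) e20.
have n0' : 0 < n%:R :> R by rewrite ltr0n.
rewrite -(ler_pM2l n0').
have := lower n K M; have := block_entropy_le n.
have : n%:R * (M%:R * pr K) <= n%:R * (e / 2) by rewrite ler_pM2l // ltW.
by nra.
Qed.

Let iM_cvg : (\int[nu]_x (gM M x)%:E)%E @[M --> \oo] --> (\int[nu]_x (g x)%:E)%E.
Proof.
have gMg x : (gM M x)%:E @[M --> \oo] --> (g x)%:E.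
  apply: cvg_EFin; first exact: nearW.
  apply: (@cvg_trans _ (cst (g x) @ \oo)); last exact: cvg_cst.
  apply: near_eq_cvg; exists (Num.truncn (g x)).+1 => // M /= gM'.
  by rewrite /gM min_l // ltW // (lt_le_trans (truncnS_gt _)) // ler_nat.
rewrite (_ : (\int[nu]_x (g x)%:E)%E =
    (\int[nu]_x limn (fun M => (gM M x)%:E))%E); last first.
  by apply: eq_integral => x _; apply/esym/cvg_lim.
apply: cvg_monotone_convergence => //.
- by move=> M; exact/measurable_EFinP.
- by move=> M x _; rewrite lee_fin.
- move=> x _ m n mn; rewrite lee_fin /gM le_min ge_min lexx /= ge_min.
  by rewrite ler_nat mn orbT.
Qed.

Let Ig := fine (\int[nu]_x (g x)%:E)%E.

Let IgE : (\int[nu]_x (g x)%:E = Ig%:E)%E.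
Proof.
rewrite /Ig fineK // ge0_fin_numE; last by apply: integral_ge0 => x _; rewrite lee_fin.
apply: (@le_lt_trans _ _ (ln b%:R + a)%:E); last exact: ltry.
by apply: (cvge_to_le iM_cvg); apply: nearW => M; rewrite iME lee_fin.
Qed.

(** The converse of [lower]. Off [bad K] the other Gibbs bound applies, up to K. On [bad K],
    [shannon_bound] applies: it produces the factor ln b + a and a ratio of mean at most 1, the
    source of the final 1. *)
Let upper n K : block_entropy n + n%:R * a <=
  n%:R * Ig + (n%:R * (ln b%:R + a) * pr K + K%:R) + 1.
Proof.
have nl0 : 0 <= n%:R * (ln b%:R + a) by rewrite mulr_ge0 // addr_ge0.
pose G x := \sum_(0 <= k < n) g (iter k T x).
have mG : measurable_fun setT G.
  apply: measurable_sum => k.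
  exact: (measurableT_comp mg (@measurable_iter_left_shift b k)).
have G0 x : 0 <= G x by apply: sumr_ge0.
have iG : (\int[nu]_x (G x)%:E = (n%:R * Ig)%:E)%E.
  by rewrite integral_birkhoff // IgE -EFinM.
have iL := integral_combination 0 (measurable_information n) (information_ge0 n)
  (lexx 0) (mulr_ge0 (ler0n R n) a_ge0) (integral_information n).
have iU := integral_combination K mG G0 nl0 (ler0n R K) iG.
rewrite mul0r add0r in iL.
rewrite -lee_fin -iL.
apply: (@le_trans _ _ (\int[nu]_x ((G x + (n%:R * (ln b%:R + a) * ind K x + K%:R))%:E
   + (b%:R ^- n / cylmass nu (initial_word x n))%:E))%E).
  have mU : measurable_fun setT (fun x =>
      (G x + (n%:R * (ln b%:R + a) * ind K x + K%:R))%:E).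
    apply/measurable_EFinP; apply: measurable_funD => //.
    by apply: measurable_funD => //; exact: measurable_funM.
  apply: ae_ge0_le_integral => //.
  - move=> x _; rewrite lee_fin addr_ge0 ?information_ge0 //.
    by rewrite mul0r add0r mulr_ge0.
  - apply/measurable_EFinP; apply: measurable_funD; first exact: measurable_information.
    by apply: measurable_funD => //; exact: measurable_funM.
  - move=> x _; rewrite -EFinD lee_fin addr_ge0 ?shannon_ge0 //.
    by rewrite addr_ge0 // addr_ge0 // mulr_ge0.
  - exact: emeasurable_funD.
  move: sum_g gibbs_information; apply: filterS2 => x gx [c0 xG] _.
  have [p0 h1 h2] := xG n.
  have sh := shannon_bound p0; have sh0 := shannon_ge0 n x.
  have e : G x = n%:R * a - S n x by exact: gx.
  have gx0 := G0 x.
  rewrite mul0r add0r -EFinD lee_fin; have [xb|xb] := boolP (x \in bad K).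
    by rewrite /ind indicE xb mulr1 mulrDr; have := ler0n R K; lra.
  rewrite /ind indicE (negbTE xb) mulr0 add0r.
  have cK : c x <= K%:R.
    by rewrite leNgt; apply/negP => h; move/negP: xb; apply; rewrite inE.
  by lra.
have -> : ((n%:R * Ig + (n%:R * (ln b%:R + a) * pr K + K%:R) + 1)%:E =
  (n%:R * Ig + (n%:R * (ln b%:R + a) * pr K + K%:R))%:E + 1%:E)%E by rewrite EFinD.
rewrite ge0_integralD //.
- by rewrite iU; apply: leeD => //; exact: integral_shannon.
- by move=> x _; rewrite lee_fin addr_ge0 // addr_ge0 // mulr_ge0.
- apply/measurable_EFinP; apply: measurable_funD => //.
  by apply: measurable_funD => //; exact: measurable_funM.
- by move=> x _; rewrite lee_fin.
Qed.

(* [entropy] is a [lim], so the convergence has to be established as well. *)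
Let entropyE : entropy nu = Ig - a.
Proof.
apply: cvg_lim => //.
apply/cvgrPdist_lt => e e0.
(* At most three quarters are spent: on the truncation at M, on the bad set, and on the additive
   constants divided by n. *)
have e40 : 0 < e / 4 by lra.
have iMI : iM M @[M --> \oo] --> Ig.
  have := iM_cvg; rewrite IgE => h.
  exact: (fine_cvg h).
have /cvgrPdist_lt /(_ _ e40) [M _ /(_ M (leqnn M)) IM] := iMI.
have [K1 Ke1] := @small_pr M%:R _ (ler0n _ _) e40.
have [K2 Ke2] := @small_pr _ _ (addr_ge0 lnb_ge0 a_ge0) e40.
have [n1 _ N1] := large_n K1%:R e40.
have [n2 n20 N2] := large_n (K2%:R + 1) e40.
exists (maxn n1 n2) => // n /=; rewrite geq_max => /andP[nn1 nn2].
have n0 : 0 < n%:R :> R by rewrite ltr0n (leq_trans n20).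
rewrite -/(block_entropy n).
have L := lower n K1 M; have U := upper n K2.
have a1 := N1 _ nn1; have a2 := N2 _ nn2.
have nH : block_entropy n = n%:R * (n%:R^-1 * block_entropy n).
  by rewrite mulVKf // gt_eqF.
move: nH L U; set z := n%:R^-1 * _ => -> L U.
move: IM; rewrite ltr_norml => /andP[_ IM].
have L' : iM M <= z + (M%:R * pr K1 + (a + e / 4)).
  by rewrite -(ler_pM2l n0); nra.
have U' : z + a <= Ig + (ln b%:R + a) * pr K2 + e / 4.
  by rewrite -(ler_pM2l n0); nra.
by rewrite ltr_norml; apply/andP; split; lra.
Qed.

(** The function is a - g, the minimum of f and a; it agrees with f almost everywhere, and
    [entropyE] gives its mean. *)
Lemma gibbs_potential_bounded_integrable : exists h : E -> R,
  [/\ measurable_fun setT h, nu.-integrable setT (EFin \o h),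
   (\int[nu]_x (h x)%:E = (- entropy nu)%:E)%E & {ae nu, forall x, h x = fr x}].
Proof.
have ig : nu.-integrable setT (EFin \o g).
  apply/integrableP; split; first exact/measurable_EFinP.
  under eq_integral do rewrite /= ger0_norm //.
  by rewrite IgE ltry.
have ia : nu.-integrable setT (EFin \o (fun _ : E => a)).
  exact: finite_measure_integrable_cst.
exists (fun x => a - g x); split.
- exact: measurable_funB.
- by have := integrableB measurableT ia ig; apply: eq_integrable.
- under eq_integral do rewrite EFinB.
  rewrite integralB_EFin // integral_cstR IgE -EFinB entropyE.
  by congr EFin; ring.
- by apply: filterS f_le => x fx; rewrite /g max_l ?subr_ge0 //; ring.
Qed.

End upper_bounded.

Lemma gibbs_potential_integrable : exists c h : E -> R,
  [/\ measurable_fun setT c, measurable_fun setT h, nu.-integrable setT (EFin \o h),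
   (\int[nu]_x (h x)%:E = (- entropy nu)%:E)%E &
   {ae nu, forall x, forall n, 0 < cylmass nu (initial_word x n) /\
     - c x + \sum_(0 <= k < n) h (iter k T x) <= ln (cylmass nu (initial_word x n))}].
Proof.
have [a a0 fa] := gibbs_potential_bounded.
have [h [mh ih eh hf]] := gibbs_potential_bounded_integrable a0 fa.
exists c, h; split => //.
move: (ae_iter_invariant mT T_inv hf) gibbs_information.
apply: filterS2 => x hx [_ xG] n; have [p0 h1 _] := xG n.
split => //; move: h1; rewrite /information opprK /S.
by under eq_bigr do rewrite -hx.
Qed.

End gibbs_integrable.

(** * The size-biased logarithm and degenerate weights *)

Lemma ae_eq_measure d (T : measurableType d) (R : realType)
    (mu : {measure set T -> \bar R}) (A B : set T) :
  measurable A -> measurable B -> {ae mu, forall t, A t <-> B t} -> mu A = mu B.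
Proof.
move=> mA mB AB; rewrite -[A]setIT -[B]setIT -!integral_indic //.
apply: ae_eq_integral => //.
- by apply/measurable_EFinP; exact: measurable_indic.
- by apply/measurable_EFinP; exact: measurable_indic.
apply: filterS AB => t ABt _; rewrite !indicE.
suff -> : (t \in A) = (t \in B) by [].
by apply/idP/idP; rewrite !inE; case: ABt.
Qed.

Section size_biased_log.
Context d' (Omega' : measurableType d') (R : realType) (P' : probability Omega' R).
Variable X : {RV P' >-> R}.
Hypothesis X_ge0 : forall w, 0 <= X w.
Hypothesis EX : (\int[P']_t (X t)%:E = 1)%E.
Variable al : R.
Hypothesis EXlnX : (\int[P']_t (X t * ln (X t))%:E = al%:E)%E.

(** From ln (1 / x) < 1 / x. The crude constant -1 suffices to bound the negative part of X ln X. *)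
Lemma xlnx_ge (x : R) : 0 <= x -> -1 <= x * ln x.
Proof.
rewrite le_eqVlt => /predU1P[<-|x0]; first by rewrite mul0r lerN10.
have : ln x^-1 < x^-1 by apply: ln_sublinear; rewrite invr_gt0.
rewrite lnV ?posrE // => h.
have := ltr_pM2l x0 (- ln x) x^-1; rewrite h divff ?gt_eqF // => /esym; lra.
Qed.

Let mlnX : measurable_fun setT (fun t => ln (X t)).
Proof. exact: (measurableT_comp (@measurable_ln R)). Qed.

Let mXlnX : measurable_fun setT (fun t => (X t * ln (X t))%:E).
Proof. by apply/measurable_EFinP; exact: measurable_funM. Qed.

(** The negative part is at most 1. The integral is the difference of those of the two parts and is
    finite, so the positive part is integrable too. *)
Lemma integrable_xlnx : P'.-integrable setT (fun t => (X t * ln (X t))%:E).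
Proof.
pose F t := (X t * ln (X t))%:E.
have Fneg : (\int[P']_t F^\- t < +oo)%E.
  apply: (@le_lt_trans _ _ (\int[P']_(t in setT) 1%:E)%E); last first.
    by rewrite integral_cst //= probability_setT mule1 ltry.
  apply: ge0_le_integral => //.
  - exact: measurable_funeneg.
  - move=> t _; rewrite funenegE /F -EFinN ge_max !lee_fin ler01 andbT.
    by have := xlnx_ge (X_ge0 t); lra.
have Fneg0 : (0 <= \int[P']_t F^\- t)%E by apply: integral_ge0.
have : (\int[P']_t F^\+ t - \int[P']_t F^\- t = al%:E)%E.
  by rewrite -integralE.
have Fpos0 : (0 <= \int[P']_t F^\+ t)%E by apply: integral_ge0.
move=> e.
have Fpos : (\int[P']_t F^\+ t < +oo)%E.
  move: e Fneg Fneg0 Fpos0; case: (\int[P']_t F^\+ t)%E => [r||] //.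
    by rewrite ltry.
  by case: (\int[P']_t F^\- t)%E.
apply/integrableP; split => //.
apply: (@le_lt_trans _ _ (\int[P']_t (F^\+ t + F^\- t))%E).
  have h : (abse \o F) = (F^\+ \+ F^\-)%E := fune_abse F.
  by rewrite -[leRHS]/(\int[P']_t (F^\+ \+ F^\-) t)%E -h.
rewrite ge0_integralD //; first exact: lte_add_pinfty.
- exact: measurable_funepos.
- exact: measurable_funeneg.
Qed.

Let mXnz : measurable [set t | X t != 0].
Proof.
rewrite (_ : [set _ | _] = X @^-1` (~` [set 0])); last first.
  by apply/seteqP; split => t /= /eqP.
rewrite -[X in measurable X]setTI; apply: (measurable_funP X) => //.
exact: measurableC.
Qed.

(** Under the size-biased law ln X has mean al. If no two levels a < b are charged as in the first
    case, either ln X >= al is null, or ln X <= al - 1 / (n + 1) is null for every n. Both ways X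
    (ln X - al) has a constant sign and integral 0, so it vanishes. *)
Lemma size_biased_log_dichotomy :
  (exists a b, [/\ a < b,
    (0 < P' [set t | (X t != 0 /\ ln (X t) <= a)%R])%E &
    (0 < P' [set t | (X t != 0 /\ b <= ln (X t))%R])%E]) \/
  {ae P', forall t, X t != 0 -> ln (X t) = al}.
Proof.
have iX : P'.-integrable setT (EFin \o X) by exact: integrable_weight.
case: (pselect (exists a b, [/\ a < b,
    (0 < P' [set t | (X t != 0 /\ ln (X t) <= a)%R])%E &
    (0 < P' [set t | (X t != 0 /\ b <= ln (X t))%R])%E])) => [|none]; [by left|right].
pose D t := X t * (ln (X t) - al).
have iD : P'.-integrable setT (EFin \o D).
  have := integrableB measurableT integrable_xlnx (integrableZl measurableT al iX).
  by apply: eq_integrable => // t _ /=; rewrite -EFinB /D; congr EFin; ring.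
have eD : (\int[P']_t (D t)%:E = 0)%E.
  transitivity (\int[P']_t ((X t * ln (X t))%:E - al%:E * (X t)%:E))%E.
    by apply: eq_integral => t _; rewrite -EFinM -EFinB /D; congr EFin; ring.
  rewrite integralB //; [|exact: integrable_xlnx|exact: integrableZl].
  rewrite integralZl //.
  by rewrite EXlnX EX mule1 subee.
have D0 : {ae P', forall t, D t = 0} ->
    {ae P', forall t, X t != 0 -> ln (X t) = al}.
  apply: filterS => t /eqP; rewrite mulf_eq0 subr_eq0.
  by move=> /orP[/eqP ->|/eqP //]; rewrite eqxx.
have mlow a : measurable [set t | X t != 0 /\ ln (X t) <= a].
  apply: measurableI => //.
  by rewrite -[X in measurable X]setTI; apply: measurable_fun_ler.
have mhigh a : measurable [set t | X t != 0 /\ a <= ln (X t)].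
  apply: measurableI => //.
  by rewrite -[X in measurable X]setTI; apply: measurable_fun_ler.
have [hB|hB] := pselect (P' [set t | (X t != 0 /\ al <= ln (X t))%R] = 0%E).
  have ND0 : {ae P', forall t, - D t = 0}.
    apply: (@ae_eq0_integral _ _ _ P') => //.
    - have := integrableN iD; apply: eq_integrable => // t _ /=.
    - exists [set t | (X t != 0 /\ al <= ln (X t))%R]; split => // t /= nD.
      split; first by apply/eqP => Xt; apply: nD; rewrite /D Xt mul0r oppr0.
      rewrite leNgt; apply/negP => h; apply: nD.
      by rewrite /D -mulrN mulr_ge0 // oppr_ge0 subr_le0 ltW.
    - have -> : (\int[P']_t (- D t)%:E = \int[P']_t ((-1)%:E * (D t)%:E))%E.
        by apply: eq_integral => t _; rewrite -EFinM mulN1r.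
      by rewrite integralZl // eD mule0.
  by apply: D0; apply: filterS ND0 => t /eqP; rewrite oppr_eq0 => /eqP.
have hA n : P' [set t | (X t != 0 /\ ln (X t) <= al - n.+1%:R^-1)%R] = 0%E.
  apply/eqP; rewrite eq_le measure_ge0 andbT leNgt; apply/negP => hA; apply: none.
  exists (al - n.+1%:R^-1), al; split => //.
    by rewrite ltrBlDr ltrDl invr_gt0.
  by rewrite lt_neqAle measure_ge0 andbT eq_sym; apply/eqP.
apply: D0; apply: (@ae_eq0_integral _ _ _ P') => //.
have : {ae P', forall t, forall n, ~ (X t != 0 /\ ln (X t) <= al - n.+1%:R^-1)}.
  apply: ae_foralln => n; exists [set t | X t != 0 /\ ln (X t) <= al - n.+1%:R^-1].
  split; [exact: mlow|exact: (hA n)|].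
  by move=> t /= /contrapT.
apply: filterS => t ht.
have [Xt|Xt] := eqVneq (X t) 0; first by rewrite /D Xt mul0r.
rewrite /D mulr_ge0 // subr_ge0 leNgt; apply/negP => lt_al.
pose e := al - ln (X t).
have e0 : 0 < e by rewrite subr_gt0.
apply: (ht (Num.truncn e^-1)); split => //.
have : (Num.truncn e^-1).+1%:R^-1 < e by rewrite invf_plt ?posrE // truncnS_gt.
have -> : ln (X t) = al - e by rewrite /e; ring.
by move=> /ltW; rewrite lerD2l lerN2.
Qed.

Hypothesis X_neq1 : (0 < P' [set w | (X w != 1)%R])%E.

(** X takes only the values 0 and e^al, and mean 1 fixes the probability e^(-al) of the latter. It
    is at most 1, so al >= 0; and al = 0 would mean X = 1 almost surely. *)
Lemma degenerate_weight : {ae P', forall t, X t != 0 -> ln (X t) = al} ->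
  is_Q_alpha X al.
Proof.
move=> deg.
have Xe : {ae P', forall t, X t != 0 -> X t = expR al}.
  apply: filterS deg => t h X0; rewrite -(h X0) lnK // posrE lt_neqAle eq_sym X0.
  exact: X_ge0.
have mset (r : R) : measurable (X @^-1` [set r]).
  by rewrite -[X in measurable X]setTI; apply: (measurable_funP X).
have e1 : (\int[P']_t (X t)%:E = (expR al)%:E * P' (X @^-1` [set expR al]))%E.
  transitivity (\int[P']_t ((expR al)%:E * (\1_(X @^-1` [set expR al]) t)%:E))%E.
    apply: ae_eq_integral => //.
    - exact/measurable_EFinP.
    - by apply: emeasurable_funM => //; apply/measurable_EFinP; exact: measurable_indic.
    apply: filterS Xe => t h _; rewrite -EFinM indicE.
    have [Xt|/h Xt] := eqVneq (X t) 0.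
      rewrite memNset ?mulr0 ?Xt //= Xt => /esym/eqP.
      by rewrite gt_eqF // expR_gt0.
    by rewrite mem_set // mulr1 Xt.
  rewrite ge0_integralZl //.
  - by rewrite integral_indic // setIT.
  - by apply/measurable_EFinP; exact: measurable_indic.
have Pe : P' (X @^-1` [set expR al]) = (expR (- al))%:E.
  move: e1; rewrite EX -(fineK (fin_num_measure P' _ (mset (expR al)))) -EFinM.
  move=> [e1]; congr EFin; rewrite expRN.
  by apply: (@mulfI _ (expR al)); rewrite ?gt_eqF ?expR_gt0 // -e1 divff // gt_eqF ?expR_gt0.
have P0 : P' (X @^-1` [set 0]) = (1 - expR (- al))%:E.
  have -> : P' (X @^-1` [set 0]) = P' (~` (X @^-1` [set expR al])).
    apply: ae_eq_measure => //; first exact: measurableC.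
    apply: filterS Xe => t h; split => /= [->|Xt].
      by apply/eqP; rewrite eq_sym gt_eqF // expR_gt0.
    by apply/eqP; apply: contrapT => /negP X0; apply: Xt; exact: h.
  by rewrite probability_setC // Pe.
split => //; rewrite lt_neqAle; apply/andP; split.
  apply/eqP => al0; move: X_neq1; rewrite ltNge; apply/negP.
  rewrite negbK (_ : [set w | X w != 1] = ~` (X @^-1` [set expR al])).
    by rewrite probability_setC // Pe -al0 oppr0 expR0 subee.
  by rewrite -al0 expR0; apply/seteqP; split => w /= /eqP.
rewrite -oppr_le0 -ler_expR expR0 -lee_fin -Pe.
exact: probability_le1.
Qed.

End size_biased_log.

(** * Two-valued weights: the walk along the spine has deterministic weight steps *)

Section degenerate_weight.
Variables (b : nat) (R : realType).
Context d (Omega : measurableType d) (P : probability Omega R).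
Context d' (Omega' : measurableType d') (P' : probability Omega' R).
Variables (X : {RV P' >-> R}) (Y : seq (alphabet b) -> {RV P >-> R}).
Local Notation words := [set u : seq (alphabet b) | u != [::]].
Hypothesis X_ge0 : forall w, 0 <= X w.
Hypothesis EX : (\int[P']_t (X t)%:E = 1)%E.
Hypothesis Y_iid : iid_copies X words Y.
Variable al : R.
Hypothesis X_deg : {ae P', forall t, X t != 0 -> ln (X t) = al}.

(** A sequence is an observable along the orbit of 0 under the successor map of nat, so
    [measurable_killed] applies with base nat. *)
Lemma measurable_killed_mean n (a : nat -> R) : measurable_fun setT (killed_mean X n a).
Proof.
have mS : measurable_fun setT succn by [].
have ma : measurable_fun setT a by [].
have := measurable_fun_pair2 0%N (measurable_killed mS X_ge0 ma n).
rewrite /killed /=; under eq_fun => s.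
  have -> : (fun k => a (iter k succn 0%N)) = a by apply/funext => k; rewrite iter_succn_0.
  over.
by [].
Qed.

(** Under the size-biased law every logarithm equals al, so given a and s the walk is deterministic;
    it is killed at the first time its position is nonnegative. *)
Lemma killed_mean_degenerate n (a : nat -> R) s m : (m <= n)%N ->
  0 <= s + \sum_(0 <= k < m) (a k + al) -> killed_mean X n a s = 0%E.
Proof.
elim: n a s m => [|n IH] a s [|m] // mn.
- by rewrite big_geq // addr0 => s0 /=; rewrite ltNge s0.
- by rewrite big_geq // addr0 => s0 /=; rewrite ltNge s0.
rewrite big_nat_recl // addrA => s0 /=; case: ifP => // _.
have X0 : {ae P', forall t, setT t -> ((X t)%:E *
    killed_mean X n (fun k => a k.+1) (s + (a 0%N + ln (X t))) = 0)%E}.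
  apply: filterS X_deg => t Xt _; have [->|/Xt ->] := eqVneq (X t) 0.
    by rewrite mul0e.
  by rewrite (IH _ _ m) // ?mule0.
rewrite (@ae_eq_integral _ _ _ P' setT (cst 0%E)) ?integral0 //.
apply: emeasurable_funM; first exact/measurable_EFinP.
have ms : measurable_fun setT (fun t => s + (a 0%N + ln (X t))).
  do 2! apply: measurable_funD => //.
  exact: (measurableT_comp (@measurable_ln R)).
exact: (measurableT_comp (measurable_killed_mean n (fun k => a k.+1)) ms).
Qed.

Variable nu : probability (seqspace b) R.
Hypothesis nu_ergodic : shift_ergodic nu.
Variables C f : seqspace b -> \bar R.
Hypothesis nuG : gibbs nu C f.
Hypothesis nu_limsup : {ae nu, forall x,
   limn_esup (fun n : nat =>
     (\sum_(0 <= k < n)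
        (fine (f (iter k (@left_shift b) x)) + al))%:E) = +oo%E}.

(** An infinite limsup carries the deterministic walk above 0 from any starting point, so [killed]
    is exactly 0 from some time on. *)
Lemma degenerate_mass_cvg0 :
  {ae P, forall w, mass Y nu n w @[n --> \oo] --> (0 : R)}.
Proof.
have [mC mf _ _ _] := nuG.
apply: (@mass_ae_cvg0 _ _ _ _ _ _ _ _ _ _ X_ge0 EX Y_iid nu
  (fun x => ln (fine (C x))) (fun x => fine (f x))).
- by apply: measurableT_comp => //; exact: measurableT_comp.
- exact: measurableT_comp.
- move: (gibbs_information nuG).
  apply: filterS => x [_ xG] n; have [p0 h1 _] := xG n.
  by split => //; move: h1; rewrite /information opprK.
move: nu_limsup; apply: filterS => x limsup s.
have [m hm] : exists m, 0 <= s +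
    \sum_(0 <= k < m) (fine (f (iter k (@left_shift b) x)) + al).
  apply: contrapT => /forallNP none.
  suff : (limn_esup (fun n : nat => (\sum_(0 <= k < n)
        (fine (f (iter k (@left_shift b) x)) + al))%:E) <= (- s)%:E)%E.
    by rewrite limsup leye_eq.
  rewrite limn_esup_lim; apply: lime_le; first exact: is_cvg_esups.
  apply: nearW => n; apply: ge_ereal_sup => _ [k _ <-].
  by rewrite lee_fin; have /negP := none k; rewrite -ltNge; lra.
apply: (@cvg_trans _ (cst 0%E @ \oo)); last exact: cvg_cst.
apply: near_eq_cvg; exists m => // n /= mn.
by rewrite /killed (killed_mean_degenerate mn).
Qed.

End degenerate_weight.

(** * Extinction of a critical Galton-Watson population *)

Section independent_zeros.
Context d (Omega : measurableType d) (R : realType) (P : probability Omega R).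
Context d' (Omega' : measurableType d') (P' : probability Omega' R).
Variables (X : {RV P' >-> R}) (I : choiceType) (D : set I) (Y : I -> {RV P >-> R}).
Hypothesis Y_iid : iid_copies X D Y.

Definition zeros (l : seq I) : set Omega := [set w | all (fun v => Y v w == 0) l].

Let p0 := fine (P' (X @^-1` [set 0])).

(** Induction on the list. Measurability is part of the statement because the event already formed
    has to be independent of the next variable. *)
Lemma independent_zeros S (B : set Omega) (l : seq I) :
  S `<=` D -> measurable (B : set (sigma_of Y S)) -> uniq l ->
  {in l, forall v, D v /\ ~ S v} ->
  measurable (B `&` zeros l : set (sigma_of Y (S `|` [set` l]))) /\
  P (B `&` zeros l) = (P B * (p0 ^+ size l)%:E)%E.
Proof.
move=> SD mB; elim: l => [|v l IH] /=.
  move=> _ _; rewrite (_ : zeros [::] = setT); last by apply/seteqP; split.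
  rewrite setIT expr0 mule1; split => //.
  by apply: (sigma_of_sub _ mB) => i; left.
move=> /andP[vl ul] hl.
have [|mBl PBl] := IH ul.
  by move=> i il; apply: hl; rewrite inE il orbT.
have [Dv Sv] : D v /\ ~ S v by apply: hl; rewrite mem_head.
have e : B `&` zeros (v :: l) = (B `&` zeros l) `&` Y v @^-1` [set 0].
  apply/seteqP; split => w.
    by move=> [Bw] /= /andP[/eqP Yv hz]; split.
  by move=> [[Bw hz] /= Yv]; split => //; apply/andP; split => //; apply/eqP.
have SlD : S `|` [set` l] `<=` D.
  by move=> i [/SD //|/= il]; have [] : D i /\ ~ S i by apply: hl; rewrite inE il orbT.
have Slv : ~ (S `|` [set` l]) v.
  by move=> [//|/=]; rewrite (negbTE vl).
have m0 : measurable [set 0 : R] by exact: measurable_set1.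
split.
  rewrite e; apply: measurableI.
    apply: (sigma_of_sub _ mBl) => i [Si|/= il]; first by left.
    by right; rewrite /= inE il orbT.
  rewrite -[X in measurable X]setTI.
  apply: (@measurable_fun_sigma_of _ _ _ _ _ Y (S `|` [set` v :: l]) v) => //.
  by right; rewrite /= mem_head.
rewrite e (sigma_of_independent Y_iid SlD Dv Slv mBl m0) PBl -muleA; congr (_ * _)%E.
have [_ /(_ _ Dv _ m0) eY] := Y_iid.
have -> : P (Y v @^-1` [set 0]) = p0%:E.
  rewrite /p0 fineK; first exact: eY.
  apply: fin_num_measure; rewrite -[X in measurable X]setTI.
  by apply: (measurable_funP X).
by rewrite -EFinM -exprSr.
Qed.

End independent_zeros.

Section critical_branching.
Variables (b : nat) (R : realType).
Hypothesis b_gt1 : (1 < b)%N.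
Context d (Omega : measurableType d) (P : probability Omega R).
Context d' (Omega' : measurableType d') (P' : probability Omega' R).
Variables (X : {RV P' >-> R}) (Y : seq (alphabet b) -> {RV P >-> R}).
Local Notation words := [set u : seq (alphabet b) | u != [::]].
Hypothesis X_ge0 : forall w, 0 <= X w.
Hypothesis EX : (\int[P']_t (X t)%:E = 1)%E.
Hypothesis Y_iid : iid_copies X words Y.
Variable p0 : R.
Hypothesis p0_gt0 : 0 < p0.
Hypothesis p0_le1 : p0 <= 1.
Hypothesis X0 : P' (X @^-1` [set 0]) = p0%:E.
Hypothesis Xb : P' (X @^-1` [set b%:R]) = (1 - p0)%:E.
Variable nu : probability (seqspace b) R.
Hypothesis nu_uniform : is_uniform nu.
Local Notation mass := (mass Y nu).
Local Notation A := (alphabet b).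

Let b_neq0 : b%:R != 0 :> R.
Proof. by rewrite pnatr_eq0 -lt0n ltnW. Qed.

Let cylmass_uniform u : cylmass nu u = b%:R ^- size u.
Proof. by apply: EFin_inj; rewrite -cylmassE nu_uniform. Qed.

Let weight_values : {ae P, forall w, forall u,
  weight Y u w = 0 \/ weight Y u w = b%:R ^+ size u}.
Proof.
have mset (r : R) : measurable [set r] by exact: measurable_set1.
have Yv u : words u -> {ae P, forall w, Y u w = 0 \/ Y u w = b%:R}.
  move=> u0; have [_ eY] := Y_iid.
  have mU : measurable ([set (0 : R)] `|` [set b%:R]) by exact: measurableU.
  have mYU : measurable (Y u @^-1` ([set (0 : R)] `|` [set b%:R])).
    by rewrite -[X in measurable X]setTI; by apply: (measurable_funP (Y u)).
  exists (~` (Y u @^-1` ([set (0 : R)] `|` [set b%:R]))); split.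
  - exact: measurableC.
  - rewrite probability_setC //.
    have -> : P (Y u @^-1` ([set (0 : R)] `|` [set b%:R])) = 1%E.
      transitivity (P' (X @^-1` ([set (0 : R)] `|` [set b%:R]))).
        exact: (eY _ u0 _ mU).
      have mX r : measurable (X @^-1` [set r]).
        by rewrite -[X in measurable X]setTI; apply: (measurable_funP X).
      have dX : X @^-1` [set 0] `&` X @^-1` [set b%:R] = set0.
        by apply/seteqP; split => // t [/= -> /eqP]; rewrite eq_sym (negbTE b_neq0).
      rewrite preimage_setU (measureU _ (mX 0) (mX b%:R) dX).
      transitivity (p0%:E + (1 - p0)%:E)%E; first by congr (_ + _)%E.
      by rewrite -EFinD; congr EFin; ring.
    by rewrite subee.
  - by move=> w /= h; apply: contra_not h => -[]; [left|right].
(* The exceptional null sets are united over the countably many words, enumerated by [unpickle]. *)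
have Yall : {ae P, forall w, forall k : nat, forall u, unpickle k = Some u ->
    words u -> Y u w = 0 \/ Y u w = b%:R}.
  apply: ae_foralln => k; case: (unpickle k) => [u|]; last by apply: aeW => w u.
  have [u0|u0] := eqVneq u [::].
    by apply: aeW => w v [<-]; rewrite /= u0 eqxx.
  by apply: filterS (Yv _ u0) => w h v [<-].
apply: filterS Yall => w h; elim/last_ind => [|u a IH].
  by right; rewrite weight_nil expr0.
rewrite weight_rcons size_rcons exprSr.
have u0 : words (rcons u a) by rewrite /=; case: (u).
have [Y0|Y0] := h _ _ (pickleK (rcons u a)) u0; first by left; rewrite Y0 normr0 mulr0.
case: IH => ->; first by left; rewrite mul0r.
by right; rewrite Y0 ger0_norm.
Qed.

Section threshold.
Variable K : nat.
Hypothesis K_gt0 : (0 < K)%N.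

Let D n : set Omega := [set w | mass n w != 0] `&` ~` exceeds Y nu K%:R 0 n.+1.

Let mneq0 (S : set (seq A)) (g : Omega -> R) :
  measurable_fun setT (g : sigma_of Y S -> R) ->
  measurable ([set w | g w != 0] : set (sigma_of Y S)).
Proof.
move=> mg; rewrite (_ : [set _ | _] = g @^-1` (~` [set 0])); last first.
  by apply/seteqP; split => t /= /eqP.
by rewrite -[X in measurable X]setTI; apply: mg => //; exact: measurableC.
Qed.

Let mD n : measurable (D n : set (sigma_of Y (level n))).
Proof.
apply: measurableI; first by apply: mneq0; exact: measurable_mass.
by apply: measurableC; exact: measurable_exceeds.
Qed.

Let alive n w : {set n.-tuple A} := [set u : n.-tuple A | weight Y u w != 0]%SET.

(** Inside a cell the set of living words is fixed, so the children whose simultaneous death means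
    extinction form a fixed list of words outside [level n]. *)
Let cell n (U : {set n.-tuple A}) : set Omega := D n `&` [set w | alive n w = U].

Let mcell n (U : {set n.-tuple A}) : measurable (@cell n U : set (sigma_of Y (level n))).
Proof.
apply: measurableI => //.
rewrite (_ : [set w | alive n w = U] =
  \bigcap_(u in [set: n.-tuple A]) [set w | (weight Y u w != 0) = (u \in U)]).
  apply: fin_bigcap_measurable; first exact: finite_finset.
  move=> u _.
  have mu0 : measurable ([set w | weight Y u w != 0] : set (sigma_of Y (level n))).
    by apply: mneq0; apply: measurable_weight; rewrite size_tuple.
  case: (u \in U).
    by rewrite (_ : [set w | _] = [set w | weight Y u w != 0]) //; apply/seteqP; split.
  rewrite (_ : [set w | _] = ~` [set w | weight Y u w != 0]); first exact: measurableC.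
  by apply/seteqP; split => w /=; case: (weight Y u w != 0).
apply/seteqP; split => w /=.
  by move=> <- u _ /=; rewrite inE.
by move=> h; apply/setP => u; rewrite inE; exact: h.
Qed.

Let children n (U : {set n.-tuple A}) : seq (seq A) :=
  [seq rcons (val u) a | u <- enum U, a <- enum {: A}].

Let uniq_children n U : uniq (@children n U).
Proof.
apply: allpairs_uniq; [exact: enum_uniq|exact: enum_uniq|].
move=> [u a] [v c] _ _ /= /rcons_inj [uv ->].
by congr (_, _); exact: val_inj.
Qed.

Let size_children n U : size (@children n U) = (#|U| * b)%N.
Proof. by rewrite size_allpairs -!cardE card_ord prednK // ltnW. Qed.

Let children_level n U : {in @children n U, forall v, words v /\ ~ level n v}.
Proof.
move=> v /allpairsP[[u a] [_ _ ->]] /=; split; first by case: (val u).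
by move=> []; rewrite size_rcons size_tuple ltnn.
Qed.

Let mass_next0 n (U : {set n.-tuple A}) w :
  cell U w -> zeros Y (children U) w -> mass n.+1 w = 0.
Proof.
move=> [_ /= aw] /allP z; apply: big1 => v _.
have [u [a va]] : exists u a, val v = rcons u a.
  have := valP v; case/lastP: (val v) => // u a _.
  by exists u, a.
have su : size u == n by have := valP v; rewrite va size_rcons.
rewrite va weight_rcons.
have [uU|uU] := boolP (Tuple su \in U).
  have /z/eqP -> : rcons u a \in children U.
    by apply/allpairsP; exists (Tuple su, a); rewrite !mem_enum.
  by rewrite normr0 !mulr0.
move: uU; rewrite -aw inE negbK => /eqP /= ->.
by rewrite mul0r mulr0.
Qed.

(** For uniform nu all cylinders have positive mass, so mass 0 at time n means that every word of
    length n is dead, and with it all its descendants. *)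
Let D_next n : D n.+1 `<=` D n.
Proof.
move=> w [/= m1 e1]; split => /=.
  apply: contra_neq m1 => m0.
  have w0 (u : n.-tuple A) : weight Y u w = 0.
    have /eqP := m0; rewrite /mass psumr_eq0; last first.
      by move=> v _; rewrite mulr_ge0 ?cylmass_ge0 ?weight_ge0.
    move=> /allP /(_ u (mem_index_enum _)) /=.
    rewrite mulf_eq0 cylmass_uniform invr_eq0 expf_eq0 (negbTE b_neq0) andbF /=.
    by move=> /eqP.
  apply: big1 => v _.
  have [u [a va]] : exists u a, val v = rcons u a.
    have := valP v; case/lastP: (val v) => // u a _.
    by exists u, a.
  have su : size u == n by have := valP v; rewrite va size_rcons.
  by rewrite va weight_rcons (w0 (Tuple su)) mul0r mulr0.
apply: contra_not e1 => /hasP[m]; rewrite mem_iota => /= mn Km.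
apply/hasP; exists m => //; rewrite mem_iota /=.
by rewrite (ltn_trans mn).
Qed.

Let mT (S : set (seq A)) (B : set Omega) :
  measurable (B : set (sigma_of Y S)) -> measurable B.
Proof. exact: sigma_of_measurable. Qed.

Let sum_cells n : (\sum_(U : {set n.-tuple A}) P (cell U) = P (D n))%E.
Proof.
have mDT := mT (@mD n).
have -> : P (D n) = (\int[P]_w (\1_(D n) w)%:E)%E by rewrite integral_indic // setIT.
have E1 U : P (@cell n U) = (\int[P]_w (\1_(cell U) w)%:E)%E.
  by rewrite integral_indic ?setIT //; exact: (mT (@mcell _ U)).
under eq_bigr do rewrite E1.
rewrite -ge0_integral_sum //; last first.
  by move=> U; apply/measurable_EFinP; apply: measurable_indic; exact: (mT (@mcell _ U)).
apply: eq_integral => w _.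
rewrite sumEFin; congr EFin.
rewrite (bigD1 (alive n w)) //= big1 ?addr0 => [|U Uw].
  rewrite !indicE; suff -> : (w \in cell (alive n w)) = (w \in D n) by [].
  by apply/idP/idP; rewrite !inE => // -[].
by rewrite indicE memNset // => -[_ /= e]; rewrite e eqxx in Uw.
Qed.

(** A living word contributes b^(-n) b^n = 1 to the mass, which is below K on [D n]. *)
Let card_cell n U : P (@cell n U) != 0%E -> (#|U| <= K)%N.
Proof.
move=> cU.
have cU0 : (0 < P (cell U))%E by rewrite lt_neqAle eq_sym cU measure_ge0.
have [w [[_ Dw] /= aw] vw] := ae_exists (mT (@mcell _ U)) cU0 weight_values.
have mK : mass n w < K%:R.
  rewrite ltNge; apply/negP => Kw; apply: Dw; apply/hasP; exists n => //.
  by rewrite mem_iota /= ltnS.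
rewrite -(ler_nat R) ltW // (le_lt_trans _ mK) // /mass.
rewrite (bigID (mem U)) /= -[X in X <= _]addr0 lerD //; last first.
  by apply: sumr_ge0 => u _; rewrite mulr_ge0 ?cylmass_ge0 ?weight_ge0.
rewrite -sum1_card natr_sum; apply: ler_sum => u uU.
move: uU; rewrite -aw inE => wu.
case: (vw (val u)) => [w0|->]; first by rewrite w0 eqxx in wu.
by rewrite cylmass_uniform mulVf // expf_neq0.
Qed.

Let r : R := 1 - p0 ^+ (K * b).

(* On the event D n at most K individuals are alive, and all their children die
   with probability at least p0 ^ (K b). *)
Let D_decay n : (P (D n.+1) <= r%:E * P (D n))%E.
Proof.
have sub : D n.+1 `<=`
    \big[setU/set0]_(U : {set n.-tuple A}) (cell U `\` zeros Y (children U)).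
  move=> w Dw; rewrite -bigcup_seq /=; exists (alive n w); first exact: mem_index_enum.
  have cw : cell (alive n w) w by split => //; exact: D_next.
  by split => // z; case: Dw => /= /eqP + _; apply; exact: mass_next0 cw z.
have mz n' U : measurable (zeros Y (@children n' U)).
  have [m1 _] := independent_zeros Y_iid (S := set0) (B := setT) (fun _ => False_ind _)
    measurableT (uniq_children U) (fun v vc => conj (children_level vc).1 id).
  by have := mT m1; rewrite setTI.
have mcz n' U : measurable (@cell n' U `\` zeros Y (children U)).
  by apply: measurableD => //; exact: (mT (@mcell _ U)).
apply: (@le_trans _ _ (\sum_(U : {set n.-tuple A}) P (cell U `\` zeros Y (children U)))%E).
  apply: (@le_trans _ _ (P (\big[setU/set0]_(U : {set n.-tuple A})
      (cell U `\` zeros Y (children U))))).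
    apply: le_measure => //; rewrite inE; first exact: (mT (@mD n.+1)).
    by apply: bigsetU_measurable.
  (* The union bound by induction over the cells; measurability is carried along because the bound
     for two sets requires it. *)
  pose Q (s : set Omega) (m : \bar R) := measurable s /\ (P s <= m)%E.
  suff [] : Q (\big[setU/set0]_(U : {set n.-tuple A}) (cell U `\` zeros Y (children U)))
    (\sum_(U : {set n.-tuple A}) P (cell U `\` zeros Y (children U)))%E by [].
  apply: (big_rec2 Q); first by rewrite /Q measure0.
  move=> U s m _ [ms' sm]; split; first exact: measurableU.
  apply: (@le_trans _ _ (P (cell U `\` zeros Y (children U)) + P s)%E).
    exact: measureU2.
  exact: leeD2l.
rewrite -sum_cells ge0_sume_distrr //; apply: lee_sum => U _.
have [_ e] := independent_zeros Y_iid (S := level n) (fun v lv => lv.1)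
  (@mcell _ U) (uniq_children U) (@children_level n U).
have fc : P (cell U) \is a fin_num := fin_num_measure P _ (mT (@mcell _ U)).
have e1 : (P (cell U `\` zeros Y (children U)) =
    P (cell U) - P (cell U `&` zeros Y (children U)))%E.
  by apply: measureD => //; [exact: (mT (@mcell _ U))|rewrite -ge0_fin_numE].
rewrite e1 e X0 size_children -(fineK fc) -!EFinM -EFinB lee_fin.
have [c0|c0] := eqVneq (P (cell U)) 0%E; first by rewrite c0 /= mul0r mulr0 subrr.
have /= Uk := card_cell c0.
have : p0 ^+ (K * b) <= p0 ^+ (#|U| * b).
  by apply: ler_wiXn2l; [exact: ltW|exact: p0_le1|rewrite leq_mul2r Uk orbT].
have : 0 <= fine (P (cell U)) by rewrite fine_ge0.
by rewrite /r => h1 h2; nra.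
Qed.

Let r01 : 0 <= r < 1.
Proof.
rewrite /r; have : 0 < p0 ^+ (K * b) by rewrite exprn_gt0.
have : p0 ^+ (K * b) <= 1 by rewrite exprn_ile1 // ltW.
by move=> h1 h2; apply/andP; split; lra.
Qed.

Let D_le n : (P (D n) <= (r ^+ n)%:E)%E.
Proof.
have /andP[r0 _] := r01.
elim: n => [|n IH]; first by rewrite expr0; apply: probability_le1; exact: (mT (@mD 0%N)).
apply: (le_trans (D_decay n)); rewrite exprS EFinM.
by apply: lee_wpmul2l => //; rewrite lee_fin.
Qed.

(** The integrand is at most K on [D n] and 0 elsewhere, and the probability of [D n] decays
    geometrically. *)
Lemma bounded_mass_cvg0 :
  (\int[P]_w (mass n w * \1_(~` exceeds Y nu K%:R 0 n.+1) w)%:E)%E @[n --> \oo]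
      --> 0%E.
Proof.
have /andP[r0 r1] := r01.
have cv : (K%:R * r ^+ n)%:E @[n --> \oo] --> 0%E.
  apply: cvg_EFin; first exact: nearW.
  rewrite -(mulr0 K%:R); apply: cvgMl_tmp.
  by apply: cvg_expr; rewrite ger0_norm.
apply: (squeeze_cvge _ (cvg_cst 0%E) cv); apply: nearW => n; apply/andP; split.
  by apply: integral_ge0 => w _; rewrite lee_fin mulr_ge0 ?mass_ge0.
have mDT := mT (@mD n).
have m1 : measurable_fun setT (fun w => (\1_(D n) w : R)%:E).
  by apply/measurable_EFinP; exact: measurable_indic.
apply: (@le_trans _ _ (\int[P]_w (K%:R%:E * (\1_(D n) w)%:E))%E).
  apply: ge0_le_integral => //.
  - by move=> w _; rewrite lee_fin mulr_ge0 ?mass_ge0.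
  - apply/measurable_EFinP; apply: measurable_funM; first exact: measurable_massT.
    by apply: measurable_indic; apply: measurableC; exact: measurable_exceedsT.
  - exact: emeasurable_funM.
  move=> w _; rewrite -EFinM lee_fin !indicE.
  case: (boolP (w \in ~` _)) => [we|_]; last by rewrite mulr0 mulr_ge0.
  rewrite mulr1; have [->|m0] := eqVneq (mass n w) 0; first by rewrite mulr_ge0.
  rewrite mem_set ?mulr1; last by split => //; exact: set_mem.
  rewrite leNgt; apply/negP => Kw; move: we; rewrite inE; apply.
  by apply/hasP; exists n; [rewrite mem_iota /= ltnS|exact: ltW].
rewrite ge0_integralZl // integral_indic // setIT EFinM.
by apply: lee_wpmul2l; [rewrite lee_fin|exact: D_le].
Qed.

End threshold.

Lemma critical_mass_cvg0 : {ae P, forall w, mass n w @[n --> \oo] --> (0 : R)}.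
Proof. by apply: (mass_cvg0 X_ge0 EX Y_iid) => k k0; exact: bounded_mass_cvg0. Qed.

End critical_branching.

Section uniform_entropy.
Variables (b : nat) (R : realType).
Hypothesis b_gt0 : (0 < b)%N.
Variable nu : probability (seqspace b) R.

Lemma entropy_uniform : is_uniform nu -> entropy nu = ln b%:R.
Proof.
move=> unif; have b0 : 0 < b%:R :> R by rewrite ltr0n.
apply: cvg_lim => //.
apply: (@cvg_trans _ (cst (ln b%:R) @ \oo)); last exact: cvg_cst.
apply: near_eq_cvg; exists 1%N => // n /= n0.
have n0' : n%:R != 0 :> R by rewrite pnatr_eq0 -lt0n.
rewrite (eq_bigr (fun=> b%:R ^- n * (n%:R * ln b%:R))); last first.
  move=> u _; have -> : cylmass nu u = b%:R ^- n.
    by apply: EFin_inj; rewrite -cylmassE unif size_tuple.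
  by rewrite lnV ?posrE ?exprn_gt0 // mulrN opprK lnXn // mulr_natl.
rewrite sumr_const card_tuple card_ord prednK // -(mulr_natl _ (b ^ n)) natrX.
by rewrite [X in _ * X]mulrA mulfV ?expf_neq0 ?gt_eqF // mul1r mulrA mulVf // mul1r.
Qed.

End uniform_entropy.

Unset Implicit Arguments.

Theorem theorem2p8 (R : realType) (b : nat) (hb : (2 <= b)%N)
    (d : measure_display) (Omega : measurableType d)
    (P : probability Omega R)
    (d' : measure_display) (Omega' : measurableType d')
    (P' : probability Omega' R)
    (X : {RV P' >-> R})
    (X_ge0 : forall w, 0 <= X w)
    (EX : ('E_P'[X] = 1)%E)
    (X_neq1 : (0 < P' [set w | (X w != 1)%R])%E)
    (Xu : seq (alphabet b) -> {RV P >-> R})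
    (Xu_iid : iid_copies X [set u : seq (alphabet b) | u != [::]] Xu)
    (nu : probability (seqspace b) R)
    (nu_ergodic : shift_ergodic nu)
    (nuG : propG nu)
    (nuGtilde : is_Q_alpha X (entropy nu) -> propGtilde nu)
    (hh : (entropy nu)%:E = hX X) :
  Q_singular Xu nu.
Proof.
have b_gt0 : (0 < b)%N by exact: ltnW.
have EX' : (\int[P']_t (X t)%:E = 1)%E by move: EX; rewrite unlock.
have EXlnX : (\int[P']_t (X t * ln (X t))%:E = (entropy nu)%:E)%E.
  by rewrite hh /hX unlock.
apply: Q_singular_mass.
have [[a [c [ac Pa Pc]]]|deg] := size_biased_log_dichotomy X_ge0 EX' EXlnX.
- have [C [f fG]] := nuG.
  have [g [h [mg mh ih eh low]]] := gibbs_potential_integrable b_gt0 nu_ergodic fG.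
  apply: (mass_ae_cvg0 X_ge0 EX' Xu_iid mg mh low).
  apply: (killed_cvg0 (@measurable_left_shift b) nu_ergodic.1 nu_ergodic.2 X_ge0
    EX' mh ih (integrable_xlnx X_ge0 EXlnX) _ ac Pa Pc).
  by rewrite eh EXlnX -EFinD addNr.
have XQ := degenerate_weight X_ge0 EX' X_neq1 deg.
have [unif|nunif] := pselect (is_uniform nu); last first.
  (* The pair C, f is taken from property (G~) and not from [nuG], since the limsup concerns that
     particular f. *)
  have [C [f [fG lim]]] := nuGtilde XQ.
  exact: (degenerate_mass_cvg0 X_ge0 EX' Xu_iid deg fG (lim nunif)).
have [_ Xb X0] := XQ.
rewrite (entropy_uniform b_gt0 unif) in X0.
have b1 : 1 < b%:R :> R by rewrite ltr1n.
have b0 : expR (ln b%:R) = b%:R :> R by rewrite lnK // posrE; lra.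
have e : expR (- ln b%:R) = b%:R^-1 :> R by rewrite expRN lnK // posrE; lra.
rewrite (entropy_uniform b_gt0 unif) in Xb; rewrite ?b0 !e in Xb X0.
have [bi0 bi1] : 0 < (b%:R^-1 : R) /\ (b%:R^-1 : R) < 1.
  by rewrite invr_gt0 invf_lt1; lra.
(* X equals b with probability 1 / b and 0 with probability 1 - 1 / b. A living word has b children,
   so on average one of them lives: the population is critical. *)
apply: (@critical_mass_cvg0 _ _ hb _ _ _ _ _ _ _ _ X_ge0 EX' Xu_iid (1 - b%:R^-1)
  _ _ X0 _ _ unif); [lra|lra|].
by rewrite Xb; congr EFin; ring.
Qed.
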